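(* Let $m\in\frac52+\mathbb Z_{\geq0}$, let $\Gamma$ be a discrete subgroup of finite covolume in $\mathrm{SL}_2(\mathbb R)^\sim$ such that $\infty$ is a cusp of $P(\Gamma)$, and let $\chi:\Gamma\to\mathbb C^\times$ be a character of finite order such that $\eta_\gamma^{-2m}=\chi(\gamma)$ for all $\gamma\in\Gamma_\infty$. Let $h\in\mathbb R_{>0}$ be such that $Z(\mathrm{SL}_2(\mathbb R)^\sim)\Gamma_\infty=Z(\mathrm{SL}_2(\mathbb R)^\sim)\langle n_h\rangle$, and let $$N:=\inf\left\{|c|:\begin{pmatrix}a&b\\c&d\end{pmatrix}\in P(\Gamma\setminus\Gamma_\infty)\right\}.$$ Suppose that $$m\geq\frac{4\pi}{Nh}+\frac83.$$ Let $s\in\mathbb C$ with $1<\Re(s)<\frac m2$. If $$e^{\frac\pi2|\Im(s)|}\,\Gamma\!\left(\frac{\Re(s)+1}2\right)\Gamma\!\left(\frac{\Re(s)-1}2\right)\frac{2^{\frac m2-1}}{\Gamma\left(\frac m2-1\right)}\cdot\frac{\left(\frac{\pi}{Nh}\right)^{\frac m2-\Re(s)}}{\frac m2-\Re(s)}\leq\pi,$$ then $\Psi_{\Gamma,m,\chi,s}\not\equiv0$.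
   Context: $\mathcal H=\{z\in\mathbb C:\Im(z)>0\}$, and $\mathrm{SL}_2(\mathbb R)$ acts on $\mathbb C\cup\{\infty\}$ by $g.z=\frac{az+b}{cz+d}$. The metaplectic cover $\mathrm{SL}_2(\mathbb R)^\sim$ is the group of pairs $\sigma=(g_\sigma,\eta_\sigma)$ with $g_\sigma=\begin{pmatrix}a_\sigma&b_\sigma\\c_\sigma&d_\sigma\end{pmatrix}\in\mathrm{SL}_2(\mathbb R)$ and $\eta_\sigma:\mathcal H\to\mathbb C$ holomorphic with $\eta_\sigma(z)^2=c_\sigma z+d_\sigma$; multiplication is $\sigma_1\sigma_2=(g_{\sigma_1}g_{\sigma_2},\eta_{\sigma_1}(g_{\sigma_2}.z)\eta_{\sigma_2}(z))$. It is a connected Lie group for which $P:\sigma\mapsto g_\sigma$ is a smooth covering homomorphism of degree 2 onto $\mathrm{SL}_2(\mathbb R)$; it acts through $P$, $\sigma.z:=g_\sigma.z$. $Z(\mathrm{SL}_2(\mathbb R)^\sim)=P^{-1}(\{\pm I_2\})$ is its center. For $x\in\mathbb R$, $n_x:=\left(\begin{pmatrix}1&x\\0&1\end{pmatrix},1\right)$. A cusp of $P(\Gamma)$ is a point of $\mathbb R\cup\{\infty\}$ fixed by a parabolic element of $P(\Gamma)$; $\Gamma_\infty:=\{\gamma\in\Gamma:\gamma.\infty=\infty\}$. The condition $\eta_\gamma^{-2m}=\chi(\gamma)$ means that $\eta_\gamma^{-2m}$ is the constant function $\chi(\gamma)$. It is known that $hN\geq1$; in particular $N>0$. For $f:\mathcal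 H\to\mathbb C$, $(f|_m\sigma)(z):=f(g_\sigma.z)\eta_\sigma(z)^{-2m}$. For $z\in\mathcal H$, $s\in\mathbb C$, let $F(z,s):=\sum_{n=1}^\infty n^{s-1}e^{2\pi inz/h}$. For $1<\Re(s)<\frac m2$, $$\Psi_{\Gamma,m,\chi,s}:=\sum_{\gamma\in\Gamma_\infty\backslash\Gamma}\overline{\chi(\gamma)}\,F(\,\cdot\,,s)\big|_m\gamma,$$ a series which converges absolutely and uniformly on compact sets in $\mathcal H$. $\Gamma(\cdot)$ applied to a number denotes the gamma function. *)

(* Defs.v *)
From HB Require Import structures.
From mathcomp Require Import all_boot all_order all_algebra.
From mathcomp Require Import all_classical all_reals all_analysis.
From mathcomp Require Import complex ring.
From mathcomp Require summability.

Set Implicit Arguments.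
Unset Strict Implicit.
Unset Printing Implicit Defensive.

Import Order.TTheory GRing.Theory Num.Theory.
Import numFieldNormedType.Exports.

Local Open Scope classical_set_scope.
Local Open Scope ring_scope.
Local Open Scope complex_scope.

Section UpperHalfPlane.
Context {R : realType}.

Record uhp := Uhp { uhp_val :> R[i]; uhp_valP : 0 < complex.Im uhp_val }.

HB.instance Definition _ := [isSub for uhp_val].
HB.instance Definition _ := [Choice of uhp by <:].

(* Complex differentiability is a library notion only for maps on the whole
   of [R[i]^o]; as [uhp] is open, the extension by zero has the same
   derivatives there. *)
Definition uhp_ext (f : uhp -> R[i]) (z : R[i]) : R[i] :=
  if insub z is Some w then f w else 0.

Definition holomorphic (f : uhp -> R[i]) : Prop :=
  forall z : uhp, derivable (uhp_ext f : R[i]^o -> R[i]^o) (z : R[i]) 1.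

Lemma uhp_i_subproof : 0 < complex.Im ('i%C : R[i]).
Proof. exact: ltr01. Qed.

Definition uhp_i : uhp := Uhp uhp_i_subproof.

Lemma uhp_extE (f : uhp -> R[i]) (z : uhp) : uhp_ext f z = f z.
Proof. by rewrite /uhp_ext valK. Qed.

End UpperHalfPlane.
Arguments uhp R : clear implicits.

Section SL2.
Context {R : realType}.

Record SL2 := MkSL2 { SL2_val :> 'M[R]_2; SL2_valP : \det SL2_val == 1 }.

HB.instance Definition _ := [isSub for SL2_val].
HB.instance Definition _ := [Choice of SL2 by <:].

Definition SL2_one := @MkSL2 1%:M (introT eqP (det1 R 2)).

Lemma SL2_mul_subproof (g h : SL2) : \det (SL2_val g *m SL2_val h) == 1.
Proof. by rewrite det_mulmx (eqP (SL2_valP g)) (eqP (SL2_valP h)) mulr1. Qed.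

Definition SL2_mul (g h : SL2) := MkSL2 (SL2_mul_subproof g h).

Lemma SL2_inv_subproof (g : SL2) : \det (invmx (SL2_val g)) == 1.
Proof. by rewrite det_inv (eqP (SL2_valP g)) invr1. Qed.

Definition SL2_inv (g : SL2) := MkSL2 (SL2_inv_subproof g).

Lemma SL2_unit (g : SL2) : SL2_val g \in unitmx.
Proof. by rewrite unitmxE (eqP (SL2_valP g)) unitr1. Qed.

Lemma SL2_mulA : associative SL2_mul.
Proof. by move=> x y z; apply: val_inj; rewrite /= mulmxA. Qed.

Lemma SL2_mul1 : left_id SL2_one SL2_mul.
Proof. by move=> x; apply: val_inj; rewrite /= mul1mx. Qed.

Lemma SL2_mulx1 : right_id SL2_one SL2_mul.
Proof. by move=> x; apply: val_inj; rewrite /= mulmx1. Qed.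

Lemma SL2_mulV : left_inverse SL2_one SL2_inv SL2_mul.
Proof. by move=> x; apply: val_inj; rewrite /= mulVmx // SL2_unit. Qed.

Lemma SL2_mulxV : right_inverse SL2_one SL2_inv SL2_mul.
Proof. by move=> x; apply: val_inj; rewrite /= mulmxV // SL2_unit. Qed.

HB.instance Definition _ :=
  isGroup.Build SL2 SL2_mulA SL2_mul1 SL2_mulx1 SL2_mulV SL2_mulxV.

End SL2.
Arguments SL2 R : clear implicits.

Section Mobius.
Context {R : realType}.
Implicit Types (g h : SL2 R) (z : uhp R).

Definition mobius_num g (z : R[i]) : R[i] := (g 0 0)%:C * z + (g 0 1)%:C.
Definition mobius_den g (z : R[i]) : R[i] := (g 1 0)%:C * z + (g 1 1)%:C.

(* The action on the Riemann sphere; [None] is the point at infinity. *)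
Definition mobius g (x : option R[i]) : option R[i] :=
  match x with
  | Some z => if mobius_den g z == 0 then None
              else Some (mobius_num g z / mobius_den g z)
  | None => if g 1 0 == 0 then None else Some ((g 0 0 / g 1 0)%:C)
  end.

Lemma sum2E (V : nmodType) (F : 'I_2 -> V) : \sum_i F i = F 0 + F 1.
Proof.
by rewrite 2!big_ord_recl big_ord0 addr0; congr (F _ + F _); apply: val_inj.
Qed.

Lemma det_mx22 (A : 'M[R]_2) : \det A = A 0 0 * A 1 1 - A 0 1 * A 1 0.
Proof.
rewrite (expand_det_row _ 0) sum2E /cofactor !det_mx11 !mxE /= expr0 expr1.
rewrite mul1r mulN1r mulrN.
by congr (_ * A _ _ - _ * A _ _); apply: val_inj.
Qed.

Lemma SL2_detE g : g 0 0 * g 1 1 - g 0 1 * g 1 0 = 1.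
Proof. by rewrite -det_mx22 (eqP (SL2_valP g)). Qed.

Lemma mobius_den_neq0 g z : mobius_den g z != 0.
Proof.
have := uhp_valP z; rewrite /mobius_den; case: (uhp_val z) => x y /= y0.
apply/negP => /eqP/eqP; rewrite eq_complex /= => /andP[/eqP e1 /eqP e2].
have {e2} : g 1 0 * y = 0 by rewrite -[RHS]e2; ring.
move/eqP; rewrite mulf_eq0 (gt_eqF y0) orbF => /eqP c0.
have d0 : g 1 1 = 0 by rewrite -[RHS]e1 c0; ring.
by have := SL2_detE g; rewrite c0 d0 !mulr0 subr0 => /eqP; rewrite eq_sym oner_eq0.
Qed.

Lemma Im_mobius g (x y : R) :
  complex.Im (mobius_num g (x +i* y) / mobius_den g (x +i* y)) =
  y / ((g 1 0 * x + g 1 1) ^+ 2 + (g 1 0 * y) ^+ 2).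
Proof.
rewrite /mobius_num /mobius_den /= !mul0r !subr0 !addr0.
set n := (g 1 0 * x + _) ^+ 2 + _.
rewrite -[in RHS](mulr1 y) -(SL2_detE g); ring.
Qed.

Lemma mobius_uhp_subproof g z :
  0 < complex.Im (mobius_num g z / mobius_den g z).
Proof.
have := uhp_valP z; have := mobius_den_neq0 g z.
case: (uhp_val z) => x y nz; rewrite Im_mobius /= => y0; rewrite divr_gt0 //.
rewrite lt0r addr_ge0 ?sqr_ge0 // andbT; apply: contra nz.
rewrite paddr_eq0 ?sqr_ge0 // !sqrf_eq0 => /andP[/eqP e1 /eqP e2].
rewrite eq_complex /=; apply/andP; split; apply/eqP.
  by rewrite -[RHS]e1; ring.
by rewrite -[RHS]e2; ring.
Qed.

Definition act g z : uhp R := Uhp (mobius_uhp_subproof g z).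

Lemma mobius_Some g z : mobius g (Some (z : R[i])) = Some (act g z : R[i]).
Proof. by rewrite /= (negbTE (mobius_den_neq0 g z)). Qed.

Lemma SL2_mulE g h i j : (g * h)%g i j = g i 0 * h 0 j + g i 1 * h 1 j.
Proof. by rewrite mxE sum2E. Qed.

Lemma SL2_1E i j : (1%g : SL2 R) i j = (i == j)%:R.
Proof. by rewrite mxE. Qed.

Lemma mobius_den1 z : mobius_den 1%g z = 1.
Proof. by rewrite /mobius_den !SL2_1E mul0r add0r. Qed.

Lemma act1 z : act 1%g z = z.
Proof.
apply: val_inj => /=; rewrite mobius_den1 divr1 /mobius_num !SL2_1E.
by rewrite mul1r addr0.
Qed.

Lemma mobius_denM g h z :
  mobius_den (g * h)%g z = mobius_den g (act h z) * mobius_den h z.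
Proof.
have nz := mobius_den_neq0 h z.
rewrite {1 2}/mobius_den /= mulrDl mulrA mulfVK // !SL2_mulE /mobius_num.
by rewrite /mobius_den !rmorphD !rmorphM /=; ring.
Qed.

Lemma actM g h z : act (g * h)%g z = act g (act h z).
Proof.
apply: val_inj => /=; rewrite mobius_denM [in RHS]/mobius_num /=.
have nz := mobius_den_neq0 h z; have nz' := mobius_den_neq0 g (act h z).
apply: (mulIf nz'); apply: (mulIf nz); rewrite !mulfVK // -mulrA mulfVK ?mulf_neq0 //.
rewrite mulrDl mulrA mulfVK // !/mobius_num !SL2_mulE.
by rewrite /mobius_den !rmorphD !rmorphM /=; ring.
Qed.

End Mobius.

Section Holomorphic.
Context {R : realType}.
Local Notation C := (R[i]^o).
Implicit Types (f g : uhp R -> R[i]) (z : uhp R).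

Lemma Im_le_norm (x : R[i]) : (`|complex.Im x|)%:C <= `|x|.
Proof.
case: x => a b; rewrite normc_def /= lecR -sqrtr_sqr ler_sqrt.
  by rewrite lerDr sqr_ge0.
by rewrite addr_ge0 ?sqr_ge0.
Qed.

Lemma uhp_near z : \forall w \near (z : C), 0 < complex.Im w.
Proof.
have y0 := uhp_valP z; apply/nbhs_ballP; exists (complex.Im z)%:C => /=.
  by rewrite ltcR.
move=> w; rewrite -ball_normE /= => /(le_lt_trans (Im_le_norm _)).
rewrite ltcR; case: (uhp_val z) w => x y [u v] /=.
by rewrite ltr_norml => /andP[_]; rewrite ltrBlDr ltrDl.
Qed.

Lemma holomorphic_near f (F : C -> C) :
  (forall z, f z = F (z : R[i])) ->
  (forall z, derivable F (z : R[i]) 1) -> holomorphic f.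
Proof.
move=> fF dF z; apply: near_eq_derivable (dF z).
near=> w; have w0 : 0 < complex.Im w by near: w; exact: uhp_near.
by rewrite -[w]/(uhp_val (Uhp w0)) uhp_extE fF.
Unshelve. all: by end_near. Qed.

Lemma holomorphic_cst (c : R[i]) : holomorphic (fun=> c : R[i]).
Proof. by apply: (holomorphic_near (F := cst c)) => // z; exact: derivable_cst. Qed.

Lemma holomorphicM f g :
  holomorphic f -> holomorphic g -> holomorphic (fun z => f z * g z).
Proof.
move=> hf hg; apply: (holomorphic_near (F := (uhp_ext f : C -> C) * (uhp_ext g : C -> C))).
  by move=> z; rewrite /= -[in LHS](uhp_extE f) -[in LHS](uhp_extE g).
by move=> z; apply: derivableM.
Qed.

Lemma holomorphicV f :
  (forall z, f z != 0) -> holomorphic f -> holomorphic (fun z => (f z)^-1).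
Proof.
move=> f0 hf; apply: (holomorphic_near (F := fun z : C => (uhp_ext f z)^-1)).
  by move=> z; rewrite uhp_extE.
by move=> z; apply: derivableV; rewrite ?uhp_extE.
Qed.

Lemma holomorphic_act f (g : SL2 R) :
  holomorphic f -> holomorphic (fun z => f (act g z)).
Proof.
move=> hf.
pose M (w : C) : C := mobius_num g w / mobius_den g w.
apply: (holomorphic_near (F := (uhp_ext f : C -> C) \o M)).
  by move=> z /=; rewrite -[in LHS](uhp_extE f).
move=> z; apply/derivable1_diffP; apply: differentiable_comp.
  apply/derivable1_diffP; apply: derivableM; last apply: derivableV.
  - apply: derivableD; last exact: derivable_cst.
    by apply: derivableM; [exact: derivable_cst|exact: derivable_id].
  - exact: mobius_den_neq0.
  - apply: derivableD; last exact: derivable_cst.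
    by apply: derivableM; [exact: derivable_cst|exact: derivable_id].
by apply/derivable1_diffP; exact: (hf (act g z)).
Qed.

End Holomorphic.
Arguments holomorphic_cst {R} c.
Arguments holomorphic_act {R f} g.
Arguments holomorphicM {R f g}.
Arguments holomorphicV {R f}.

Section Metaplectic.
Context {R : realType}.

Record Mp2 := MkMp2 {
  Mp2_proj : SL2 R;
  Mp2_eta : uhp R -> R[i];
  Mp2_holo : holomorphic Mp2_eta;
  Mp2_sqr : forall z, Mp2_eta z ^+ 2 = mobius_den Mp2_proj z }.
Arguments Mp2_holo : clear implicits.

Implicit Types (s t : Mp2) (z : uhp R).

Lemma Mp2_eq s t :
  Mp2_proj s = Mp2_proj t -> Mp2_eta s =1 Mp2_eta t -> s = t.
Proof.
case: s t => [g e he se] [g' e' he' se'] /= gE /funext eE.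
by subst g' e'; rewrite (Prop_irrelevance he he') (Prop_irrelevance se se').
Qed.

HB.instance Definition _ := gen_eqMixin Mp2.
HB.instance Definition _ := gen_choiceMixin Mp2.

Lemma Mp2_eta_neq0 s z : Mp2_eta s z != 0.
Proof. by rewrite -sqrf_eq0 Mp2_sqr mobius_den_neq0. Qed.

Lemma Mp2_one_sqr z : 1 ^+ 2 = mobius_den (1%g : SL2 R) z.
Proof. by rewrite mobius_den1 expr1n. Qed.

Definition Mp2_one := MkMp2 (holomorphic_cst 1) Mp2_one_sqr.

Lemma Mp2_mul_sqr s t z :
  (Mp2_eta s (act (Mp2_proj t) z) * Mp2_eta t z) ^+ 2 =
  mobius_den (Mp2_proj s * Mp2_proj t)%g z.
Proof. by rewrite exprMn !Mp2_sqr mobius_denM. Qed.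

Definition Mp2_mul s t :=
  MkMp2 (holomorphicM (holomorphic_act (Mp2_proj t) (Mp2_holo s))
           (Mp2_holo t)) (Mp2_mul_sqr s t).

Lemma Mp2_inv_sqr s z :
  (Mp2_eta s (act (Mp2_proj s)^-1%g z))^-1 ^+ 2 =
  mobius_den (Mp2_proj s)^-1%g z.
Proof.
apply: (mulfI (mobius_den_neq0 (Mp2_proj s) (act (Mp2_proj s)^-1%g z))).
by rewrite -mobius_denM mulgV mobius_den1 exprVn Mp2_sqr divff // mobius_den_neq0.
Qed.

Definition Mp2_inv s :=
  MkMp2 (holomorphicV (fun z => Mp2_eta_neq0 s (act (Mp2_proj s)^-1%g z))
           (holomorphic_act _ (Mp2_holo s))) (Mp2_inv_sqr s).

Lemma Mp2_mulA : associative Mp2_mul.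
Proof. by move=> s t u; apply: Mp2_eq => [|z] /=; rewrite ?mulgA ?actM ?mulrA. Qed.

Lemma Mp2_mul1 : left_id Mp2_one Mp2_mul.
Proof. by move=> s; apply: Mp2_eq => [|z] /=; rewrite ?mul1g ?mul1r. Qed.

Lemma Mp2_mulx1 : right_id Mp2_one Mp2_mul.
Proof. by move=> s; apply: Mp2_eq => [|z] /=; rewrite ?mulg1 ?act1 ?mulr1. Qed.

Lemma Mp2_mulV : left_inverse Mp2_one Mp2_inv Mp2_mul.
Proof.
move=> s; apply: Mp2_eq => [|z] /=; first by rewrite mulVg.
by rewrite -actM mulVg act1 mulVf // Mp2_eta_neq0.
Qed.

Lemma Mp2_mulxV : right_inverse Mp2_one Mp2_inv Mp2_mul.
Proof.
move=> s; apply: Mp2_eq => [|z] /=; first by rewrite mulgV.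
by rewrite mulfV // Mp2_eta_neq0.
Qed.

HB.instance Definition _ :=
  isGroup.Build Mp2 Mp2_mulA Mp2_mul1 Mp2_mulx1 Mp2_mulV Mp2_mulxV.

(* [s] is determined by its matrix and the value of its [eta] at [i], and
   [Mp2_emb] identifies [Mp2] with the closed subset
   [w ^+ 2 = c * 'i + d], [\det g = 1] of [M_2(R) * C]: the double cover of
   SL_2(R) with its Lie group topology. *)
Definition Mp2_emb s : 'M[R]_2 * R[i]^o :=
  (SL2_val (Mp2_proj s), Mp2_eta s uhp_i).

HB.instance Definition _ := isPointed.Build Mp2 1%g.
HB.instance Definition _ := Topological.copy Mp2 (initial_topology Mp2_emb).

Definition upper_unip_mx (x : R) : 'M[R]_2 :=
  \matrix_(i, j) (if i == j then 1 else if i == 0 then x else 0).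

Lemma upper_unip_det (x : R) : \det (upper_unip_mx x) == 1.
Proof. by rewrite det_mx22 !mxE /= mulr0 subr0 mulr1. Qed.

Definition upper_unip (x : R) : SL2 R := MkSL2 (upper_unip_det x).

Lemma Mp2_n_sqr (x : R) z : 1 ^+ 2 = mobius_den (upper_unip x) z.
Proof. by rewrite /mobius_den !mxE /= mul0r add0r expr1n. Qed.

Definition Mp2_n (x : R) : Mp2 := MkMp2 (holomorphic_cst 1) (Mp2_n_sqr x).

(* The center of the group is the preimage of [{I, - I}]. *)
Definition Mp2_center : set Mp2 :=
  [set s | SL2_val (Mp2_proj s) = 1%:M \/ SL2_val (Mp2_proj s) = - 1%:M].

Definition cyclic_subgroup (s : Mp2) : set Mp2 :=
  [set t | exists k, t = (s ^+ k)%g \/ t = (s ^- k)%g].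

Definition set_mulg (A B : set Mp2) : set Mp2 :=
  [set (s * t)%g | s in A & t in B].

Definition is_subgroup (G : set Mp2) : Prop :=
  G 1%g /\ forall s t, G s -> G t -> G (s / t)%g.

Definition discrete_set (G : set Mp2) : Prop := G `<=` isolated G.

Definition Mp2_borel := g_sigma_algebraType (open : set (set Mp2)).

(* Finiteness on compact sets is enough regularity, as [Mp2] is locally
   compact and second countable. *)
Definition is_haar (mu : {measure set Mp2_borel -> \bar R}) : Prop :=
  [/\ (mu setT != 0)%E,
      (forall K : set Mp2, compact K -> (mu K < +oo)%E) &
      (forall (s : Mp2) (A : set Mp2_borel), measurable A ->
         mu [set (s * t)%g | t in (A : set Mp2)] = mu A)].

(* The Haar measure of a Borel set meeting every orbit [G s] exactly once is
   the invariant volume of the quotient by [G]. *)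
Definition finite_covolume (G : set Mp2) : Prop :=
  exists mu : {measure set Mp2_borel -> \bar R}, is_haar mu /\
  exists D : set Mp2_borel, [/\ measurable D,
    (forall s : Mp2, exists! t : Mp2,
       D t /\ exists2 g, G g & t = (g * s)%g) &
    (mu D < +oo)%E].

Definition parabolic (g : SL2 R) : Prop :=
  [/\ SL2_val g <> 1%:M, SL2_val g <> - 1%:M & `|\tr (SL2_val g)| = 2].

Definition is_cusp (H : set (SL2 R)) (x : option R[i]) : Prop :=
  (if x is Some w then complex.Im w = 0 else True) /\
  exists g, [/\ H g, parabolic g & mobius g x = x].

Definition stab_infty (G : set Mp2) : set Mp2 :=
  G `&` [set s | mobius (Mp2_proj s) None = None].

Definition finite_order_character (G : set Mp2) (chi : Mp2 -> R[i]) : Prop :=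
  [/\ (forall s, G s -> chi s != 0),
      (forall s t, G s -> G t -> chi (s * t)%g = chi s * chi t) &
      (exists2 k, (0 < k)%N & forall s, G s -> chi s ^+ k = 1)].

Definition min_lower_entry (G : set Mp2) : R :=
  inf [set `|SL2_val g 1 0| | g in Mp2_proj @` (G `\` stab_infty G)].

End Metaplectic.
Arguments Mp2 R : clear implicits.

Section PoincareSeries.
Context {R : realType}.

(* Euler's integral, meaningful for [0 < x] *)
Definition Gamma_fun (x : R) : R :=
  \int[lebesgue_measure]_(t in `]0, +oo[) (t `^ (x - 1) * expR (- t)).

Definition cexp (z : R[i]) : R[i] :=
  let: x +i* y := z in (expR x * cos y) +i* (expR x * sin y).

Definition natpowc (n : nat) (w : R[i]) : R[i] := cexp (w * (ln n%:R)%:C).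

(* [w] stands for the odd integer [2 * m] *)
Definition slash (w : nat) (f : uhp R -> R[i]) (s : Mp2 R) (z : uhp R) : R[i] :=
  f (act (Mp2_proj s) z) * Mp2_eta s z ^- w.

Definition Fseries (h : R) (s : R[i]) (z : uhp R) : R[i] :=
  limn ((fun N => \sum_(1 <= n < N)
    natpowc n (s - 1) * cexp ((2 * pi * n%:R / h)%:C * 'i%C * (z : R[i])))
    : nat -> R[i]^o).

Definition right_cosets (H G : set (Mp2 R)) : set (set (Mp2 R)) :=
  [set [set (t * g)%g | t in H] | g in G].

(* Each coset [stab_infty G * g] contributes the term of a chosen
   representative. Where [eta ^- w = chi] on [stab_infty G] and [h] is the
   width of the cusp, the term does not depend on the choice. The sum over
   the cosets is the limit along finite sets of cosets. *)
Definition Psi (G : set (Mp2 R)) (w : nat) (chi : Mp2 R -> R[i]) (h : R)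
    (s : R[i]) (z : uhp R) : R[i] :=
  summability.sum
    (fun A : (right_cosets (stab_infty G) G : set (set (Mp2 R))) =>
      let g := xget 1%g (val A) in
      ((chi g)^*%C * slash w (Fseries h s) g z) : R[i]^o).

End PoincareSeries.

(* Main.v *)
(* Suppose Psi = 0.  Then at every z the coset of 1 is compensated by the other
   cosets, so phi z = |F z| (Im z)^(m/2) is at most the sum of phi (g z) over
   the cosets of the g with nonzero lower left entry.  Such a g maps the strip
   0 <= x < h, 1/N < y below the height 1/N, and the images are disjoint modulo
   translations by h.  Integrating over the strip for dx dy / y^2 and unfolding,
   the integral of phi over the strip is at most the integral of phi over
   0 <= x < h, y <= 1/N.

   The first Fourier coefficient of F bounds the left side below by
   h (h / 2 pi)^k times the incomplete gamma integral from 2 pi / (N h), with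
   k = m/2 - 1.  This exceeds half of Gamma k because the median of the gamma
   distribution is greater than k - 1/3, where m >= 4 pi / (N h) + 8/3 enters.

   For the right side, n^(s-1) is the limit, as p tends to infinity, of the
   ratio of the coefficients of (1 - q)^(-s) at p n and at p, and (1 - q)^(-s)
   is the square of (1 - q)^(-s/2).  Averaging over the p-th roots of q picks
   every p-th coefficient, and Parseval over roots of unity then bounds the mean
   of |F| on a horizontal line by a sum of squares comparable to the
   coefficients of (1 - r^2)^(1 - Re s).  Legendre's duplication formula turns
   the resulting constant into that of the assumed inequality, which makes the
   right side at most half of h (h / 2 pi)^k Gamma k, a contradiction.

   That N > 0 is Shimizu's lemma: if 0 < |c| h < 1, iterated commutators of g
   with the translation by h converge to 1 in a discrete group. *)
Require Import Defs.
From HB Require Import structures.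
From mathcomp Require Import all_boot all_order all_algebra finmap.
From mathcomp Require Import all_classical all_reals all_analysis.
From mathcomp Require Import complex measurable_realfun ring lra zify.
From mathcomp Require summability.

Set Implicit Arguments.
Unset Strict Implicit.
Unset Printing Implicit Defensive.

Import Order.TTheory GRing.Theory Num.Theory.
Import numFieldNormedType.Exports.

Local Open Scope classical_set_scope.
Local Open Scope ring_scope.

(** * Substitutions in Lebesgue integrals *)

(** The mean of |F| over a horizontal line is an L1 mean, out of reach of Parseval. Approximating F
    by averages of a square P^2 turns it into an L2 mean of P, which Parseval evaluates exactly. To
    stay with polynomials, the integral over a period is rewritten as an integral of averages over M
    equally spaced shifts; p tends to infinity at fixed M, and M only afterwards. For complex s, the
    squared moduli of the coefficients exceed those for Re s by a product over j of factors
    depending on Im s. The product for s / 2 in the numerator is at most |s| / Re s times the square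
    root of the one for s, which the denominator cancels in the limit; what remains is |s| / Re s,
    at most exp (pi |Im s| / 2). The sum Psi is handled through its majorant: where the majorant of
    the other cosets is infinite the pointwise inequality is trivial, and where it is finite the sum
    converges absolutely. *)

Section Density.
Local Open Scope ereal_scope.
Context d (T : measurableType d) (R : realType).
Variables (mu : {measure set T -> \bar R}) (w : T -> R).
Hypotheses (mw : measurable_fun setT w) (w0 : forall x, (0 <= w x)%R).

(** Serves the measure dy / y on the positive half line, whose image under [ln] is Lebesgue
    measure. *)
Definition density_measure (A : set T) : \bar R := \int[mu]_(x in A) (w x)%:E.

Let mwE : measurable_fun setT (EFin \o w).
Proof. exact/measurable_EFinP. Qed.

Let density0 : density_measure set0 = 0.
Proof. exact: integral_set0. Qed.

Let density_ge0 A : 0 <= density_measure A.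
Proof. by apply: integral_ge0 => x _; rewrite lee_fin. Qed.

Let density_sigma_additive : semi_sigma_additive density_measure.
Proof.
move=> F mF tF mUF; rewrite /density_measure ge0_integral_bigcup//.
- by apply: is_cvg_nneseries => n _ _; exact: density_ge0.
- exact: measurable_funTS.
- by move=> x _; rewrite lee_fin.
Qed.

HB.instance Definition _ := isMeasure.Build _ _ _ density_measure
  density0 density_ge0 density_sigma_additive.

Import HBNNSimple.

Lemma ge0_integral_density (f : T -> \bar R) :
  measurable_fun setT f -> (forall x, 0 <= f x) ->
  \int[density_measure]_x f x = \int[mu]_x (f x * (w x)%:E).
Proof.
move=> mf f0; pose f_ := nnsfun_approx measurableT mf.
have fc x : (f_ n x)%:E @[n --> \oo] --> f x by apply: cvg_nnsfun_approx.
have fE x : f x = limn (fun n => (f_ n x)%:E) by apply/esym/cvg_lim => //.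
transitivity (limn (fun n => \int[density_measure]_x (f_ n x)%:E)).
  rewrite -monotone_convergence//.
  - by apply: eq_integral => y _; rewrite fE.
  - by move=> n; exact/measurable_EFinP/measurable_funP.
  - by move=> n y _; rewrite lee_fin.
  - by move=> y _ m n mn; rewrite lee_fin; exact/lefP/nd_nnsfun_approx.
transitivity (limn (fun n => \int[mu]_x ((f_ n x)%:E * (w x)%:E))); last first.
  rewrite -monotone_convergence//.
  - by apply: eq_integral => y _; apply/cvg_lim => //; apply: cvgeZr.
  - by move=> n; apply: emeasurable_funM => //; exact/measurable_EFinP/measurable_funP.
  - by move=> n y _; rewrite mule_ge0// lee_fin.
  - move=> y _ m n mn; apply: lee_wpmul2r; rewrite lee_fin //.
    exact/lefP/nd_nnsfun_approx.
congr (limn _); apply/funext => n.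
under [LHS]eq_integral do rewrite fimfunE -fsumEFin//.
have mI k : measurable (f_ n @^-1` [set k]).
  by rewrite -(setTI (_ @^-1` _)); exact: measurable_funP.
rewrite ge0_integral_fsum//; last 2 first.
- by move=> y; exact/measurable_EFinP/measurable_funM.
- by move=> y x _; rewrite EFinM nnfun_muleindic_ge0.
under [RHS]eq_integral.
  move=> x _; rewrite fimfunE -fsumEFin// ge0_mule_fsuml; last first.
    by move=> k; rewrite EFinM nnfun_muleindic_ge0.
  over.
rewrite ge0_integral_fsum//; last 2 first.
- move=> y; apply: emeasurable_funM => //.
  exact/measurable_EFinP/measurable_funM.
- by move=> y x _; rewrite mule_ge0 ?lee_fin// -lee_fin EFinM nnfun_muleindic_ge0.
apply: eq_fsbigr => r /[!inE] -[x _ <-].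
rewrite integralZl_indic_nnsfun// integral_indic// setIT.
under [RHS]eq_integral do rewrite EFinM -muleA.
rewrite ge0_integralZl//.
- congr (_ * _); rewrite -[LHS]/(density_measure _) /density_measure.
  rewrite [LHS]integral_mkcond; apply: eq_integral => y _.
  by rewrite patchE indicE; case: ifP; rewrite ?mul1e ?mul0e.
- apply: emeasurable_funM => //; exact/measurable_EFinP.
- by move=> y _; rewrite mule_ge0 // lee_fin.
- by rewrite lee_fin.
Qed.
End Density.

Section ChangeOfVariable.
Context {R : realType}.
Local Notation mu := (@lebesgue_measure R).
Local Open Scope ereal_scope.

Lemma ge0_integral_oppr (f : R -> \bar R) :
  measurable_fun setT f -> (forall x, 0 <= f x) ->
  \int[mu]_x f x = \int[mu]_x f (- x)%R.
Proof.
move=> mf f0.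
transitivity (\int[pushforward mu (-%R : _ -> measurableTypeR R)]_x f x).
  apply: eq_measure_integral => A mA _; exact/esym/lebesgue_measureN.
by rewrite ge0_integral_pushforward// preimage_setT.
Qed.

Lemma measurable_affine (a b : R) :
  measurable_fun setT (fun x => a * x + b : measurableTypeR R)%R.
Proof. by apply: measurable_funD => //; exact: measurable_funM. Qed.

(** [a] times the image of Lebesgue measure under the affine map gives every interval its length,
    hence is Lebesgue measure. *)
Lemma ge0_integral_affine (a b : R) (f : R -> \bar R) : (0 < a)%R ->
  measurable_fun setT f -> (forall x, 0 <= f x) ->
  \int[mu]_x f x = a%:E * \int[mu]_x f (a * x + b)%R.
Proof.
move=> a0 mf f0; pose T (x : measurableTypeR R) : measurableTypeR R := (a * x + b)%R.
have mT : measurable_fun setT T by exact: measurable_affine.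
have a0' : (0 <= a)%R by exact: ltW.
have f0' : {in setT, forall y, 0 <= f y} by move=> y _.
rewrite [X in _ * X](_ : _ = \int[mu]_(x in T @^-1` setT) (f \o T) x)//.
rewrite -(ge0_integral_pushforward mT)//.
rewrite -[X in X%:E]/((NngNum a0')%:num).
rewrite -ge0_integral_mscale//.
apply: eq_measure_integral => A mA _.
apply: lebesgue_measure_unique => //= _ [[u v]] _ <-.
rewrite /= /mscale /= /pushforward.
rewrite (_ : T @^-1` _ = `]((u - b) / a)%R, ((v - b) / a)%R]%classic); last first.
  by apply/seteqP; split => x /=; rewrite !in_itv/= /T ltr_pdivrMr// ler_pdivlMr//
    ltrBlDr lerBrDr mulrC.
rewrite !lebesgue_measure_itv/= !lte_fin ltr_pM2r ?invr_gt0// ltrD2r.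
case: ifP => uv; last by rewrite mule0.
by rewrite -EFinB -EFinM; congr EFin; field; rewrite gt_eqF.
Qed.

(** The image of dy / y under [ln] is Lebesgue measure; by uniqueness this reduces to the integral
    of 1 / y over an interval from exp a to exp b. *)
Lemma ge0_integral_expR (f : R -> \bar R) :
  measurable_fun setT f -> (forall x, 0 <= f x) ->
  \int[mu]_(y in `]0%R, +oo[) f y = \int[mu]_u (f (expR u) * (expR u)%:E).
Proof.
move=> mf f0.
(* The weight vanishes for y <= 0, where [ln] takes a default value, so these points do not disturb
   the image measure. *)
pose w (y : measurableTypeR R) : R := (if (0 < y)%R then y^-1 else 0)%R.
have w0 y : (0 <= w y)%R by rewrite /w; case: ifP => // /ltW; rewrite invr_ge0.
have mw : measurable_fun setT w.
  apply: (@eq_measurable_fun _ _ _ _ setT (fun y : R => \1_(`]0%R, +oo[) y * y `^ (-1))%R).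
    move=> y _; rewrite indicE /w mem_setE in_itv/= andbT.
    by case: ifPn => [y0|]; rewrite ?mul0r // mul1r powR_inv1// ltW.
  by apply: measurable_funM => //; exact: measurable_powR.
pose L (y : measurableTypeR R) : measurableTypeR R := ln y.
have mL : measurable_fun setT L by exact: measurable_ln.
pose g u := f (expR u) * (expR u)%:E.
have g0 u : 0 <= g u by rewrite mule_ge0// lee_fin expR_ge0.
have mg : measurable_fun setT g.
  apply: emeasurable_funM; first exact: measurableT_comp.
  exact/measurable_EFinP.
have g0' : {in setT, forall y, 0 <= g y} by move=> y _.
transitivity (\int[mu]_y (g (L y) * (w y)%:E)).
  rewrite integral_mkcond; apply: eq_integral => y _.
  rewrite patchE mem_setE in_itv/= andbT /w; case: ifPn => y0; last by rewrite mule0.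
  by rewrite /g /L lnK ?posrE// -muleA -EFinM mulfV ?gt_eqF// mule1.
have mgL : measurable_fun setT (g \o L) by exact: measurableT_comp.
have gL0 x : 0 <= (g \o L) x by exact: g0.
rewrite -[LHS](ge0_integral_density _ mw w0 mgL gL0).
transitivity (\int[density_measure mu w]_(x in L @^-1` setT) (g \o L) x) => //.
rewrite -(ge0_integral_pushforward mL)//.
apply/esym/eq_measure_integral => A mA _.
apply: lebesgue_measure_unique => //= _ [[a b]] _ <-.
rewrite /= /pushforward /= /density_measure.
have [ab|ba] := ltP a b; last first.
  rewrite lebesgue_measure_itv/= lte_fin ltNge ba/= set_itv_ge ?bnd_simp -?leNgt//.
  by rewrite preimage_set0 integral_set0.
rewrite lebesgue_measure_itv/= lte_fin ab.
rewrite integral_mkcond.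
transitivity (\int[mu]_(x in `]expR a, expR b]) (x^-1)%:E).
  rewrite integral_itv_obnd_cbnd; last first.
    apply: (@eq_measurable_fun _ _ _ _ _ (fun y : R => (y `^ (-1))%:E)).
      move=> y /[!inE] /= /[!in_itv]/= /andP[/ltW ya _].
      by rewrite powR_inv1// (le_trans _ ya)// expR_ge0.
    by apply/measurable_EFinP; apply: measurable_funTS; exact: measurable_powR.
  rewrite (@continuous_FTC2 _ (fun x => x^-1)%R (@ln R)).
  - by rewrite !expRK.
  - by rewrite ltr_expR.
  - apply: continuous_in_subspaceT => y /[!inE] /= /[!in_itv]/= /andP[ya _].
    by apply: inv_continuous; rewrite gt_eqF// (lt_le_trans _ ya)// expR_gt0.
  - have lnc y : (0 < y)%R -> {for y, continuous (@ln R)} by exact: continuous_ln.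
    split.
    + move=> y /[!in_itv]/= /andP[ya _]; have y0 : (0 < y)%R by rewrite (lt_trans _ ya)// expR_gt0.
      by have [] := is_derive1_ln y0.
    + by apply: cvg_at_right_filter; apply: lnc; exact: expR_gt0.
    + by apply: cvg_at_left_filter; apply: lnc; exact: expR_gt0.
  - move=> y /[!in_itv]/= /andP[ya _]; have y0 : (0 < y)%R by rewrite (lt_trans _ ya)// expR_gt0.
    by rewrite derive1E; have [] := is_derive1_ln y0.
rewrite [LHS]integral_mkcond; apply: eq_integral => y _.
rewrite !patchE /w.
have -> : (y \in `]expR a, expR b]%classic) = (0 < y)%R && (y \in L @^-1` `]a, b]).
  rewrite !mem_setE /= !in_itv/=; have [y0|y0] /= := ltP 0%R y; last first.
    by rewrite ltNge (le_trans y0)// expR_ge0.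
  by rewrite -{1 2}(@lnK _ y)// ltr_expR ler_expR.
case: ifP; case: (0 < y)%R => //=; case: ifP => //.
Qed.

End ChangeOfVariable.

Section Substitutions.
Context {R : realType}.
Local Notation mu := (@lebesgue_measure R).
Local Open Scope ereal_scope.

(** In logarithmic coordinates, raising to the power p is multiplication by p. *)
Lemma ge0_integral_powR (p : R) (f : R -> \bar R) : (0 < p)%R ->
  measurable_fun setT f -> (forall x, 0 <= f x) ->
  \int[mu]_(y in `]0%R, +oo[) f y =
  \int[mu]_(y in `]0%R, +oo[) (f (y `^ p)%R * (p * y `^ (p - 1))%:E).
Proof.
move=> p0 mf f0; rewrite !ge0_integral_expR//; last 2 first.
- apply: emeasurable_funM.
    by apply: measurableT_comp => //; exact: measurable_powR.
  by apply/measurable_EFinP/measurable_funM => //; exact: measurable_powR.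
- by move=> x; rewrite mule_ge0// lee_fin mulr_ge0 ?powR_ge0// ltW.
rewrite (@ge0_integral_affine _ p 0 _ p0); last 2 first.
- apply: emeasurable_funM; first exact: measurableT_comp.
  exact/measurable_EFinP.
- by move=> x; rewrite mule_ge0// lee_fin expR_ge0.
have mE : measurable_fun setT (fun t : R => expR (p * t + 0)).
  by apply: measurableT_comp => //; exact: measurable_affine.
rewrite -ge0_integralZl//.
- apply: eq_integral => u _; rewrite addr0 -expRM (mulrC u) muleCA -[RHS]muleA.
  congr (_ * _); rewrite -!EFinM -mulrA -expRM -expRD.
  by congr (_ * expR _)%:E; ring.
- apply: emeasurable_funM; last exact/measurable_EFinP.
  by apply: (measurableT_comp mf).
- by move=> x _; rewrite mule_ge0// lee_fin expR_ge0.
- by rewrite lee_fin ltW.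
Qed.

End Substitutions.

(** * Euler's integral: functional equation and finiteness *)

Section GammaE.
Context {R : realType}.
Local Notation mu := (@lebesgue_measure R).
Local Open Scope ereal_scope.
Implicit Types (x y : R).

(** Kept in the extended reals: the functional equation comes before finiteness and is used to prove
    it. *)
Definition gammaE x := \int[mu]_(t in `]0%R, +oo[) (t `^ (x - 1) * expR (- t))%:E.

Lemma measurable_gamma_integrand x :
  measurable_fun setT (fun t : R => t `^ (x - 1) * expR (- t))%R.
Proof.
apply: measurable_funM; first exact: measurable_powR.
by apply: measurableT_comp => //; exact: oppr_measurable.
Qed.

Lemma gammaE_exp x : gammaE x = \int[mu]_u (expR (x * u - expR u))%:E.
Proof.
rewrite /gammaE ge0_integral_expR//; last 2 first.
- by apply/measurable_EFinP; exact: measurable_gamma_integrand.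
- by move=> t; rewrite lee_fin mulr_ge0// ?powR_ge0// expR_ge0.
apply: eq_integral => u _; rewrite -EFinM -expRM -!expRD; congr (expR _)%:E; ring.
Qed.

(** The tangent line of [expR] at [ln y] lies below the graph. *)
Lemma lin_le_expR y (u : R) : (0 < y)%R -> (y * u <= expR u + (y * ln y - y))%R.
Proof.
move=> y0; have := expR_ge1Dx (u - ln y); rewrite expRB lnK// => H.
have := ler_wpM2l (ltW y0) H; rewrite [X in (_ <= X)%R]mulrC mulfVK ?gt_eqF//; lra.
Qed.

Lemma cvg_expRN (c : R) : (0 < c)%R ->
  (expR (- (n.+1%:R * c)))%R @[n --> \oo] --> (0 : R)%R.
Proof.
move=> c0; have H : (t * c)%R @[t --> +oo%R] --> +oo%R by apply: gt0_cvgMly => //; exact: cvg_id.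
have H1 : n.+1%:R @[n --> \oo] --> (+oo%R : set_system R).
  by have := @cvgr_idn R; rewrite -(cvg_shiftS (fun n => n%:R : R)).
exact: (cvg_comp _ _ H1 (cvg_comp _ _ H (@cvgr_expR R))).
Qed.

(** The fundamental theorem of calculus for F u = exp (x u - exp u) on growing intervals: F' = x F -
    exp u F, and F tends to 0 at both ends of the line. *)
Lemma gammaE_S x : (0 < x)%R -> gammaE (x + 1) = x%:E * gammaE x.
Proof.
move=> x0; rewrite !gammaE_exp.
pose F u := expR (x * u - expR u).
pose D (n : nat) : set R := [set` `[(- n.+1%:R : R)%R, (n.+1%:R : R)%R]].
have mD n : measurable (D n) by exact: measurable_itv.
have UD : \bigcup_n D n = setT.
  apply/seteqP; split => // u _; exists (Num.truncn `|u|)%N => //=.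
  by rewrite /D /= in_itv/= -ler_norml ltW// truncnS_gt.
have ndD : nondecreasing_seq D.
  move=> m n mn; rewrite subsetEset /D => u /=; rewrite !in_itv/= -!ler_norml => /le_trans; apply.
  by rewrite ler_nat.
have dF (u : R) : is_derive u (1 : R)%R F (x * F u - expR u * F u)%R.
  rewrite /F; apply: is_derive_eq.
  by rewrite ?scaler1 /GRing.scale/=; ring.
have cF : continuous F.
  by move=> u; apply: differentiable_continuous; apply/derivable1_diffP; have [] := dF u.
have F0 u : (0 <= F u)%R by exact: expR_ge0.
have cG : continuous (fun u => expR u * F u)%R.
  by move=> u; apply: cvgM; [exact: continuous_expR|exact: cF].
have G0 u : (0 <= expR u * F u)%R by rewrite mulr_ge0// expR_ge0.
have mc (f : R -> R) : continuous f -> measurable_fun setT f by exact: continuous_measurable_fun.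
have cvgD (f : R -> R) : continuous f -> (forall u, 0 <= f u)%R ->
   \int[mu]_(u in D n) (f u)%:E @[n --> \oo] --> \int[mu]_u (f u)%:E.
  move=> cf f0; rewrite -UD; apply: ge0_nondecreasing_set_cvg_integral => //.
    by move=> n; apply/measurable_EFinP; apply: measurable_funTS; exact: mc.
  by move=> n u _; rewrite lee_fin.
have step n : x%:E * \int[mu]_(u in D n) (F u)%:E =
    (F n.+1%:R - F (- n.+1%:R))%:E + \int[mu]_(u in D n) (expR u * F u)%:E.
  have iC (f : R -> R) : continuous f -> mu.-integrable (D n) (EFin \o f).
    move=> cf; apply: continuous_compact_integrable; first exact: segment_compact.
    exact: continuous_subspaceT.
  have cH : continuous (fun u => x * F u - expR u * F u)%R.
    by move=> u; apply: cvgB; [apply: cvgM; [exact: cvg_cst|exact: cF]|exact: cG].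
  have -> : (F n.+1%:R - F (- n.+1%:R))%:E =
      \int[mu]_(u in D n) (x * F u - expR u * F u)%:E.
    rewrite (@continuous_FTC2 _ _ F) ?EFinB//.
    - by rewrite gtrN.
    - exact: continuous_subspaceT.
    - split.
      + by move=> u _; have [] := dF u.
      + by apply: cvg_at_right_filter; exact: cF.
      + by apply: cvg_at_left_filter; exact: cF.
    - by move=> u _; rewrite derive1E; have [] := dF u.
  have iH : mu.-integrable (D n) (fun u => (x * F u - expR u * F u)%:E) by exact: (iC _ cH).
  have iG : mu.-integrable (D n) (fun u => (expR u * F u)%:E) by exact: (iC _ cG).
  rewrite -integralD//; last exact: measurable_itv.
  rewrite -integralZl//; [|exact: measurable_itv|exact: (iC _ cF)].
  by apply: eq_integral => u _; rewrite -EFinD -EFinM; congr EFin; ring.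
(* The tangent bound with slope x + 1 exceeds the growth of x u by one power and leaves a factor exp
   (- n). *)
have Fy : F n.+1%:R @[n --> \oo] --> (0 : R)%R.
  apply: (@squeeze_cvgr _ _ _ _ (fun=> 0)%R
    (fun n : nat => expR ((x + 1) * ln (x + 1) - (x + 1)) * expR (- (n.+1%:R * 1)))%R).
  - apply: nearW => n; rewrite F0/= -expRD ler_expR.
    have := lin_le_expR n.+1%:R (ltr_wpDl (ltW x0) ltr01); lra.
  - exact: cvg_cst.
  - rewrite -[X in _ --> X](mulr0 (expR ((x + 1) * ln (x + 1) - (x + 1)))).
    by apply: cvgM; [exact: cvg_cst|exact: cvg_expRN].
have FNy : F (- n.+1%:R)%R @[n --> \oo] --> (0 : R)%R.
  apply: (@squeeze_cvgr _ _ _ _ (fun=> 0)%R (fun n : nat => expR (- (n.+1%:R * x)))%R).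
  - by apply: nearW => n; rewrite F0/= ler_expR mulrN mulrC gerBl expR_ge0.
  - exact: cvg_cst.
  - exact: cvg_expRN.
have L1 := cvgeZl (y := x%:E) isT (cvgD _ cF F0).
have L2 : (F n.+1%:R - F (- n.+1%:R))%:E + \int[mu]_(u in D n) (expR u * F u)%:E @[n --> \oo]
    --> 0%:E + \int[mu]_u (expR u * F u)%:E.
  apply: cvgeD; last exact: cvgD.
    by rewrite fin_num_adde_defr.
  by apply: cvg_EFin; [exact: nearW|rewrite /= -[X in _ --> X]subr0; exact: cvgB].
rewrite -(funext step) in L2.
have := cvg_unique _ L1 L2; rewrite add0e => -> //.
by apply: eq_integral => u _; rewrite -expRD; congr (expR _)%:E; ring.
Qed.

Lemma gammaE_ge0 x : 0 <= gammaE x.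
Proof. by apply: integral_ge0 => t _; rewrite lee_fin mulr_ge0// ?powR_ge0// expR_ge0. Qed.

(** The functional equation carries finiteness from x + 1 down to x. This leaves x >= 1, where the
    integrand is at most a multiple of exp (- t / 2). *)
Lemma gammaE_fin x : (0 < x)%R -> gammaE x \is a fin_num.
Proof.
wlog x1 : x / (1 <= x)%R.
  move=> W x0; have := W (x + 1)%R; rewrite lerDr addr_gt0// => /(_ (ltW x0) isT).
  rewrite gammaE_S// !ge0_fin_numE ?mule_ge0 ?gammaE_ge0 ?lee_fin ?ltW//.
  by have := gammaE_ge0 x; case: (gammaE x) => //= [r _|_]; rewrite ?ltry// gt0_muley ?lte_fin.
move=> x0; rewrite ge0_fin_numE ?gammaE_ge0//.
(* C is (2 x)^x: [ln v < v] at v = t / (2 x) gives t^x <= C exp (t / 2). *)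
pose C := (expR (x * ln (2 * x)))%R.
have I2 : \int[mu]_(t in `[0%R, +oo[) (C * expR (- (t / 2)))%:E = (0%:E - (- (2 * C))%:E).
  pose K (t : R) := (- (2 * C) * expR (- (t / 2)))%R.
  have dF (t : R) : is_derive t (1 : R)%R K (C * expR (- (t / 2)))%R.
    by rewrite /K; apply: is_derive_eq; rewrite ?scaler1 /GRing.scale/=; field.
  have cF : continuous K.
    by move=> t; apply: differentiable_continuous; apply/derivable1_diffP; have [] := dF t.
  rewrite (@ge0_continuous_FTC2y _ _ K _ 0%R).
  - by rewrite /K mul0r oppr0 expR0 mulr1.
  - by move=> t _; rewrite mulr_ge0// expR_ge0.
  - apply: continuous_subspaceT => t.
    apply: cvgM; first exact: cvg_cst.
    apply: continuous_comp; last exact: continuous_expR.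
    by apply: cvgN; apply: cvgM; [exact: cvg_id|exact: cvg_cst].
  - rewrite -[X in _ --> X](mulr0 (- (2 * C))%R); apply: cvgM; first exact: cvg_cst.
    have H : ((t : R) / 2)%R @[t --> +oo%R] --> +oo%R by apply: gt0_cvgMly => //; exact: cvg_id.
    exact: (cvg_comp _ _ H (@cvgr_expR R)).
  - by move=> t _; have [] := dF t.
  - by apply: cvg_at_right_filter; exact: cF.
  - by move=> t _; rewrite derive1E; have [] := dF t.
apply: (@le_lt_trans _ _ (0%:E - (- (2 * C))%:E)); last by rewrite -EFinB ltry.
rewrite -I2 -integral_itv_obnd_cbnd; last first.
  apply: measurable_funTS; apply/measurable_EFinP; apply: measurable_funM => //.
  by apply: measurableT_comp => //; apply: measurable_funN; exact: measurable_funM.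
apply: ge0_le_integral => //.
- by move=> t _; rewrite lee_fin mulr_ge0// ?powR_ge0// expR_ge0.
- by apply: measurable_funTS; apply/measurable_EFinP; exact: measurable_gamma_integrand.
- apply: measurable_funTS; apply/measurable_EFinP; apply: measurable_funM => //.
  by apply: measurableT_comp => //; apply: measurable_funN; exact: measurable_funM.
move=> t; rewrite /= in_itv/= andbT => t0; rewrite lee_fin.
rewrite /powR gt_eqF// /C -!expRD ler_expR.
have t2 : (0 < t / (2 * x))%R by rewrite divr_gt0// mulr_gt0.
have := ln_sublinear t2; rewrite ln_div ?posrE ?mulr_gt0// => H.
have l2 : (0 <= ln (2 * x))%R by apply: ln_ge0; lra.
have H2 : (x * (ln t - ln (2 * x)) <= t / 2)%R.
  have := ler_wpM2l (ltW x0) (ltW H); have -> : (x * (t / (2 * x)) = t / 2)%R.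
    by field; rewrite gt_eqF.
  by [].
have : ((x - 1) * ln t <= x * (ln t - ln (2 * x)) + x * ln (2 * x))%R \/ ((x - 1) * ln t <= 0)%R.
  have [|] := leP 0%R (ln t) => lt0; [left|right]; nra.
have : (0 <= x * ln (2 * x))%R by rewrite mulr_ge0// ltW.
move: H2; lra.
Qed.
End GammaE.

(** * The gamma function *)

Section GammaFun.
Context {R : realType}.
Local Notation mu := (@lebesgue_measure R).
Implicit Types (x y : R).

Lemma gammaE_Gamma x : 0 < x -> gammaE x = (Gamma_fun x)%:E.
Proof. by move=> x0; rewrite fineK// gammaE_fin. Qed.

Lemma Gamma_fun_gt0 x : 0 < x -> 0 < Gamma_fun x.
Proof.
move=> x0; rewrite -lte_fin -gammaE_Gamma// gammaE_exp.
apply: (@lt_le_trans _ _ (\int[mu]_(u in `[0%R, 1%R]) (expR (- expR 1))%:E)%E).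
  rewrite integral_cst//= lebesgue_measure_itv/= lte_fin ltr01 oppr0 adde0 mule1.
  by rewrite lte_fin expR_gt0.
apply: (@le_trans _ _ (\int[mu]_(u in `[0%R, 1%R]) (expR (x * u - expR u))%:E)%E).
  apply: ge0_le_integral => //.
  - apply: measurable_funTS; apply/measurable_EFinP; apply: measurableT_comp => //.
    by apply: measurable_funB => //; exact: measurable_funM.
  - move=> u; rewrite /= in_itv/= => /andP[u0 u1]; rewrite lee_fin ler_expR.
    have : expR u <= expR 1 by rewrite ler_expR.
    have : 0 <= x * u by rewrite mulr_ge0// ltW.
    lra.
apply: ge0_subset_integral => //.
- apply: measurable_funTS; apply/measurable_EFinP; apply: measurableT_comp => //.
  by apply: measurable_funB => //; exact: measurable_funM.
Qed.

Lemma Gamma_funS x : 0 < x -> Gamma_fun (x + 1) = x * Gamma_fun x.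
Proof.
move=> x0; apply: EFin_inj; rewrite EFinM -!gammaE_Gamma ?gammaE_S//.
by rewrite addr_gt0.
Qed.

Lemma powRD_gt0 (t a b c : R) : 0 < t -> a + b = c -> t `^ a * t `^ b = t `^ c.
Proof. by move=> t0 <-; rewrite powRD// (gt_eqF t0) implybT. Qed.

Lemma ln_le_subr1 x : 0 < x -> ln x <= x - 1.
Proof. by move=> x0; have := @le_ln1Dx R (x - 1); rewrite (addrC 1) subrK; apply; lra. Qed.

(** Bernoulli's inequality as weighted AM-GM: [m] is the mean of u and 1 with weights a and 1 - a,
    and [ln x <= x - 1] is applied at u / m and 1 / m. *)
Lemma powR_le_tangent (a u : R) : 0 < u -> 0 <= a <= 1 -> u `^ a <= 1 + a * (u - 1).
Proof.
move=> u0 /andP[a0 a1]; set m := 1 + _.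
have m0 : 0 < m.
  rewrite /m; have [->|a1'] := eqVneq a 1; first lra.
  have : a < 1 by rewrite lt_neqAle a1'.
  have : 0 <= a * u by rewrite mulr_ge0// ltW.
  lra.
rewrite /powR gt_eqF// -[leRHS]lnK// ler_expR.
have H1 := ln_le_subr1 (divr_gt0 u0 m0).
have H2 := ln_le_subr1 (divr_gt0 ltr01 m0).
rewrite !ln_div ?posrE// ln1 in H1 H2.
have a1' : 0 <= 1 - a by lra.
have := lerD (ler_wpM2l a0 H1) (ler_wpM2l a1' H2).
have -> : a * (u / m - 1) + (1 - a) * (1 / m - 1) = 0.
  by rewrite /m; field; rewrite -/m gt_eqF.
lra.
Qed.

Lemma powR_ge_tangent (a u : R) : 0 < u -> 1 <= a -> 1 + a * (u - 1) <= u `^ a.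
Proof.
move=> u0 a1; have a0 : 0 < a by lra.
have ai : 0 <= a^-1 <= 1 by rewrite invr_ge0 ltW//= invf_le1.
have := powR_le_tangent (powR_gt0 a u0) ai.
rewrite -powRrM mulfV ?gt_eqF// (powRr1 (ltW u0)) => K.
have := ler_wpM2l (ltW a0) K; rewrite mulrDr mulrA mulfV ?gt_eqF// mul1r mulr1; lra.
Qed.

Lemma gammaE_lin (a b c d : R) : 0 < a -> 0 < b -> 0 <= c -> 0 <= d ->
  (\int[mu]_(t in `]0%R, +oo[)
     (c * (t `^ (a - 1) * expR (- t)) + d * (t `^ (b - 1) * expR (- t)))%:E)%E =
  (c * Gamma_fun a + d * Gamma_fun b)%:E.
Proof.
move=> a0 b0 c0 d0.
have M e : measurable_fun setT (fun t : R => t `^ (e - 1) * expR (- t)).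
  exact: measurable_gamma_integrand.
have P e (t : R) : 0 <= t `^ (e - 1) * expR (- t) by rewrite mulr_ge0// ?powR_ge0 ?expR_ge0.
have MM e f : measurable_fun (`]0, +oo[%classic : set R) (fun t : R => (e * (t `^ (f - 1) * expR (- t)))%:E).
  by apply: measurable_funTS; apply/measurable_EFinP; apply: measurable_funM => //.
under eq_integral do rewrite EFinD.
rewrite ge0_integralD//; last 4 first.
- by move=> t _; rewrite lee_fin mulr_ge0.
- exact: MM.
- by move=> t _; rewrite lee_fin mulr_ge0.
- exact: MM.
under eq_integral do rewrite EFinM.
under [X in (_ + X)%E]eq_integral do rewrite EFinM.
rewrite !ge0_integralZl//; last 4 first.
- by apply: measurable_funTS; apply/measurable_EFinP; exact: measurable_gamma_integrand.
- by move=> t _; rewrite lee_fin.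
- by apply: measurable_funTS; apply/measurable_EFinP; exact: measurable_gamma_integrand.
- by move=> t _; rewrite lee_fin.
by rewrite EFinD !EFinM -(gammaE_Gamma a0) -(gammaE_Gamma b0).
Qed.

(** Comparison of integrands. Terms with a negative sign are to be moved to the other side, so that
    both sides are integrals of nonnegative functions. *)
Lemma Gamma_le_lin (a b c d : R) (p q r s : R) :
  0 < a -> 0 < b -> 0 < c -> 0 < d -> 0 <= p -> 0 <= q -> 0 <= r -> 0 <= s ->
  (forall t : R, 0 < t ->
     p * t `^ (a - 1) + q * t `^ (b - 1) <= r * t `^ (c - 1) + s * t `^ (d - 1)) ->
  p * Gamma_fun a + q * Gamma_fun b <= r * Gamma_fun c + s * Gamma_fun d.
Proof.
move=> a0 b0 c0 d0 p0 q0 r0 s0 H; rewrite -lee_fin -(gammaE_lin a0 b0 p0 q0) -(gammaE_lin c0 d0 r0 s0).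
have M e : measurable_fun setT (fun t : R => t `^ (e - 1) * expR (- t)).
  exact: measurable_gamma_integrand.
have P e (t : R) : 0 <= t `^ (e - 1) * expR (- t) by rewrite mulr_ge0// ?powR_ge0 ?expR_ge0.
have MM e f g h : measurable_fun (`]0, +oo[%classic : set R) (fun t : R =>
   (e * (t `^ (f - 1) * expR (- t)) + g * (t `^ (h - 1) * expR (- t)))%:E).
  by apply: measurable_funTS; apply/measurable_EFinP; apply: measurable_funD; apply: measurable_funM => //.
apply: ge0_le_integral => //.
- by move=> t _; rewrite lee_fin addr_ge0// mulr_ge0.
- exact: MM.
- exact: MM.
- move=> t; rewrite /= in_itv/= andbT => t0; rewrite lee_fin !mulrA -!mulrDl.
  by rewrite ler_wpM2r ?expR_ge0// H.
Qed.

(** Jensen's inequality: the tangent at y of the convex function t^x is integrated against t^(y-1)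
    exp (- t), whose mean is y, so the linear term drops out. *)
Lemma Gamma_ge_pow x y : 0 < y -> 1 <= x -> y `^ x * Gamma_fun y <= Gamma_fun (y + x).
Proof.
move=> y0 x1; have x0 : 0 < x by lra.
have yx0 : 0 < y `^ x by rewrite powR_gt0.
have yx1 : 0 < y `^ (x - 1) by rewrite powR_gt0.
have := @Gamma_le_lin y (y + 1) (y + x) y (y `^ x) (x * y `^ (x - 1)) 1 (x * y `^ x).
rewrite Gamma_funS// mul1r => H.
have : y `^ x * Gamma_fun y + x * y `^ (x - 1) * (y * Gamma_fun y) <=
   Gamma_fun (y + x) + x * y `^ x * Gamma_fun y.
  apply: H; rewrite ?addr_gt0 ?mulr_ge0 ?(ltW x0) ?(ltW yx0) ?(ltW yx1) ?ler01// => t t0.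
  have := powR_ge_tangent (divr_gt0 t0 y0) x1.
  rewrite -(ler_pM2r yx0) -(powRM _ (divr_ge0 (ltW t0) (ltW y0)) (ltW y0)) [t / y * y]divfK ?gt_eqF// => K.
  have -> : t `^ (y + x - 1) = t `^ x * t `^ (y - 1).
    by apply/esym/powRD_gt0 => //; ring.
  have -> : t `^ (y + 1 - 1) = t * t `^ (y - 1).
    by rewrite -[t in t * _]powRr1 ?ltW//; apply/esym/powRD_gt0 => //; ring.
  have t1 : 0 <= t `^ (y - 1) by rewrite powR_ge0.
  have := ler_wpM2r t1 K.
  have E : y `^ x = y * y `^ (x - 1) by rewrite mulr_powRB1 ?ltW.
  have -> : (1 + x * (t / y - 1)) * y `^ x * t `^ (y - 1) =
     (y `^ x + x * y `^ (x - 1) * t - x * y `^ x) * t `^ (y - 1).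
    by rewrite E; field; rewrite gt_eqF.
  lra.
have E : y `^ x = y * y `^ (x - 1) by rewrite mulr_powRB1 ?ltW.
rewrite E; move: (y `^ (x - 1)) (Gamma_fun y) (Gamma_fun (y + x)) => p g g'; lra.
Qed.

Lemma Gamma_le_pow x y : 0 < y -> 0 < x <= 1 -> Gamma_fun (y + x) <= y `^ x * Gamma_fun y.
Proof.
move=> y0 /andP[x0 x1].
have yx0 : 0 < y `^ x by rewrite powR_gt0.
have yx1 : 0 < y `^ (x - 1) by rewrite powR_gt0.
have := @Gamma_le_lin (y + x) y y (y + 1) 1 (x * y `^ x) (y `^ x) (x * y `^ (x - 1)).
rewrite Gamma_funS// mul1r => H.
have : Gamma_fun (y + x) + x * y `^ x * Gamma_fun y <=
   y `^ x * Gamma_fun y + x * y `^ (x - 1) * (y * Gamma_fun y).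
  apply: H; rewrite ?addr_gt0 ?mulr_ge0 ?(ltW x0) ?(ltW yx0) ?(ltW yx1) ?ler01// => t t0.
  have x01 : 0 <= x <= 1 by rewrite ltW.
  have := powR_le_tangent (divr_gt0 t0 y0) x01.
  rewrite -(ler_pM2r yx0) -(powRM _ (divr_ge0 (ltW t0) (ltW y0)) (ltW y0)) [t / y * y]divfK ?gt_eqF// => K.
  have -> : t `^ (y + x - 1) = t `^ x * t `^ (y - 1).
    by apply/esym/powRD_gt0 => //; ring.
  have -> : t `^ (y + 1 - 1) = t * t `^ (y - 1).
    by rewrite -[t in t * _]powRr1 ?ltW//; apply/esym/powRD_gt0 => //; ring.
  have t1 : 0 <= t `^ (y - 1) by rewrite powR_ge0.
  have := ler_wpM2r t1 K.
  have E : y `^ x = y * y `^ (x - 1) by rewrite mulr_powRB1 ?ltW.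
  have -> : (1 + x * (t / y - 1)) * y `^ x * t `^ (y - 1) =
     (y `^ x + x * y `^ (x - 1) * t - x * y `^ x) * t `^ (y - 1).
    by rewrite E; field; rewrite gt_eqF.
  lra.
have E : y `^ x = y * y `^ (x - 1) by rewrite mulr_powRB1 ?ltW.
rewrite E; move: (y `^ (x - 1)) (Gamma_fun y) (Gamma_fun (y + x)) => p g g'; lra.
Qed.

Lemma Gamma_fun1 : Gamma_fun 1 = 1 :> R.
Proof.
apply: EFin_inj; rewrite -gammaE_Gamma// /gammaE.
under eq_integral do rewrite subrr powRr0 mul1r.
rewrite integral_itv_obnd_cbnd; last first.
  by apply: measurable_funTS; apply/measurable_EFinP; apply: measurableT_comp.
pose K (t : R) : R := - expR (- t).
have dF (t : R) : is_derive t (1 : R) K (expR (- t)).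
  by rewrite /K; apply: is_derive_eq; rewrite ?scaler1 /GRing.scale/=; ring.
have cF : continuous K.
  by move=> t; apply: differentiable_continuous; apply/derivable1_diffP; have [] := dF t.
rewrite (@ge0_continuous_FTC2y _ _ K _ 0).
- by rewrite /K oppr0 expR0 -EFinB opprK add0r.
- by move=> t _; rewrite expR_ge0.
- apply: continuous_subspaceT => t.
  by apply: continuous_comp; [exact: oppr_continuous|exact: continuous_expR].
- by rewrite -oppr0; apply: cvgN; exact: cvgr_expR.
- by move=> t _; have [] := dF t.
- by apply: cvg_at_right_filter; exact: cF.
- by move=> t _; rewrite derive1E; have [] := dF t.
Qed.

(** The substitution by y^2 leads to the Gaussian integral. *)
Lemma Gamma_half : Gamma_fun (2^-1) = Num.sqrt pi :> R.
Proof.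
apply: EFin_inj; rewrite -gammaE_Gamma ?invr_gt0// /gammaE.
rewrite (@ge0_integral_powR _ 2)//; last 2 first.
- by apply/measurable_EFinP; exact: measurable_gamma_integrand.
- by move=> x; rewrite lee_fin mulr_ge0// ?powR_ge0 ?expR_ge0.
transitivity (\int[mu]_(y in `]0%R, +oo[) (2%:E * (gauss_fun y)%:E))%E.
  apply: eq_integral => y; rewrite inE/= in_itv/= andbT => y0.
  have E : (y `^ 2) `^ (2^-1 - 1) * y `^ (2 - 1) = 1.
    by rewrite -powRrM (@powRD_gt0 _ _ _ 0) ?powRr0//; field.
  rewrite -!EFinM; congr EFin; rewrite /gauss_fun -[y ^+ 2]powR_mulrn ?ltW//.
  have -> : (y `^ 2) `^ (2^-1 - 1) * expR (- y `^ 2) * (2 * y `^ (2 - 1)) =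
    2 * expR (- y `^ 2) * ((y `^ 2) `^ (2^-1 - 1) * y `^ (2 - 1)) by ring.
  by rewrite E mulr1.
rewrite ge0_integralZl//; last 2 first.
- by apply: measurable_funTS; apply/measurable_EFinP; exact: measurable_gauss_fun.
- by move=> y _; rewrite lee_fin gauss_fun_ge0.
rewrite integral_itv_obnd_cbnd; last first.
  by apply: measurable_funTS; apply/measurable_EFinP; exact: measurable_gauss_fun.
by rewrite integral0y_gauss -EFinM mulrCA divff// mulr1.
Qed.

End GammaFun.

(** * Binomial coefficients, Euler's limit and Legendre's duplication formula *)

Section Pochhammer.

(** The coefficient of q^n in (1 - q)^(-x), that is x (x + 1) ... (x + n - 1) / n!. *)
Definition poch (K : fieldType) (x : K) (n : nat) : K :=
  \prod_(j < n) ((x + j%:R) / (1 + j%:R)).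

Lemma pochS (K : fieldType) (x : K) n :
  poch x n.+1 = poch x n * ((x + n%:R) / (1 + n%:R)).
Proof. by rewrite /poch big_ord_recr. Qed.

Lemma poch0 (K : fieldType) (x : K) : poch x 0 = 1.
Proof. by rewrite /poch big_ord0. Qed.

Context {R : realType}.
Implicit Types x y : R.

Lemma poch_gt0 x n : 0 < x -> 0 < poch x n.
Proof.
move=> x0; apply: prodr_gt0 => j _; rewrite divr_gt0//.
by rewrite ltr_pwDl// ler0n.
Qed.

Lemma Gamma_poch x n : 0 < x ->
  Gamma_fun (x + n%:R) = poch x n * Gamma_fun (1 + n%:R) * Gamma_fun x.
Proof.
move=> x0; elim: n => [|n IH].
  by rewrite !addr0 poch0 Gamma_fun1 !mul1r.
have xn : 0 < x + n%:R by rewrite ltr_pwDl// ler0n.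
have n1 : 0 < 1 + n%:R :> R by rewrite ltr_pwDl// ler0n.
rewrite -addn1 natrD !addrA (Gamma_funS xn) (Gamma_funS n1) IH addn1 pochS.
move: (Gamma_fun _) (Gamma_fun _) (poch _ _) => g g' p; field.
by rewrite gt_eqF.
Qed.

(** The concave bound at exponent x gives 1 from above; the convex bound at exponent x + 1, divided
    by one functional equation, gives n / (n + x) from below. *)
Lemma cvg_Gamma_ratio1 x : 0 < x <= 1 ->
  (Gamma_fun (n.+1%:R + x) / (n.+1%:R `^ x * Gamma_fun n.+1%:R)) @[n --> \oo] --> (1 : R).
Proof.
move=> /andP[x0 x1].
have H1 : (n.+1%:R / (n.+1%:R + x)) @[n --> \oo] --> (1 : R).
  rewrite -[X in _ --> X](_ : (1 + x * 0)^-1 = 1); last by rewrite mulr0 addr0 invr1.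
  apply: (@cvg_trans _ ((1 + x * n.+1%:R^-1)^-1 @[n --> \oo])).
    apply: near_eq_cvg; apply: nearW => n /=.
    have n0 : 0 < n.+1%:R :> R by rewrite ltr0n.
    move: n0; move: (n.+1%:R : R) => y y0.
    by field; rewrite !gt_eqF ?addr_gt0.
  apply: cvgV; first by rewrite mulr0 addr0 oner_eq0.
  apply: cvgD; first exact: cvg_cst.
  by apply: cvgM; [exact: cvg_cst|exact: cvg_harmonic].
apply: (@squeeze_cvgr _ _ _ _ (fun n : nat => n.+1%:R / (n.+1%:R + x)) (fun=> 1));
  [|exact: H1|exact: cvg_cst].
apply: nearW => n.
have n0 : 0 < n.+1%:R :> R by rewrite ltr0n.
have gn := Gamma_fun_gt0 n0.
have pn : 0 < n.+1%:R `^ x :> R by rewrite powR_gt0.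
apply/andP; split.
  rewrite ler_pdivlMr; last exact: mulr_gt0.
  rewrite mulrAC ler_pdivrMr; last exact: addr_gt0.
  have := @Gamma_ge_pow R (x + 1) n.+1%:R n0; rewrite lerDr (ltW x0) => /(_ isT).
  rewrite -(@powRD_gt0 _ _ x 1 (x + 1))// (powRr1 (ltW n0)).
  rewrite [_ + (x + 1)]addrA (Gamma_funS (addr_gt0 n0 x0)).
  by move: (Gamma_fun _) (Gamma_fun _) (_ `^ _) => g g' p; lra.
by rewrite ler_pdivrMr ?mulr_gt0// mul1r Gamma_le_pow// x0.
Qed.

Lemma cvg_Gamma_ratio x : 0 < x ->
  (Gamma_fun (n.+1%:R + x) / (n.+1%:R `^ x * Gamma_fun n.+1%:R)) @[n --> \oo] --> (1 : R).
Proof.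
have S y : 0 < y ->
  (Gamma_fun (n.+1%:R + y) / (n.+1%:R `^ y * Gamma_fun n.+1%:R)) @[n --> \oo] --> (1 : R) ->
  (Gamma_fun (n.+1%:R + (y + 1)) / (n.+1%:R `^ (y + 1) * Gamma_fun n.+1%:R)) @[n --> \oo] --> (1 : R).
  move=> y0 H; have H1 : (1 + y * n.+1%:R^-1) @[n --> \oo] --> (1 + y * 0 : R).
    apply: cvgD; first exact: cvg_cst.
    by apply: cvgM; [exact: cvg_cst|exact: cvg_harmonic].
  rewrite -[X in _ --> X](_ : (1 + y * 0) * 1 = 1); last by ring.
  apply: cvg_trans (cvgM H1 H); apply: near_eq_cvg; apply: nearW => n /=.
  have n0 : 0 < n.+1%:R :> R by rewrite ltr0n.
  rewrite addrA Gamma_funS ?addr_gt0// -(@powRD_gt0 _ _ y 1 (y + 1))// powRr1 ?ltW//.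
  have := Gamma_fun_gt0 n0.
  have : 0 < n.+1%:R `^ y :> R by rewrite powR_gt0.
  move: (Gamma_fun _) (Gamma_fun _) (_ `^ _) => g g' p p0 g0.
  by field; rewrite !gt_eqF.
have [k] : exists k : nat, x <= k.+1%:R.
  by exists (Num.truncn x); rewrite ltW// truncnS_gt.
elim: k x => [|k IH] x xk x0; first by apply: cvg_Gamma_ratio1; rewrite x0.
have [x1|x1] := leP x 1; first by apply: cvg_Gamma_ratio1; rewrite x0.
rewrite -(subrK 1 x); apply: S; first by rewrite subr_gt0.
by apply: IH; rewrite ?subr_gt0// lerBlDr natr1.
Qed.

(** A form of Euler's limit for the gamma function; it shows that the coefficients grow like
    n^(x-1). *)
Lemma cvg_poch x : 0 < x ->
  (poch x n.+1 * n.+1%:R `^ (1 - x)) @[n --> \oo] --> (Gamma_fun x)^-1.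
Proof.
move=> x0; have gx := Gamma_fun_gt0 x0.
rewrite -[X in _ --> X]mulr1.
apply: cvg_trans (cvgM (cvg_cst (Gamma_fun x)^-1) (cvg_Gamma_ratio x0)); apply: near_eq_cvg; apply: nearW => n /=.
have n0 : 0 < n.+1%:R :> R by rewrite ltr0n.
have gn := Gamma_fun_gt0 n0.
have pn : 0 < n.+1%:R `^ x :> R by rewrite powR_gt0.
rewrite addrC (Gamma_poch _ x0) [1 + _]addrC (Gamma_funS n0).
have -> : n.+1%:R `^ (1 - x) = n.+1%:R / n.+1%:R `^ x :> R.
  by rewrite powRB ?(powRr1 (ltW n0))// (gt_eqF n0) implybT.
move: gn gx pn; move: (Gamma_fun _) (Gamma_fun _) (_ `^ _) (poch _ _) => g g' p q g0 g'0 p0.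
by field; rewrite !gt_eqF.
Qed.

Lemma poch_double x n : 0 < x ->
  poch (2 * x) (2 * n) = poch x n * poch (x + 2^-1) n / poch (2^-1) n.
Proof.
move=> x0; elim: n => [|n IH]; first by rewrite muln0 !poch0; field.
rewrite mulnS !addSn add0n !pochS IH (_ : (2 * n).+1%:R = 2 * n%:R + 1) ?natrM; last by rewrite -natr1 natrM.
have n1 : 0 <= n%:R :> R by [].
have p0 := @poch_gt0 2^-1 n (ltac:(by rewrite invr_gt0)).
by field; rewrite !gt_eqF//; lra.
Qed.

(** The limit of the finite identity [poch_double], each factor being read through [cvg_poch]; Gamma
    (1/2) supplies the square root of pi. *)
Lemma Gamma_duplication x : 0 < x ->
  Gamma_fun x * Gamma_fun (x + 2^-1) =
  2 `^ (1 - 2 * x) * Num.sqrt pi * Gamma_fun (2 * x) :> R.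
Proof.
move=> x0; have x2 : 0 < 2 * x by rewrite mulr_gt0.
have xh : 0 < x + 2^-1 by rewrite addr_gt0// invr_gt0.
have h0 : 0 < 2^-1 :> R by rewrite invr_gt0.
have L1 : (poch (2 * x) (2 * n.+1) * (2 * n.+1)%:R `^ (1 - 2 * x)) @[n --> \oo] -->
    (Gamma_fun (2 * x))^-1.
  have H : (2 * n).+1%N @[n --> \oo] --> \oo.
    apply/cvgnyPge => A; exists A => // n /= An.
    by rewrite (leq_trans An)// mul2n -addnn leqW// leq_addr.
  have := cvg_comp _ _ H (cvg_poch x2); apply: cvg_trans; apply: near_eq_cvg; apply: nearW => n /=.
  by rewrite mulnS.
have L2 : (2 `^ (1 - 2 * x) * (poch x n.+1 * n.+1%:R `^ (1 - x) *
    (poch (x + 2^-1) n.+1 * n.+1%:R `^ (1 - (x + 2^-1))) /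
    (poch 2^-1 n.+1 * n.+1%:R `^ (1 - 2^-1)))) @[n --> \oo] -->
    2 `^ (1 - 2 * x) * ((Gamma_fun x)^-1 * (Gamma_fun (x + 2^-1))^-1 / (Gamma_fun 2^-1)^-1).
  apply: cvgM; first exact: cvg_cst.
  apply: cvgM; first by apply: cvgM; exact: cvg_poch.
  by apply: cvgV; [rewrite invr_eq0 gt_eqF ?Gamma_fun_gt0|exact: cvg_poch].
have E : (fun n : nat => poch (2 * x) (2 * n.+1) * (2 * n.+1)%:R `^ (1 - 2 * x)) =
  (fun n : nat => 2 `^ (1 - 2 * x) * (poch x n.+1 * n.+1%:R `^ (1 - x) *
    (poch (x + 2^-1) n.+1 * n.+1%:R `^ (1 - (x + 2^-1))) /
    (poch 2^-1 n.+1 * n.+1%:R `^ (1 - 2^-1)))).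
  apply/funext => n; have n0 : 0 < n.+1%:R :> R by rewrite ltr0n.
  rewrite poch_double// natrM powRM ?ltW//.
  have p0 := @poch_gt0 2^-1 n.+1 h0.
  have q0 : 0 < n.+1%:R `^ (1 - 2^-1) :> R by rewrite powR_gt0.
  have -> : n.+1%:R `^ (1 - 2 * x) = n.+1%:R `^ (1 - x) * n.+1%:R `^ (1 - (x + 2^-1)) /
      n.+1%:R `^ (1 - 2^-1) :> R.
    apply: (mulIf (lt0r_neq0 q0)); rewrite mulfVK ?gt_eqF//.
    rewrite (@powRD_gt0 _ _ _ _ (2^-1 + (1 - 2 * x)))//; last by field.
    by rewrite (@powRD_gt0 _ _ _ _ (2^-1 + (1 - 2 * x)))//; field.
  by field; rewrite !gt_eqF.
rewrite E in L1; have := cvg_unique _ L1 L2.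
rewrite invrK Gamma_half => /(_ _ _)/(congr1 (fun u => u * Gamma_fun (2 * x) * Gamma_fun x * Gamma_fun (x + 2^-1))).
move: (Gamma_fun_gt0 x0) (Gamma_fun_gt0 x2) (Gamma_fun_gt0 xh).
move: (Gamma_fun _) (Gamma_fun _) (Gamma_fun _) => g1 g2 g3 g10 g20 g30.
rewrite mulVf ?gt_eqF// mul1r => -> //.
by field; rewrite !gt_eqF.
Qed.

End Pochhammer.

(** * The median of the gamma distribution *)

Section GammaMedian.
Context {R : realType}.
Local Notation mu := (@lebesgue_measure R).
Implicit Types (x y k w : R).

(** The left side consists of the first two terms of the odd series of the logarithm; the difference
    vanishes at 0 and has derivative 2 t^4 / (1 - t^2). *)
Lemma ln_ratio_gt (v : R) : 0 < v < 1 -> 2 * v + 2 * v ^+ 3 / 3 < ln (1 + v) - ln (1 - v).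
Proof.
move=> /andP[v0 v1].
pose f (t : R) := ln (1 + t) - ln (1 - t) - (2 * t + 2 * t ^+ 3 / 3).
have df (t : R) : -1 < t < 1 -> is_derive t (1 : R) f (2 * t ^+ 4 / (1 - t ^+ 2)).
  move=> /andP[t0 t1]; rewrite /f.
  have p1 : 0 < 1 + t by lra.
  have p2 : 0 < 1 - t by lra.
  have d1 := is_derive1_ln p1.
  have d2 := is_derive1_ln p2.
  have D1 : is_derive t (1 : R) (fun t : R => ln (1 + t)) (1 + t)^-1.
    have D : is_derive t (1 : R) (fun t : R => 1 + t) 1.
      by have := is_deriveD (is_derive_cst (1 : R) t (1 : R)) (is_derive_id t (1 : R)); rewrite add0r.
    rewrite -[(1 + t)^-1]mulr1; exact: (@is_derive1_comp _ (@ln R)).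
  have D2 : is_derive t (1 : R) (fun t : R => ln (1 - t)) (- (1 - t)^-1).
    have D : is_derive t (1 : R) (fun t : R => 1 - t) (-1).
      by have := is_deriveB (is_derive_cst (1 : R) t (1 : R)) (is_derive_id t (1 : R)); rewrite sub0r.
    rewrite -mulrN1; exact: (@is_derive1_comp _ (@ln R)).
  apply: is_derive_eq; rewrite ?scaler1 /GRing.scale/=.
  have : 1 - t ^+ 2 != 0 by rewrite gt_eqF//; nra.
  by move=> ?; field; rewrite !gt_eqF//; nra.
suff : f 0 < f v.
  by rewrite /f addr0 subr0 subrr mulr0 expr0n mulr0 mul0r addr0 subr0 subr_gt0.
have dv (t : R) : 0 <= t <= v -> -1 < t < 1 by move=> /andP[? ?]; apply/andP; split; lra.
apply: (@gtr0_derive1_lt_cc _ f 0 v).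
- move=> t; rewrite in_itv/= => /andP[t0 t1].
  have tv : 0 <= t <= v by rewrite !ltW.
  by have [] := df t (dv t tv).
- move=> t; rewrite in_itv/= => /andP[t0 t1].
  have tv : 0 <= t <= v by rewrite !ltW.
  have [_ E] := df t (dv t tv).
  by rewrite derive1E E divr_gt0// ?mulr_gt0// ?exprn_gt0//; nra.
- apply: continuous_in_subspaceT => t /[!inE] /=; rewrite in_itv/= => /dv tv.
  by apply: differentiable_continuous; apply/derivable1_diffP; have [] := df t tv.
- by rewrite in_itv/= lexx ltW.
- by rewrite in_itv/= lexx ltW.
- by [].
Qed.

(** The integrand of Gamma k after t = w^3. Its logarithm has derivative (3 k - 1) / w - 3 w^2, so
    its maximum is at w^3 = k - 1/3: this is the origin of the 1/3, and the cube root is chosen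
    because the density is then skewed to the right of its mode. *)
Definition cube_density k w : R := 3 * w `^ (3 * k - 1) * expR (- w ^+ 3).

Lemma gammaE_cube k (a : R) : 0 < a -> 0 < k ->
  (\int[mu]_(t in `]0%R, +oo[) ((t `^ (k - 1) * expR (- t)) * \1_(`]0%R, a ^+ 3]) t)%:E =
   \int[mu]_(w in `]0%R, +oo[) (cube_density k w * \1_(`]0%R, a]) w)%:E)%E.
Proof.
move=> a0 k0; rewrite (@ge0_integral_powR _ 3)//; last 2 first.
- apply/measurable_EFinP; apply: measurable_funM => //.
  exact: measurable_gamma_integrand.
- by move=> x; rewrite lee_fin !mulr_ge0// ?powR_ge0 ?expR_ge0.
apply: eq_integral => w; rewrite inE/= in_itv/= andbT => w0.
rewrite -EFinM; congr EFin; rewrite /cube_density !indicE.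
have w3 : w `^ 3 = w ^+ 3 by rewrite powR_mulrn ?ltW.
have -> : (w `^ 3 \in `]0, a ^+ 3]%classic) = (w \in `]0, a]%classic).
  rewrite !mem_setE !in_itv/= w3 exprn_gt0// w0 /=.
  by rewrite ler_pXn2r// nnegrE ltW.
rewrite w3 mulrAC; congr (_ * _).
rewrite -w3 -powRrM -(@powRD_gt0 _ _ (3 * (k - 1)) (3 - 1) (3 * k - 1))//; last by ring.
by rewrite w3; ring.
Qed.

(** In logarithms the claim is 3 a^3 (ln (a + u) - ln (a - u)) > 6 a^2 u + 2 u^3, which is exactly
    [ln_ratio_gt] at u / a. *)
Lemma cube_density_reflect k (a u : R) : k = a ^+ 3 + 3^-1 -> 0 < u < a ->
  cube_density k (a - u) < cube_density k (a + u).
Proof.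
move=> ka /andP[u0 ua]; have a0 : 0 < a by lra.
have am : 0 < a - u by lra.
have ap : 0 < a + u by lra.
rewrite /cube_density -!mulrA ltr_pM2l// /powR !gt_eqF// -!expRD ltr_expR.
have -> : 3 * k - 1 = 3 * a ^+ 3 by rewrite ka; field.
have v01 : 0 < u / a < 1 by rewrite divr_gt0//= ltr_pdivrMr// mul1r.
have := ln_ratio_gt v01.
have -> : 1 + u / a = (a + u) / a by field; rewrite gt_eqF.
have -> : 1 - u / a = (a - u) / a by field; rewrite gt_eqF.
rewrite !ln_div ?posrE// => H.
have a3 : 0 < 3 * a ^+ 3 by rewrite mulr_gt0// exprn_gt0.
have := H; rewrite -(ltr_pM2l a3).
have -> : 3 * a ^+ 3 * (2 * (u / a) + 2 * (u / a) ^+ 3 / 3) = 6 * a ^+ 2 * u + 2 * u ^+ 3.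
  by field; rewrite gt_eqF.
by move=> K; nra.
Qed.

Lemma cube_density_ge0 k w : 0 <= cube_density k w.
Proof. by rewrite /cube_density !mulr_ge0// ?powR_ge0 ?expR_ge0. Qed.

Lemma measurable_cube_density k : measurable_fun setT (cube_density k).
Proof.
apply: measurable_funM.
  by apply: measurable_funM => //; exact: measurable_powR.
by apply: measurableT_comp => //; apply: measurable_funN; exact: measurable_funX.
Qed.

Lemma gammaE_le_cube k (a : R) : 0 < a -> 0 < k ->
  (\int[mu]_(w in `]0%R, a]) (cube_density k w)%:E <= gammaE k)%E.
Proof.
move=> a0 k0.
have -> : (\int[mu]_(w in `]0%R, a]) (cube_density k w)%:E =
  \int[mu]_(w in `]0%R, +oo[) (cube_density k w * \1_(`]0%R, a]) w)%:E)%E.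
  rewrite integral_mkcond [RHS]integral_mkcond; apply: eq_integral => w _.
  rewrite !patchE indicE !mem_setE !in_itv/=.
  by case: (0 < w) => //=; case: (w <= a); rewrite ?mulr1 ?mulr0.
rewrite -gammaE_cube//; apply: ge0_le_integral => //.
- by move=> t _; rewrite lee_fin !mulr_ge0// ?powR_ge0 ?expR_ge0.
- apply: measurable_funTS; apply/measurable_EFinP; apply: measurable_funM => //.
  exact: measurable_gamma_integrand.
- by apply: measurable_funTS; apply/measurable_EFinP; exact: measurable_gamma_integrand.
- move=> t _; rewrite lee_fin ler_piMr ?mulr_ge0// ?powR_ge0 ?expR_ge0//.
Qed.

(** The reflection of w into 2 b - w at the mode, with [cube_density_reflect] comparing the two
    sides pointwise. *)
Lemma cube_density_half k (b : R) : 0 < b -> k = b ^+ 3 + 3^-1 ->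
  (\int[mu]_(w in `]0%R, b]) (cube_density k w)%:E <=
   \int[mu]_(w in `](b : R), (2 * b)%R]) (cube_density k w)%:E)%E.
Proof.
move=> b0 kb; pose g w := (cube_density k w)%:E.
have mg : measurable_fun setT g by apply/measurable_EFinP; exact: measurable_cube_density.
have g0 w : (0 <= g w)%E by rewrite lee_fin cube_density_ge0.
pose G w := ((g \_ `]0%R, b[) w)%E.
have mG : measurable_fun setT G by apply/(measurable_restrictT _ _).1 => //; exact: measurable_funTS.
have G0 w : (0 <= G w)%E by rewrite /G patchE; case: ifP.
rewrite -(integral_itv_bndo_bndc (r := b)) ; last exact: measurable_funTS.
rewrite [leLHS]integral_mkcond [leRHS]integral_mkcond.
rewrite (ge0_integral_oppr mG)// (@ge0_integral_affine _ 1 (- (2 * b)))//; last first.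
  by apply: (measurableT_comp mG); exact: oppr_measurable.
rewrite mul1e; apply: ge0_le_integral => //.
- by apply: (measurableT_comp mG); apply: measurable_funN; exact: measurable_affine.
- by apply/(measurable_restrictT _ _).1 => //; exact: measurable_funTS.
move=> w _; rewrite /G !patchE !mem_setE !in_itv/= mul1r opprB.
case: ifPn => [/andP[w1 w2]|_]; last by case: ifP => _; [exact: g0|exact: lexx].
have -> : (b < w) && (w <= 2 * b) by apply/andP; split; lra.
rewrite lee_fin ltW//.
have -> : 2 * b - w = b - (w - b) by ring.
have {2}-> : w = b + (w - b) by ring.
by apply: cube_density_reflect => //; apply/andP; split; lra.
Qed.

Lemma gamma_lower_lt_half k (b : R) : 0 < b -> k = b ^+ 3 + 3^-1 ->
  (\int[mu]_(t in `]0%R, (b ^+ 3)%R]) (t `^ (k - 1) * expR (- t))%:E < (Gamma_fun k / 2)%:E)%E.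
Proof.
move=> b0 kb; have b30 : 0 < b ^+ 3 by rewrite exprn_gt0.
have k0 : 0 < k by rewrite kb addr_gt0// invr_gt0.
pose g w := (cube_density k w)%:E.
have mg : measurable_fun setT g by apply/measurable_EFinP; exact: measurable_cube_density.
have g0 w : (0 <= g w)%E by rewrite lee_fin cube_density_ge0.
have -> : (\int[mu]_(t in `]0%R, (b ^+ 3)%R]) (t `^ (k - 1) * expR (- t))%:E =
  \int[mu]_(w in `]0%R, b]) g w)%E.
  transitivity (\int[mu]_(t in `]0%R, +oo[) ((t `^ (k - 1) * expR (- t)) * \1_(`]0%R, (b ^+ 3)]) t)%:E)%E.
    rewrite integral_mkcond [RHS]integral_mkcond; apply: eq_integral => w _.
    rewrite !patchE indicE !mem_setE !in_itv/=.
    by case: (0 < w) => //=; case: (w <= _); rewrite ?mulr1 ?mulr0.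
  rewrite gammaE_cube//.
  rewrite integral_mkcond [RHS]integral_mkcond; apply: eq_integral => w _.
  rewrite !patchE indicE !mem_setE !in_itv/=.
  by case: (0 < w) => //=; case: (w <= _); rewrite ?mulr1 ?mulr0.
set P := (X in (X < _)%E).
have P0 : (0 <= P)%E by apply: integral_ge0.
have H1 : (P <= \int[mu]_(w in `](b : R), (2 * b)%R]) g w)%E by exact: cube_density_half.
(* Strictness comes from the interval from 2 b to 3 b, beyond the mirror image; [c] is a lower bound
   of the density there. *)
pose c := 3 * (2 * b) `^ (3 * k - 1) * expR (- (3 * b) ^+ 3).
have c0 : 0 < c by rewrite !mulr_gt0// ?powR_gt0 ?expR_gt0// mulr_gt0.
have H2 : ((c * b)%:E <= \int[mu]_(w in `](2 * b)%R, (3 * b)%R]) g w)%E.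
  apply: (@le_trans _ _ (\int[mu]_(w in `](2 * b)%R, (3 * b)%R]) c%:E)%E).
    rewrite integral_cst//= lebesgue_measure_itv/= lte_fin.
    have -> : 2 * b < 3 * b by lra.
    by rewrite -EFinB -EFinM lee_fin; have -> : 3 * b - 2 * b = b by ring.
  apply: ge0_le_integral => //.
  - by move=> w _; rewrite lee_fin ltW.
  - exact: measurable_funTS.
  - move=> w /=; rewrite in_itv/= => /andP[w1 w2]; rewrite lee_fin /c /cube_density.
    have w0 : 0 < w by lra.
    rewrite ler_pM ?mulr_ge0 ?powR_ge0 ?expR_ge0//.
      rewrite ler_pM2l// ge0_ler_powR ?nnegrE ?ltW//; first by rewrite kb; nra.
      by lra.
    by rewrite ler_expR lerN2; apply: lerXn2r => //; rewrite nnegrE; lra.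
have H3 : (P + (\int[mu]_(w in `](b : R), (2 * b)%R]) g w + \int[mu]_(w in `](2 * b)%R, (3 * b)%R]) g w) <= gammaE k)%E.
  have b3 : 0 < 3 * b by lra.
  apply: le_trans (gammaE_le_cube b3 k0).
  rewrite -ge0_integral_setU//; last 2 first.
  - exact: measurable_funTS.
  - by apply/disj_setPS => w /= []; rewrite !in_itv/= => /andP[? ?] /andP[? ?]; lra.
  rewrite -ge0_integral_setU//; last 3 first.
  - exact: measurableU.
  - exact: measurable_funTS.
  - by apply/disj_setPS => w /= [+ [|]]; rewrite !in_itv/= => /andP[? ?] /andP[? ?]; lra.
  apply: ge0_subset_integral => //.
  - by apply: measurableU => //; exact: measurableU.
  - exact: measurable_funTS.
  - by move=> w /= [|[|]]; rewrite !in_itv/= => /andP[? ?]; apply/andP; split; lra.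
rewrite gammaE_Gamma// in H3.
have Pf : P \is a fin_num.
  rewrite ge0_fin_numE//; apply: (@le_lt_trans _ _ (Gamma_fun k)%:E); last exact: ltry.
  apply: le_trans H3; rewrite leeDl// adde_ge0//; exact: integral_ge0.
have : (P + (P + (c * b)%:E) <= (Gamma_fun k)%:E)%E.
  by apply: le_trans H3; rewrite leeD2l// leeD.
rewrite -(fineK Pf) -!EFinD lee_fin lte_fin.
have : 0 < c * b by rewrite mulr_gt0.
lra.
Qed.

Lemma gamma_median k (a : R) : 0 < a -> a <= k - 3^-1 ->
  ((Gamma_fun k / 2)%:E < \int[mu]_(t in `](a : R), +oo[) (t `^ (k - 1) * expR (- t))%:E)%E.
Proof.
move=> a0 ak; have k3 : 0 < k - 3^-1 by lra.
have h3 : 0 < 3^-1 :> R by rewrite invr_gt0.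
have k0 : 0 < k by lra.
pose b := (k - 3^-1) `^ (3^-1).
have b0 : 0 < b by rewrite powR_gt0.
have b3 : b ^+ 3 = k - 3^-1 by rewrite -powR_mulrn ?ltW// -powRrM mulVf// powRr1// ltW.
have kb : k = b ^+ 3 + 3^-1 by rewrite b3 subrK.
pose f t := (t `^ (k - 1) * expR (- t))%:E : \bar R.
have f0 t : (0 <= f t)%E by rewrite lee_fin mulr_ge0 ?powR_ge0 ?expR_ge0.
have mf : measurable_fun setT f by apply/measurable_EFinP; exact: measurable_gamma_integrand.
have H1 : (\int[mu]_(t in `]0%R, a]) f t < (Gamma_fun k / 2)%:E)%E.
  apply: le_lt_trans (gamma_lower_lt_half b0 kb); apply: ge0_subset_integral => //.
    exact: measurable_funTS.
  by move=> t /=; rewrite !in_itv/= => /andP[-> ta]; rewrite b3 (le_trans ta).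
have H2 : (gammaE k = \int[mu]_(t in `]0%R, a]) f t + \int[mu]_(t in `](a : R), +oo[) f t)%E.
  rewrite -ge0_integral_setU//.
  - by congr (\int[mu]_(t in _) _)%E; apply/seteqP; split => t /=; rewrite !in_itv/= ?andbT;
      [move=> t0; have [|] := leP t a; [left|right]; rewrite ?t0|case=> [/andP[]//|]; lra].
  - exact: measurable_funTS.
  - by apply/disj_setPS => t /= []; rewrite !in_itv/= andbT => /andP[? ?] ?; lra.
have I0 : (0 <= \int[mu]_(t in `]0%R, a]) f t)%E by exact: integral_ge0.
have If : (\int[mu]_(t in `]0%R, a]) f t)%E \is a fin_num.
  by rewrite ge0_fin_numE// (lt_trans H1)// ltry.
rewrite gammaE_Gamma// in H2.
move: H1 H2; rewrite -(fineK If) lte_fin.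
rewrite -/(f _); move: (\int[mu]_(t in `](a : R), +oo[) f t)%E => [j|_ _|//]; last by rewrite ltry.
by rewrite -EFinD lte_fin => H1 [H2]; lra.
Qed.
End GammaMedian.

(** * The hyperbolic measure and unfolding *)

(** Lists the integers as 0, -1, 1, -2, ..., so that sums over translates are series over [nat]. *)
Definition zenum (n : nat) : int := if odd n then Negz n./2 else Posz n./2.

Lemma zenum_inj : injective zenum.
Proof.
move=> m n; rewrite /zenum => E; rewrite -(odd_double_half m) -(odd_double_half n).
by move: E; case: (odd m); case: (odd n) => // -[->].
Qed.

Lemma zenum_surj k : exists n, zenum n = k.
Proof.
case: k => k; [exists k.*2|exists k.*2.+1]; rewrite /zenum /= odd_double //=.
  by rewrite doubleK.
by rewrite uphalf_double.
Qed.

Section Series.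
Context {R : realType}.
Local Open Scope ereal_scope.

Lemma nneseries_single (a : nat -> \bar R) n0 : (forall n, 0 <= a n) ->
  (forall n, n != n0 -> a n = 0) -> \sum_(n <oo) a n = a n0.
Proof.
move=> a0 az; rewrite (@nneseriesD1 _ _ n0)// eseries0 ?adde0// => n _ /=.
exact: az.
Qed.

(** At most one pair contributes: in this form disjointness of the images enters the unfolding. *)
Lemma nneseries_indic_le (A : nat -> nat -> bool) (Q : bool) (c : \bar R) :
  0 <= c ->
  (forall n k n' k', A n k -> A n' k' -> n = n' /\ k = k') ->
  (forall n k, A n k -> Q) ->
  \sum_(n <oo) \sum_(k <oo) ((A n k)%:R%:E * c) <= Q%:R%:E * c.
Proof.
move=> c0 Au AQ.
have t0 n k : 0 <= (A n k)%:R%:E * c by rewrite mule_ge0// lee_fin ler0n.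
have [[[n0 k0] /= H]|H] := pselect (exists p, A p.1 p.2).
  rewrite (@nneseries_single _ n0).
  - rewrite (@nneseries_single _ k0)// ?H ?(AQ _ _ H)// => k kk.
    by case: (boolP (A n0 k)) => [/(Au _ _ _ _ H)[_ e]|_]; rewrite ?mul0e// e eqxx in kk *.
  - by move=> n; apply: nneseries_ge0 => k _ _.
  - move=> n nn; rewrite eseries0// => k _ _.
    by case: (boolP (A n k)) => [/(Au _ _ _ _ H)[e _]|_]; rewrite ?mul0e// e eqxx in nn *.
rewrite eseries0 ?mule_ge0 ?lee_fin ?ler0n// => n _ _.
rewrite eseries0// => k _ _.
by case: (boolP (A n k)) => [h|_]; rewrite ?mul0e//; case: H; exists (n, k).
Qed.

End Series.

Section HalfPlaneMeasure.
Context {R : realType}.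
Local Notation RT := (measurableTypeR R).
Local Notation mu := (@lebesgue_measure R).
Local Open Scope ereal_scope.
Implicit Types (f g : RT * RT -> \bar R).

(** The intervals from k h to k h + h partition the line, and each is moved back to [0, h). *)
Lemma ge0_integral_fold (h : R) (g : RT -> \bar R) : (0 < h)%R ->
  measurable_fun setT g -> (forall x, 0 <= g x) ->
  \int[mu]_x g x =
  \int[mu]_x (\sum_(k <oo) ((0 <= x < h)%R%:R%:E * g (x + (zenum k)%:~R * h)%R)).
Proof.
move=> h0 mg g0.
pose I k : set RT := `[((zenum k)%:~R * h)%R, ((zenum k)%:~R * h + h)%R[%classic.
have IT : \bigcup_k I k = setT.
  apply/seteqP; split => // x _; have [k kE] := zenum_surj (Num.floor (x / h)).
  exists k => //; rewrite /I /= in_itv/= kE; have := floor_itv (x / h)%R.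
  rewrite ler_pdivlMr// ltr_pdivrMr// => /andP[-> ] /=.
  by rewrite intrD mulrDl mul1r.
have tI : trivIset setT I.
  move=> i j _ _ [x []]; rewrite /I /= !in_itv/= => /andP[a b] /andP[c d].
  apply: zenum_inj; apply/eqP; rewrite eq_le -!ltzD1 -!(ltr_int R) !intrD.
  by apply/andP; split; rewrite -(ltr_pM2r h0) mulrDl mul1r; [exact: le_lt_trans d|exact: le_lt_trans b].
have mI k : measurable (I k) by exact: measurable_itv.
have mind (A : set RT) : measurable A -> measurable_fun setT (fun x => (\1_A x : R)%:E).
  by move=> mA; apply/measurable_EFinP; exact: measurable_indic.
rewrite -[in LHS]IT ge0_integral_bigcup//; last by rewrite IT.
have mt k : measurable_fun setT (fun x : RT => g (x + (zenum k)%:~R * h)%R).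
  apply: (measurableT_comp mg); have := measurable_affine 1 ((zenum k)%:~R * h)%R.
  by apply: eq_measurable_fun => x _; rewrite mul1r.
have iE (x : R) : ((0 <= x < h)%R%:R : R) = \1_(`[0%R, h[%classic : set RT) x.
  by rewrite indicE mem_setE in_itv.
rewrite integral_nneseries//; last 2 first.
- move=> k; apply: emeasurable_funM => //.
  have := mind _ (measurable_itv `[0%R, h[); apply: eq_measurable_fun => x _.
  by rewrite iE.
- by move=> k x _; rewrite mule_ge0// lee_fin ler0n.
apply: eq_eseriesr => k _.
transitivity (\int[mu]_x (g x * (\1_(I k) x)%:E)).
  by rewrite integral_mkcond; apply: eq_integral => x _; rewrite patchE indicE; case: ifP => _; rewrite ?mule1 ?mule0.
rewrite (@ge0_integral_affine _ 1 ((zenum k)%:~R * h)%R)//; last 2 first.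
- by apply: emeasurable_funM => //; exact: mind.
- by move=> x; rewrite mule_ge0// lee_fin.
rewrite mul1e; apply: eq_integral => x _; rewrite mul1r muleC indicE mem_setE in_itv/=.
by rewrite lerDr addrC ltrD2l.
Qed.

(* In the coordinates (x, log y) the invariant measure of the half plane
   becomes [exp (- u)] times Lebesgue measure, on all of the plane. *)
Definition hyp_integral f : \bar R :=
  \int[mu \x mu]_p (f (p.1, expR p.2) * (expR (- p.2))%:E).

Lemma measurable_expR_snd : measurable_fun [set: RT * RT] (fun p => expR p.2 : RT).
Proof. by apply: measurableT_comp => //; exact: measurable_snd. Qed.

Lemma measurable_expRN_snd : measurable_fun [set: RT * RT] (fun p => (expR (- p.2))%:E).
Proof.
apply/measurable_EFinP; apply: measurableT_comp => //; apply: measurableT_comp => //.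
Qed.

Lemma measurable_logcoord f : measurable_fun setT f ->
  measurable_fun setT (fun p : RT * RT => f (p.1, expR p.2)).
Proof.
move=> mf; apply: (measurableT_comp mf); apply: measurable_fun_pair => //.
exact: measurable_expR_snd.
Qed.

Lemma measurable_hyp f : measurable_fun setT f ->
  measurable_fun setT (fun p : RT * RT => f (p.1, expR p.2) * (expR (- p.2))%:E).
Proof.
move=> mf; apply: emeasurable_funM; first exact: measurable_logcoord.
exact: measurable_expRN_snd.
Qed.

Lemma le_hyp f g : measurable_fun setT f -> measurable_fun setT g ->
  (forall p, 0 <= f p) ->
  (forall x y : R, (0 < y)%R -> f (x, y) <= g (x, y)) -> hyp_integral f <= hyp_integral g.
Proof.
move=> mf mg f0 fg; apply: ge0_le_integral => //.
- by move=> p _; rewrite mule_ge0// lee_fin expR_ge0.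
- exact: measurable_hyp.
- exact: measurable_hyp.
- by move=> p _; rewrite lee_wpmul2r ?lee_fin ?expR_ge0// fg// expR_gt0.
Qed.

Lemma eq_hyp f g : (forall x y : R, (0 < y)%R -> f (x, y) = g (x, y)) -> hyp_integral f = hyp_integral g.
Proof. by move=> fg; apply: eq_integral => p _; rewrite fg// expR_gt0. Qed.

Lemma hyp_nneseries (f : nat -> RT * RT -> \bar R) :
  (forall n, measurable_fun setT (f n)) -> (forall n p, 0 <= f n p) ->
  \sum_(n <oo) hyp_integral (f n) = hyp_integral (fun p => \sum_(n <oo) f n p).
Proof.
move=> mf f0; rewrite /hyp_integral -integral_nneseries//; last 2 first.
- by move=> n; exact: measurable_hyp.
- by move=> n p _; rewrite mule_ge0// lee_fin expR_ge0.
apply: eq_integral => p _; rewrite muleC -nneseriesZl//.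
by apply: eq_eseriesr => n _; rewrite muleC.
Qed.

Lemma hyp_iter f : measurable_fun setT f -> (forall p, 0 <= f p) ->
  hyp_integral f = \int[mu]_u \int[mu]_x (f (x, expR u) * (expR (- u))%:E).
Proof.
move=> mf f0; have mh := measurable_hyp mf.
have h0 p : 0 <= f (p.1, expR p.2) * (expR (- p.2))%:E.
  by rewrite mule_ge0// lee_fin expR_ge0.
by rewrite /hyp_integral (fubini_tonelli2 _ mh h0).
Qed.

Lemma hyp_fold (h : R) f : (0 < h)%R -> measurable_fun setT f ->
  (forall p, 0 <= f p) ->
  hyp_integral f = hyp_integral (fun p => \sum_(k <oo)
    ((0 <= p.1 < h)%R%:R%:E * f (p.1 + (zenum k)%:~R * h, p.2)%R)).
Proof.
move=> h0 mf f0.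
have mk k : measurable_fun setT (fun p : RT * RT =>
    (0 <= p.1 < h)%R%:R%:E * f (p.1 + (zenum k)%:~R * h, p.2)%R).
  apply: emeasurable_funM.
    apply/measurable_EFinP.
    apply: (measurableT_comp (f := fun x : RT => (0 <= x < h)%R%:R : R)); last exact: measurable_fst.
    have iE (x : R) : ((0 <= x < h)%R%:R : R) = \1_(`[0%R, h[%classic : set RT) x.
      by rewrite indicE mem_setE in_itv.
    by under eq_fun do rewrite iE; apply: measurable_indic; exact: measurable_itv.
  apply: (measurableT_comp mf); apply: measurable_fun_pair; last exact: measurable_snd.
  by apply: measurable_funD => //; exact: measurable_fst.
have k0 k (p : RT * RT) : 0 <= (0 <= p.1 < h)%R%:R%:E * f (p.1 + (zenum k)%:~R * h, p.2)%R.
  by rewrite mule_ge0// lee_fin ler0n.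
rewrite hyp_iter// hyp_iter//; last 2 first.
- by apply: ge0_emeasurable_sum => // k p _ _; exact: k0.
- by move=> p; apply: nneseries_ge0 => k _ _; exact: k0.
apply: eq_integral => u _; rewrite (@ge0_integral_fold h)//; last 2 first.
- apply: emeasurable_funM => //.
  by apply: (measurableT_comp mf); exact: measurable_fun_pair.
- by move=> x; rewrite mule_ge0// lee_fin expR_ge0.
apply: eq_integral => x _; rewrite [RHS]muleC -nneseriesZl//.
by apply: eq_eseriesr => k _; rewrite muleA [RHS]muleC.
Qed.

(** The action in real coordinates, made a total measurable map of the plane; for y > 0 it agrees
    with [act], see [actRE]. *)
Definition actR (g : SL2 R) (p : RT * RT) : RT * RT :=
  let D := ((g 1 0 * p.1 + g 1 1) ^+ 2 + (g 1 0 * p.2) ^+ 2)%R in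
  (((g 0 0 * p.1 + g 0 1) * (g 1 0 * p.1 + g 1 1) + g 0 0 * g 1 0 * p.2 ^+ 2) / D,
   p.2 / D)%R.

Lemma measurable_actR (g : SL2 R) : measurable_fun setT (actR g).
Proof.
have mx : measurable_fun [set: RT * RT] (fun p => p.1 : R) by exact: measurable_fst.
have my : measurable_fun [set: RT * RT] (fun p => p.2 : R) by exact: measurable_snd.
have mD : measurable_fun [set: RT * RT]
    (fun p => ((g 1 0 * p.1 + g 1 1) ^+ 2 + (g 1 0 * p.2) ^+ 2)%R : R).
  by apply: measurable_funD; apply: measurable_funX;
    [apply: measurable_funD => //|]; apply: measurable_funM.
have mV : measurable_fun [set: RT * RT]
    (fun p => (((g 1 0 * p.1 + g 1 1) ^+ 2 + (g 1 0 * p.2) ^+ 2)^-1)%R : R).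
  apply: (eq_measurable_fun (fun p : RT * RT => ((g 1 0 * p.1 + g 1 1) ^+ 2 + (g 1 0 * p.2) ^+ 2) `^ (-1))%R).
    by move=> p _; rewrite powR_inv1// addr_ge0 ?sqr_ge0.
  exact: (measurableT_comp (measurable_powR (-1)%R) mD).
apply: measurable_fun_pair; apply: measurable_funM => //.
apply: measurable_funD; apply: measurable_funM => //.
- by apply: measurable_funD => //; exact: measurable_funM.
- by apply: measurable_funD => //; exact: measurable_funM.
- exact: measurable_funX.
Qed.

(** Coordinates for [hyp_actR]: [e] is the height, and t = (x + d / c) / e labels the rays from the
    pole - d / c. *)
Lemma polar_y (c d e t : R) : c != 0%R -> e != 0%R ->
  (e / ((c * (e * t - d / c) + d) ^+ 2 + (c * e) ^+ 2) =
   (c ^+ 2 * (1 + t ^+ 2))^-1 / e)%R.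
Proof.
move=> c0 e0; have t2 : (1 + t ^+ 2 != 0)%R by rewrite gt_eqF// ltr_pwDl// sqr_ge0.
have -> : (c * (e * t - d / c) + d = c * e * t)%R by field.
have -> : ((c * e * t) ^+ 2 + (c * e) ^+ 2 = c ^+ 2 * (1 + t ^+ 2) * e ^+ 2)%R by ring.
by field; rewrite ?c0 ?e0 ?t2.
Qed.

Lemma polar_x (a c d e t : R) : c != 0%R -> e != 0%R ->
  (((a * (e * t - d / c) + (a * d - 1) / c) * (c * (e * t - d / c) + d) + a * c * e ^+ 2)
    / ((c * (e * t - d / c) + d) ^+ 2 + (c * e) ^+ 2) =
   a / c - t * ((c ^+ 2 * (1 + t ^+ 2))^-1 / e))%R.
Proof.
move=> c0 e0; have t2 : (1 + t ^+ 2 != 0)%R by rewrite gt_eqF// ltr_pwDl// sqr_ge0.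
have -> : (c * (e * t - d / c) + d = c * e * t)%R by field.
have -> : ((c * e * t) ^+ 2 + (c * e) ^+ 2 = c ^+ 2 * (1 + t ^+ 2) * e ^+ 2)%R by ring.
by field; rewrite ?c0 ?e0 ?t2.
Qed.

(** In the coordinates t = (x + d / c) / y and u = ln y the measure dx dy / y^2 is dt du. The map
    sends the ray t from - d / c to the ray - t from a / c, and u to ln (K t) - u. Invariance thus
    follows from one-dimensional affine substitutions and Fubini. *)
Lemma hyp_actR (g : SL2 R) f : (g 1 0 != 0)%R -> measurable_fun setT f ->
  (forall p, 0 <= f p) -> hyp_integral (f \o actR g) = hyp_integral f.
Proof.
move=> c0 mf f0; set a := g 0%R 0%R; set c := g 1%R 0%R; set d := g 1%R 1%R.
have mfg : measurable_fun setT (f \o actR g) by apply: measurableT_comp => //; exact: measurable_actR.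
rewrite hyp_iter//; last by move=> p; exact: f0.
pose K (t : R) : R := ((c ^+ 2 * (1 + t ^+ 2)) `^ (-1))%R.
have K0 t : (0 < K t)%R by rewrite powR_gt0// mulr_gt0 ?exprn_even_gt0// ltr_pwDl// sqr_ge0.
have KE t : K t = ((c ^+ 2 * (1 + t ^+ 2))^-1)%R.
  by rewrite /K powR_inv1// mulr_ge0 ?sqr_ge0// addr_ge0// sqr_ge0.
have mK : measurable_fun [set: RT] (fun t => K t : RT).
  have mB : measurable_fun [set: RT] (fun t => c ^+ 2 * (1 + t ^+ 2) : R)%R.
    by apply: measurable_funM => //; apply: measurable_funD => //; exact: measurable_funX.
  exact: (measurableT_comp (measurable_powR (-1)%R) mB).
have E1 (t u : R) : (expR (ln (K t) - u) = K t * (expR u)^-1)%R.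
  by rewrite expRD lnK ?posrE// expRN.
pose G (p : RT * RT) : \bar R := f (a / c - p.1 * expR (ln (K p.1) - p.2), expR (ln (K p.1) - p.2))%R.
pose G1 (p : RT * RT) : \bar R := f (a / c - p.1 * expR p.2, expR p.2)%R.
have m1 : measurable_fun [set: RT * RT] (fun p => p.1 : RT) by exact: measurable_fst.
have m2 : measurable_fun [set: RT * RT] (fun p => p.2 : RT) by exact: measurable_snd.
have me : measurable_fun [set: RT * RT] (fun p => expR (ln (K p.1) - p.2) : RT)%R.
  apply: measurableT_comp => //; apply: measurable_funB => //.
  by apply: (measurableT_comp (@measurable_ln R)); exact: (measurableT_comp mK).
have mG : measurable_fun setT G.
  apply: (measurableT_comp mf); apply: measurable_fun_pair => //.
  by apply: measurable_funB => //; exact: measurable_funM.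
have mG1 : measurable_fun setT G1.
  apply: (measurableT_comp mf); apply: measurable_fun_pair; last exact: measurable_expR_snd.
  by apply: measurable_funB => //; apply: measurable_funM => //; exact: measurable_expR_snd.
transitivity (\int[mu]_u \int[mu]_t G (t, u)).
  apply: eq_integral => u _.
  rewrite (@ge0_integral_affine _ (expR u) (- (d / c))) ?expR_gt0//; last 2 first.
  - apply: emeasurable_funM => //.
    by apply: (measurableT_comp mfg); exact: measurable_fun_pair.
  - by move=> x; rewrite mule_ge0 ?lee_fin ?expR_ge0//; exact: f0.
  rewrite -ge0_integralZl//; last 2 first.
  - apply: emeasurable_funM => //; apply: (measurableT_comp mfg).
    apply: measurable_fun_pair => //; exact: measurable_affine.
  - by move=> x _; rewrite mule_ge0 ?lee_fin ?expR_ge0//; exact: f0.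
  apply: eq_integral => t _; rewrite muleC -muleA -EFinM -expRD addNr expR0 mule1.
  rewrite /G /= /actR -/a -/c -/d E1 KE; congr (f (_, _)).
    have ad := SL2_detE g; rewrite -/a -/c -/d in ad.
    have e0 := expR_gt0 u.
    have bE : g 0%R 1%R = ((a * d - 1) / c)%R.
      by rewrite -ad opprB addrC subrK mulfK.
    by rewrite bE; apply: polar_x => //; rewrite gt_eqF.
  by apply: polar_y => //; rewrite gt_eqF ?expR_gt0.
have G0 p : 0 <= G p by exact: f0.
have G10 p : 0 <= G1 p by exact: f0.
rewrite -(fubini_tonelli _ mG G0).
transitivity (\int[mu]_t \int[mu]_u G1 (t, u)).
  apply: eq_integral => t _.
  have mg : measurable_fun [set: RT] (fun u => G1 (t, u)) by apply: (measurableT_comp mG1); exact: measurable_fun_pair.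
  rewrite (ge0_integral_oppr mg)// (@ge0_integral_affine _ 1 (- ln (K t))%R)//; last first.
    by apply: (measurableT_comp mg); exact: oppr_measurable.
  rewrite mul1e; apply: eq_integral => u _.
  by rewrite /G1 /G /= mul1r opprD opprK [(- u + _)%R]addrC.
rewrite (fubini_tonelli _ mG1 G10) hyp_iter//.
apply: eq_integral => u _.
have mg : measurable_fun [set: RT] (fun t => G1 (t, u)) by apply: (measurableT_comp mG1); exact: measurable_fun_pair.
rewrite (ge0_integral_oppr mg)// [RHS](@ge0_integral_affine _ (expR u) (a / c)) ?expR_gt0//; last 2 first.
- by apply: emeasurable_funM => //; apply: (measurableT_comp mf); exact: measurable_fun_pair.
- by move=> x; rewrite mule_ge0 ?lee_fin ?expR_ge0.
rewrite -ge0_integralZl//; last 2 first.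
- apply: emeasurable_funM => //; apply: (measurableT_comp mf).
  apply: measurable_fun_pair => //; exact: measurable_affine.
- by move=> x _; rewrite mule_ge0 ?lee_fin ?expR_ge0.
apply: eq_integral => t _; rewrite muleC -muleA -EFinM -expRD addNr expR0 mule1.
by rewrite /G1 /= mulNr opprK [(t * _)%R]mulrC [(a / c + _)%R]addrC.
Qed.

Lemma actR_gt0 (g : SL2 R) x y : (0 < y)%R -> (0 < (actR g (x, y)).2)%R.
Proof.
move=> y0; rewrite /actR /=.
have := mobius_uhp_subproof g (@Uhp R (x +i* y)%C y0); rewrite Im_mobius //=.
Qed.

Lemma actRE (g : SL2 R) x y (y0 : (0 < y)%R) :
  let w := act g (@Uhp R (x +i* y)%C y0) in actR g (x, y) = (complex.Re w, complex.Im w).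
Proof.
move=> w; rewrite /w /actR; congr pair; last by rewrite -Im_mobius.
rewrite /= /mobius_num /mobius_den /=.
rewrite !mul0r !subr0 !addr0.
have : ((g 1 0 * x + g 1 1) ^+ 2 + (g 1 0 * y) ^+ 2 != 0)%R.
  by have := actR_gt0 g x y0; rewrite /actR /=; apply: contraTneq => ->; rewrite invr0 mulr0 ltxx.
by move=> D0; field.
Qed.

Lemma actRK (g : SL2 R) x y : (0 < y)%R -> actR g^-1%g (actR g (x, y)) = (x, y).
Proof.
move=> y0; rewrite (actRE g x y0); set w := act g _.
have w0 := uhp_valP w.
have wE : @Uhp R (complex.Re w +i* complex.Im w)%C w0 = w.
  by apply: val_inj => /=; case: (uhp_val w).
by rewrite (actRE _ _ w0) wE /w -actM mulVg act1.
Qed.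

End HalfPlaneMeasure.

Section Unfolding.
Context {R : realType}.
Local Notation RT := (measurableTypeR R).
Local Notation mu := (@lebesgue_measure R).
Local Open Scope ereal_scope.

Lemma in_stripE (h : R) (x : RT) :
  ((0 <= x < h)%R%:R : R) = \1_(`[0%R, h[%classic : set RT) x.
Proof. by rewrite indicE mem_setE in_itv. Qed.

Lemma measurable_strip (h : R) :
  measurable_fun [set: RT] (fun x : RT => (0 <= x < h)%R%:R : R).
Proof.
have : measurable_fun [set: RT] (\1_(`[0%R, h[%classic : set RT) : RT -> R).
  by apply: measurable_indic; exact: measurable_itv.
by apply: eq_measurable_fun => x _; rewrite in_stripE.
Qed.

Lemma integral_strip (h : R) (g : RT -> \bar R) :
  \int[mu]_(x in `[0%R, h[) g x = \int[mu]_x ((0 <= x < h)%R%:R%:E * g x).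
Proof.
rewrite integral_mkcond; apply: eq_integral => x _.
by rewrite patchE mem_setE in_itv/=; case: ifP => _; rewrite ?mul1e ?mul0e.
Qed.

(** By invariance the indicator of [S n] moves to its image under [g n]. Folding by h and uniqueness
    of the pair (n, k) then leave at most one copy of [f] at each point of the strip below B. *)
Lemma hyp_unfold (h B : R) (S : nat -> set (RT * RT)) (g : nat -> SL2 R)
    (f : RT * RT -> \bar R) : (0 < h)%R ->
  (forall n, measurable (S n)) -> (forall n, g n 1%R 0%R != 0%R) ->
  measurable_fun setT f -> (forall p, 0 <= f p) ->
  (forall (k : int) x y, f (x + k%:~R * h, y)%R = f (x, y)) ->
  (forall x y n k n' k', (0 < y)%R -> (0 <= x < h)%R ->
    S n (actR (g n)^-1%g (x + (zenum k)%:~R * h, y)%R) ->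
    S n' (actR (g n')^-1%g (x + (zenum k')%:~R * h, y)%R) -> n = n' /\ k = k') ->
  (forall x y n k, (0 < y)%R -> (0 <= x < h)%R ->
    S n (actR (g n)^-1%g (x + (zenum k)%:~R * h, y)%R) -> (y <= B)%R) ->
  \sum_(n <oo) hyp_integral (fun p => (\1_(S n) p)%:E * f (actR (g n) p)) <=
  hyp_integral (fun p => ((0 <= p.1 < h) && (p.2 <= B))%R%:R%:E * f p).
Proof.
move=> h0 mS c0 mf f0 fper Suniq SB.
have mind n : measurable_fun setT (fun p => (\1_(S n) (actR (g n)^-1%g p) : R)%:E).
  apply/measurable_EFinP; apply: (measurableT_comp (f := (\1_(S n) : RT * RT -> R))).
    exact: measurable_indic.
  exact: measurable_actR.
have mF n : measurable_fun setT (fun p => (\1_(S n) (actR (g n)^-1%g p) : R)%:E * f p).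
  exact: emeasurable_funM.
have F0 n p : 0 <= (\1_(S n) (actR (g n)^-1%g p) : R)%:E * f p.
  by rewrite mule_ge0// lee_fin.
have mstrip : measurable_fun [set: RT * RT] (fun p => ((0 <= p.1 < h)%R%:R : R)%:E).
  apply/measurable_EFinP.
  by apply: (measurableT_comp (measurable_strip h)); exact: measurable_fst.
have mshift k : measurable_fun [set: RT * RT] (fun p => (p.1 + (zenum k)%:~R * h, p.2)%R : RT * RT).
  apply: measurable_fun_pair; last exact: measurable_snd.
  by apply: measurable_funD => //; exact: measurable_fst.
pose T n k (p : RT * RT) := (0 <= p.1 < h)%R%:R%:E *
   ((\1_(S n) (actR (g n)^-1%g (p.1 + (zenum k)%:~R * h, p.2)%R) : R)%:E *
    f (p.1 + (zenum k)%:~R * h, p.2)%R).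
have mT n k : measurable_fun setT (T n k).
  by apply: emeasurable_funM => //; apply: (measurableT_comp (mF n)).
have T0 n k p : 0 <= T n k p by rewrite mule_ge0 ?lee_fin ?ler0n.
have -> : \sum_(n <oo) hyp_integral (fun p => (\1_(S n) p)%:E * f (actR (g n) p)) =
    \sum_(n <oo) hyp_integral (fun p => \sum_(k <oo) T n k p).
  apply: eq_eseriesr => n _; rewrite -[RHS](hyp_fold h0 (mF n) (F0 n)).
  rewrite -(hyp_actR (c0 n) (mF n) (F0 n)); apply: eq_hyp => x y y0 /=.
  by rewrite actRK.
rewrite hyp_nneseries; last 2 first.
- by move=> n; apply: ge0_emeasurable_sum => // k p _ _; exact: T0.
- by move=> n p; apply: nneseries_ge0 => k _ _; exact: T0.
have mB : measurable_fun [set: RT * RT] (fun p => ((p.2 <= B)%R%:R : R)%:E).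
  apply/measurable_EFinP.
  apply: (measurableT_comp (f := fun y : RT => (y <= B)%R%:R : R)); last exact: measurable_snd.
  have : measurable_fun [set: RT] (\1_(`]-oo, B]%classic : set RT) : RT -> R).
    by apply: measurable_indic; exact: measurable_itv.
  by apply: eq_measurable_fun => x _; rewrite indicE mem_setE in_itv.
apply: le_hyp.
- apply: ge0_emeasurable_sum => [n p _ _|n _].
    by apply: nneseries_ge0 => k _ _; exact: T0.
  by apply: ge0_emeasurable_sum => // k p _ _; exact: T0.
- apply: emeasurable_funM => //.
  have := emeasurable_funM mstrip mB; apply: eq_measurable_fun => p _.
  by rewrite /= -EFinM -natrM mulnb.
- move=> p; apply: nneseries_ge0 => n _ _; apply: nneseries_ge0 => k _ _; exact: T0.
move=> x y y0 /=.
pose A n k := (0 <= x < h)%R && ((actR (g n)^-1%g (x + (zenum k)%:~R * h, y)%R) \in S n).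
have -> : \sum_(n <oo) \sum_(k <oo) T n k (x, y) =
    \sum_(n <oo) \sum_(k <oo) ((A n k)%:R%:E * f (x, y)).
  apply: eq_eseriesr => n _; apply: eq_eseriesr => k _.
  by rewrite /T /A /= fper indicE muleA -EFinM -natrM mulnb.
apply: nneseries_indic_le => //.
- by move=> n k n' k' /andP[xh /set_mem s1] /andP[_ /set_mem s2]; exact: Suniq s1 s2.
- by move=> n k /andP[xh /set_mem s1]; rewrite xh /=; exact: SB s1.
Qed.

(** Exactly one translate of x - a by a multiple of h lies in [0, h), so folding back leaves a
    single term. *)
Lemma integral_shift (h a : R) (g : RT -> \bar R) : (0 < h)%R ->
  measurable_fun setT g -> (forall x, 0 <= g x) ->
  (forall (k : int) x, g (x + k%:~R * h)%R = g x) ->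
  \int[mu]_(x in `[0%R, h[) g (x + a)%R = \int[mu]_(x in `[0%R, h[) g x.
Proof.
move=> h0 mg g0 gper.
have mga : measurable_fun [set: RT] (fun x => g (x + a)%R).
  apply: (measurableT_comp mg); have := measurable_affine 1 a.
  by apply: eq_measurable_fun => x _; rewrite mul1r.
have ms : measurable_fun [set: RT] (fun x => ((0 <= x < h)%R%:R : R)%:E).
  by apply/measurable_EFinP; exact: measurable_strip.
rewrite !integral_strip (@ge0_integral_affine _ 1 (- a))//; last 2 first.
- exact: emeasurable_funM.
- by move=> x; rewrite mule_ge0// lee_fin ler0n.
rewrite mul1e; under eq_integral do rewrite mul1r subrK.
rewrite [LHS](@ge0_integral_fold _ h)//; last 2 first.
- apply: emeasurable_funM => //.
  have := measurableT_comp ms (measurable_affine 1 (- a)).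
  by apply: eq_measurable_fun => x _ /=; rewrite mul1r.
- by move=> x; rewrite mule_ge0// lee_fin ler0n.
apply: eq_integral => x _.
have [k0 k0E] := zenum_surj (- Num.floor ((x - a) / h)).
have := floor_itv ((x - a) / h)%R; rewrite ler_pdivlMr// ltr_pdivrMr// => /andP[f1 f2].
rewrite intrD mulrDl mul1r in f2.
have H : (0 <= x + (zenum k0)%:~R * h - a < h)%R.
  rewrite k0E mulrNz mulNr; set y := (_ * h)%R in f1 f2 *.
  by move: y f1 f2 => y f1 f2; apply/andP; split; lra.
have K k : k != k0 -> (0 <= x + (zenum k)%:~R * h - a < h)%R = false.
  move=> kk; apply: contra_neqF kk => /andP[a1 a2]; apply: zenum_inj; rewrite k0E.
  apply/eqP; rewrite -addr_eq0 eq_le -!ltzD1 -!(ltr_int R) !intrD mulr0z.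
  move: f1 f2 a1 a2; move: (zenum k)%:~R (Num.floor ((x - a) / h))%:~R => u v f1 f2 a1 a2.
  by apply/andP; split; rewrite -(ltr_pM2r h0) !mulrDl ?mul1r ?mul0r; lra.
rewrite (@nneseries_single _ _ k0).
- by rewrite gper H mul1e.
- by move=> k; rewrite mule_ge0 ?mule_ge0// lee_fin ler0n.
- by move=> k kk; rewrite (K _ kk) mul0e mule0.
Qed.

(** Replaces the mean over a period by means over M equally spaced points, where the powers of exp
    (2 pi i x / h) are governed by M-th roots of unity. *)
Lemma integral_average (h : R) (M : nat) (g : RT -> \bar R) : (0 < h)%R -> (0 < M)%N ->
  measurable_fun setT g -> (forall x, 0 <= g x) ->
  (forall (k : int) x, g (x + k%:~R * h)%R = g x) ->
  \int[mu]_(x in `[0%R, h[) g x =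
  \int[mu]_(x in `[0%R, h[) (M%:R^-1%:E * \sum_(j < M) g (x + j%:R * (h / M%:R))%R).
Proof.
move=> h0 M0 mg g0 gper.
have mga (a : R) : measurable_fun [set: RT] (fun x => g (x + a)%R).
  apply: (measurableT_comp mg); have := measurable_affine 1 a.
  by apply: eq_measurable_fun => x _; rewrite mul1r.
have mI : measurable (`[0%R, h[%classic : set RT) by exact: measurable_itv.
rewrite ge0_integralZl//; last 2 first.
- apply: (@emeasurable_sum _ _ _ _ _ _ (fun (j : 'I_M) (x : RT) => g (x + j%:R * (h / M%:R))%R)).
  by move=> j; exact: measurable_funTS.
- by move=> x _; exact: sume_ge0.
rewrite ge0_integral_sum//; last by move=> j; exact: measurable_funTS.
under [in RHS]eq_bigr do rewrite integral_shift//.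
rewrite sumr_const card_ord.
set I := integral _ _ _.
have -> : GRing.natmul I M = M%:R%:E * I by rewrite mule_natl.
by rewrite muleA -EFinM mulVf ?mul1e// pnatr_eq0 -lt0n.
Qed.

End Unfolding.

Import ComplexField.Normc.
Local Open Scope complex_scope.

(** * Complex exponentials, roots of unity and Pochhammer ratios *)

Section ComplexNorm.
Context {R : realType}.
Implicit Types (z w : R[i]) (x y : R).

Lemma normc_norm z : `|z| = (normc z)%:C.
Proof. by case: z. Qed.

Lemma normc_ge0 z : 0 <= normc z.
Proof. by case: z => a b /=; exact: sqrtr_ge0. Qed.

Lemma normc_triangle z w : normc (z + w) <= normc z + normc w.
Proof. by rewrite -lecR rmorphD /= -!normc_norm ler_normD. Qed.

Lemma normc_opp z : normc (- z) = normc z.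
Proof. by apply: complexI; rewrite -!normc_norm normrN. Qed.

Lemma normc_sub z w : normc (z - w) = normc (w - z).
Proof. by rewrite -normc_opp opprB. Qed.

Lemma normc_sum (I : Type) (r : seq I) (P : pred I) (F : I -> R[i]) :
  normc (\sum_(i <- r | P i) F i) <= \sum_(i <- r | P i) normc (F i).
Proof.
elim/big_ind2: _ => [||i _ //]; first by rewrite normc0.
by move=> z x w y zx wy; rewrite (le_trans (normc_triangle _ _))// lerD.
Qed.

Lemma normc_prod (I : Type) (r : seq I) (P : pred I) (F : I -> R[i]) :
  normc (\prod_(i <- r | P i) F i) = \prod_(i <- r | P i) normc (F i).
Proof.
by elim/big_ind2: _ => [||i _ //]; [rewrite normc1|move=> z x w y <- <-; rewrite normcM].
Qed.

Lemma normcX z n : normc (z ^+ n) = normc z ^+ n.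
Proof. by elim: n => [|n IH]; rewrite ?expr0 ?normc1// !exprS normcM IH. Qed.

Lemma normcR x : normc x%:C = `|x|.
Proof. by rewrite /= expr0n addr0 sqrtr_sqr. Qed.

Lemma normc_nat n : normc (n%:R : R[i]) = n%:R.
Proof. by rewrite -(rmorph_nat (real_complex R)) normcR normr_nat. Qed.

Lemma normc_sqr z : (normc z ^+ 2)%:C = z * z^*.
Proof. by rewrite rmorphXn /= -normc_norm sqr_normc. Qed.

Lemma normc_sqrE z : normc z ^+ 2 = complex.Re z ^+ 2 + complex.Im z ^+ 2.
Proof. by case: z => a b /=; rewrite sqr_sqrtr// addr_ge0// sqr_ge0. Qed.

Lemma Re_le_normc z : `|complex.Re z| <= normc z.
Proof. by rewrite -lecR -normc_norm normc_ge_Re. Qed.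

Lemma Im_le_normc z : `|complex.Im z| <= normc z.
Proof.
by case: z => a b /=; rewrite -sqrtr_sqr ler_wsqrtr// lerDr sqr_ge0.
Qed.

Lemma normc_le_ReIm z : normc z <= `|complex.Re z| + `|complex.Im z|.
Proof.
rewrite -[leRHS]ger0_norm ?addr_ge0// -sqrtr_sqr.
case: z => a b /=; rewrite ler_wsqrtr// sqrrD !real_normK ?num_real//.
by rewrite -addrA lerD2l lerDr mulrn_wge0// mulr_ge0.
Qed.

Lemma normc_distl z w : `|normc z - normc w| <= normc (z - w).
Proof.
rewrite ler_norml; apply/andP; split.
  have := normc_triangle (w - z) z; rewrite subrK (normc_sub w); lra.
have := normc_triangle (z - w) w; rewrite subrK; lra.
Qed.

Lemma cexpD z w : cexp (z + w) = cexp z * cexp w.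
Proof.
case: z w => [a b] [c d]; rewrite /cexp /= expRD cosD sinD.
by apply/eqP; rewrite eq_complex /=; apply/andP; split; apply/eqP; ring.
Qed.

Lemma cexp0 : cexp 0 = 1 :> R[i].
Proof. by rewrite /cexp /= expR0 cos0 sin0 mulr1 mulr0. Qed.

Lemma cexpMn z n : cexp (n%:R * z) = cexp z ^+ n.
Proof.
by elim: n => [|n IH]; rewrite ?mul0r ?cexp0// -natr1 mulrDl mul1r cexpD IH exprSr.
Qed.

Lemma cexp_sum (I : Type) (r : seq I) (P : pred I) (F : I -> R[i]) :
  cexp (\sum_(i <- r | P i) F i) = \prod_(i <- r | P i) cexp (F i).
Proof. by elim/big_ind2: _ => [||//]; [exact: cexp0|move=> z x w y <- <-; exact: cexpD]. Qed.

Lemma normc_cexp z : normc (cexp z) = expR (complex.Re z).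
Proof.
case: z => a b; rewrite /cexp /= !exprMn -mulrDr cos2Dsin2 mulr1 sqrtr_sqr.
by rewrite ger0_norm// expR_ge0.
Qed.

Lemma natpowcE n w : (0 < n)%N -> normc (natpowc n w) = n%:R `^ (complex.Re w).
Proof.
move=> n0; rewrite normc_cexp /powR pnatr_eq0 gtn_eqF//.
by case: w => a b /=; rewrite mulr0 subr0.
Qed.

Lemma natpowc1 w : natpowc 1 w = 1 :> R[i].
Proof. by rewrite /natpowc ln1 mulr0 cexp0. Qed.

Lemma expR_bound2 x : `|x| <= 2^-1 -> `|expR x - 1 - x| <= 2 * x ^+ 2.
Proof.
rewrite ler_norml => /andP[x1 x2].
have l := expR_ge1Dx x.
have h := expR_ge1Dx (- x).
have p : 0 < 1 - x by lra.
have u : expR x <= (1 - x)^-1.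
  by rewrite -[x in expR x]opprK expRN lef_pV2 ?posrE ?expR_gt0.
have v : (1 - x)^-1 <= 1 + x + 2 * x ^+ 2.
  by rewrite -[leLHS]mul1r ler_pdivrMr//; nra.
by rewrite ler_norml; apply/andP; split; nra.
Qed.

Lemma sin_MVT x : 0 <= x -> exists2 c, 0 <= c <= x & sin x = cos c * x.
Proof.
move=> x0; have [|c + H] := @MVT_segment R sin cos 0 x x0 (fun y _ => is_derive_sin y).
  by apply: continuous_subspaceT; exact: continuous_sin.
by rewrite in_itv/= => c0; exists c => //; move: H; rewrite sin0 !subr0.
Qed.

Lemma sin_bound1 x : `|sin x| <= `|x|.
Proof.
wlog x0 : x / 0 <= x.
  move=> W; have [/W//|x0] := leP 0 x.
  by rewrite -normrN -sinN -[leRHS]normrN W// oppr_ge0 ltW.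
have [c _ ->] := sin_MVT x0; rewrite normrM ler_piMl//.
by rewrite ler_norml cos_geN1 cos_le1.
Qed.

Lemma cos_mulr2n' x : cos (x *+ 2) = 1 - 2 * sin x ^+ 2.
Proof. by rewrite cos_mulr2n cos2sin2; ring. Qed.

Lemma cos_bound2 x : `|cos x - 1| <= x ^+ 2 / 2.
Proof.
have -> : cos x - 1 = - (2 * sin (x / 2) ^+ 2).
  have {1}-> : x = (x / 2) *+ 2 by rewrite -mulr_natr divfK.
  by rewrite cos_mulr2n'; ring.
rewrite normrN normrM normrX normr_nat.
have := sin_bound1 (x / 2); rewrite -(ler_pXn2r (n := 2)) ?nnegrE//.
rewrite normrM exprMn (@ger0_norm _ 2^-1) ?invr_ge0// (real_normK (num_real x)) => H.
by lra.
Qed.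

Lemma sin_bound2 x : `|x| <= 1 -> `|sin x - x| <= x ^+ 2.
Proof.
wlog x0 : x / 0 <= x.
  move=> W x1; have [/W->//|x0] := leP 0 x.
  have := W (- x); rewrite sinN sqrrN -opprD !normrN; apply=> //.
  by rewrite oppr_ge0 ltW.
rewrite (ger0_norm x0) => x1; have [c /andP[c0 cx] ->] := sin_MVT x0.
have -> : cos c * x - x = (cos c - 1) * x by ring.
rewrite normrM (ger0_norm x0); have := cos_bound2 c; nra.
Qed.

(** Only the quadratic order matters, for [poch_cvg_natpowc]; the constant 20 is crude. *)
Lemma cexp_bound2 z : normc z <= 2^-1 -> normc (cexp z - 1 - z) <= 20 * normc z ^+ 2.
Proof.
case: z => x y z2; apply: (le_trans (normc_le_ReIm _)).
have x2 : `|x| <= 2^-1 by apply: le_trans z2; exact: (Re_le_normc (x +i* y)).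
have y2 : `|y| <= 2^-1 by apply: le_trans z2; exact: (Im_le_normc (x +i* y)).
have y1 : `|y| <= 1 by lra.
rewrite normc_sqrE /= !oppr0 ?subr0 ?addr0.
have e := expR_bound2 x2.
have c := cos_bound2 y.
have s := sin_bound2 y1.
have s1 := sin_bound1 y.
have ->: expR x * cos y - 1 - x = (expR x - 1 - x) + expR x * (cos y - 1) by ring.
have ->: expR x * sin y - y = (expR x - 1) * sin y + (sin y - y) by ring.
have e2 : 0 <= expR x <= 2.
  rewrite expR_ge0/=; move: e x2; rewrite !ler_norml => /andP[_ e] /andP[x3 x4]; nra.
have e3 : `|expR x - 1| <= 2 * `|x|.
  have -> : expR x - 1 = (expR x - 1 - x) + x by ring.
  apply: (le_trans (ler_normD _ _)).
  have : 2 * x ^+ 2 <= `|x| by rewrite -(real_normK (num_real x)); have := normr_ge0 x; nra.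
  lra.
have h1 : `|expR x - 1 - x + expR x * (cos y - 1)| <= 2 * x ^+ 2 + y ^+ 2.
  apply: (le_trans (ler_normD _ _)); rewrite normrM (ger0_norm (expR_ge0 x)).
  have := normr_ge0 (cos y - 1); case/andP: e2 => e20 e21; nra.
have h2 : `|(expR x - 1) * sin y + (sin y - y)| <= x ^+ 2 + y ^+ 2 + y ^+ 2.
  apply: (le_trans (ler_normD _ _)); rewrite normrM.
  have : `|expR x - 1| * `|sin y| <= 2 * `|x| * `|y| by apply: ler_pM.
  have := sqr_ge0 (`|x| - `|y|); rewrite sqrrB !real_normK ?num_real//; lra.
have := sqr_ge0 x; have := sqr_ge0 y; lra.
Qed.

End ComplexNorm.

Section RootsOfUnity.
Context {R : realType}.
Implicit Types (z w x q : R[i]).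

Definition omega (n : nat) : R[i] := cexp ((2 * pi / n%:R)%:C * 'i).

Lemma omegaX n k : omega n ^+ k = cexp ((2 * pi * k%:R / n%:R)%:C * 'i).
Proof.
rewrite -cexpMn; congr cexp; rewrite mulrA; congr (_ * _).
by rewrite -(rmorph_nat (real_complex R)) -rmorphM /=; congr (_%:C); ring.
Qed.

Lemma cexp_itheta (t : R) : cexp (t%:C * 'i) = (cos t) +i* (sin t).
Proof. by rewrite /cexp /= !mul0r !mulr0 !mulr1 subr0 addr0 expR0 !mul1r. Qed.

Lemma omega_expn n : (0 < n)%N -> omega n ^+ n = 1.
Proof.
move=> n0; rewrite omegaX mulfK ?pnatr_eq0 -?lt0n// cexp_itheta.
by rewrite mulrC mulr_natr cos2pi sin2pi.
Qed.

Lemma omega_neq1 n k : (0 < k < n)%N -> omega n ^+ k != 1.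
Proof.
move=> /andP[k0 kn]; rewrite omegaX cexp_itheta; apply/negP => /eqP[H _].
have n0 : 0 < n%:R :> R by rewrite ltr0n (leq_trans _ kn).
have : 0 < sin (pi * k%:R / n%:R : R).
  apply: sin_gt0_pi; apply/andP; split.
    by rewrite divr_gt0// mulr_gt0 ?pi_gt0// ltr0n.
  by rewrite ltr_pdivrMr// ltr_pM2l ?pi_gt0// ltr_nat.
have E : 2 * pi * k%:R / n%:R = (pi * k%:R / n%:R : R) *+ 2 by rewrite mulr2n; ring.
move: H; rewrite E cos_mulr2n' => H.
by have -> : sin (pi * k%:R / n%:R : R) = 0; [apply/eqP; rewrite -sqrf_eq0; apply/eqP; lra|rewrite ltxx].
Qed.

Lemma normc_omega n : normc (omega n) = 1.
Proof. by rewrite normc_cexp /= !mul0r !mulr0 subr0 expR0. Qed.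

Lemma omegaM n m : (0 < m)%N -> omega (n * m) ^+ m = omega n.
Proof.
move=> m0; rewrite omegaX /omega; congr (cexp (_%:C * _)).
have m1 : m%:R != 0 :> R by rewrite pnatr_eq0 -lt0n.
by rewrite natrM invfM mulrAC mulrA mulrAC mulfK// mulrAC.
Qed.

Lemma omega_mod n k : (0 < n)%N -> omega n ^+ (k %% n) = omega n ^+ k.
Proof. by move=> n0; rewrite expr_mod// omega_expn. Qed.

Lemma sum_geom_root (x : R[i]) n : x ^+ n = 1 -> x != 1 -> \sum_(i < n) x ^+ i = 0.
Proof.
move=> xn x1; apply/eqP; have := subrX1 x n; rewrite xn subrr => /esym/eqP.
by rewrite mulf_eq0 subr_eq0 (negbTE x1).
Qed.

Lemma sum_omega n k : (0 < n)%N ->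
  \sum_(i < n) (omega n ^+ k) ^+ i = if (n %| k)%N then n%:R else 0.
Proof.
move=> n0; case: ifPn => [/dvdnP[d ->]|ndk].
  under eq_bigr do rewrite mulnC exprM omega_expn// !expr1n.
  by rewrite sumr_const card_ord.
apply: sum_geom_root; first by rewrite exprAC omega_expn// expr1n.
rewrite -omega_mod//; apply: omega_neq1; rewrite ltn_mod n0 andbT lt0n.
by rewrite -[_ == _]/(n %| k)%N.
Qed.

Lemma sum_mul_ord (V : nmodType) (F : nat -> V) p n :
  \sum_(m < n * p) F m = \sum_(i < n) \sum_(k < p) F (i * p + k)%N.
Proof.
elim: n => [|n IH]; first by rewrite mul0n !big_ord0.
rewrite big_ord_recr /= -IH mulSn addnC big_split_ord /=.
by congr (_ + _); apply: eq_bigr => i _.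
Qed.

(** Orthogonality of the characters of Z / p keeps only the exponents divisible by p. *)
Lemma alias_sum (Q : {poly R[i]}) p n x : (0 < p)%N -> (size Q <= n * p)%N ->
  \sum_(k < p) Q.[omega p ^+ k * x] = p%:R * \sum_(i < n) Q`_(i * p) * (x ^+ p) ^+ i.
Proof.
move=> p0 sQ.
under eq_bigr do rewrite (horner_coef_wide _ sQ).
rewrite exchange_big /= (sum_mul_ord (fun m => \sum_(j < p) Q`_m * (omega p ^+ j * x) ^+ m)).
rewrite mulr_sumr; apply: eq_bigr => i _.
have E m : \sum_(j < p) Q`_m * (omega p ^+ j * x) ^+ m =
    (if (p %| m)%N then p%:R else 0) * (Q`_m * x ^+ m).
  rewrite -sum_omega// mulr_suml; apply: eq_bigr => j _.
  by rewrite exprMn exprAC; ring.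
under eq_bigr do rewrite E.
case: p p0 {sQ E} => // p _; rewrite big_ord_recl /= addn0 dvdn_mull// big1 ?addr0.
  by rewrite mulnC exprM.
move=> j _; rewrite dvdn_addr ?dvdn_mull// gtnNdvd ?mul0r//.
by rewrite ltnS.
Qed.

(** The bound on the size keeps distinct exponents distinct modulo n, so every off-diagonal sum over
    the roots of unity is 0. *)
Lemma parseval_omega (Q : {poly R[i]}) n x : (0 < n)%N -> (size Q <= n)%N ->
  \sum_(i < n) normc Q.[omega n ^+ i * x] ^+ 2 =
  n%:R * \sum_(k < n) normc Q`_k ^+ 2 * (normc x ^+ 2) ^+ k.
Proof.
move=> n0 sQ; apply: complexI; rewrite rmorph_sum /= rmorphM rmorph_sum /= rmorph_nat.
pose c k := Q`_k * x ^+ k.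
transitivity (\sum_(i < n) \sum_(k < n) \sum_(l < n)
    (c k * (c l)^*) * ((omega n ^+ k) * (omega n ^+ l)^*) ^+ i).
  apply: eq_bigr => i _; rewrite normc_sqr (horner_coef_wide _ sQ) rmorph_sum mulr_suml.
  apply: eq_bigr => k _; rewrite mulr_sumr; apply: eq_bigr => l _.
  rewrite /c !exprMn !rmorphM !rmorphXn /= -!exprM ![(i * _)%N]mulnC; ring.
rewrite exchange_big /= mulr_sumr; apply: eq_bigr => k _.
rewrite exchange_big /= (bigD1 k)//= [X in _ + X]big1 ?addr0.
  rewrite -mulr_sumr.
  have -> : omega n ^+ k * (omega n ^+ k)^* = 1.
    by rewrite -normc_sqr normcX normc_omega !expr1n.
  under eq_bigr do rewrite expr1n.
  rewrite sumr_const card_ord mulrC; congr (_ * _).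
  by rewrite -normc_sqr /c normcM normcX exprMn -!exprM mulnC.
move=> l lk; rewrite -mulr_sumr sum_geom_root ?mulr0//.
  by rewrite exprMn -exprM mulnC exprM omega_expn// expr1n -rmorphXn -exprM mulnC exprM omega_expn// expr1n rmorph1 mulr1.
apply/negP => /eqP H.
have {H} : omega n ^+ k = omega n ^+ l.
  have U : omega n ^+ l * (omega n ^+ l)^* = 1.
    by rewrite -normc_sqr normcX normc_omega !expr1n.
  by rewrite -[LHS]mulr1 -[X in _ * X = _]U mulrCA H mulr1.
have W (a b : nat) : (a < b < n)%N -> omega n ^+ a != omega n ^+ b.
  move=> /andP[ab bn]; rewrite -(subnK (ltnW ab)) exprD.
  have o0 : omega n ^+ a != 0.
    by apply/negP => /eqP/(congr1 (@normc R)); rewrite normcX normc_omega expr1n normc0 => /eqP; rewrite oner_eq0.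
  rewrite -[X in X != _]mul1r (inj_eq (mulIf o0)) eq_sym omega_neq1//.
  by rewrite subn_gt0 ab/= (leq_ltn_trans _ bn)// leq_subr.
move/eqP; apply/negP; case: (ltngtP k l) => kl; last by case/eqP: lk; exact/esym/val_inj.
  by apply: W; rewrite kl/=.
by rewrite eq_sym; apply: W; rewrite kl/=.
Qed.

End RootsOfUnity.

Section PochAlgebra.

Lemma poch_recr (K : numFieldType) (x : K) n :
  (n.+1)%:R * poch x n.+1 = (x + n%:R) * poch x n.
Proof.
rewrite pochS (addrC 1) natr1 mulrCA [X in _ * X = _]mulrC divfK ?pnatr_eq0//.
by rewrite mulrC.
Qed.

(** The Chu-Vandermonde identity, that is, (1 - q)^(-a) (1 - q)^(-b) = (1 - q)^(-(a + b)). Splitting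
    n + 1 as j + (n + 1 - j) in each term lets [poch_recr] act on either factor. *)
Lemma poch_conv (K : numFieldType) (a b : K) n :
  \sum_(j < n.+1) poch a j * poch b (n - j) = poch (a + b) n.
Proof.
elim: n => [|n IH]; first by rewrite big_ord_recl big_ord0 !poch0 mulr1 addr0.
apply: (@mulfI _ n.+1%:R); first by rewrite pnatr_eq0.
rewrite poch_recr -IH mulr_sumr.
transitivity (\sum_(j < n.+2) (j%:R * poch a j * poch b (n.+1 - j)) +
  \sum_(j < n.+2) (poch a j * ((n.+1 - j)%:R * poch b (n.+1 - j)))).
  rewrite -big_split; apply: eq_bigr => j _ /=.
  have -> : n.+1%:R = j%:R + (n.+1 - j)%:R :> K by rewrite -natrD subnKC// -ltnS.
  by ring.
rewrite big_ord_recl /= mul0r mul0r add0r [X in _ + X]big_ord_recr /= subnn mul0r mulr0 addr0.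
rewrite -big_split /= mulr_sumr; apply: eq_bigr => j _ /=.
rewrite /bump /= add1n subSS poch_recr.
have jn : (j <= n)%N by rewrite -ltnS.
rewrite subSn// poch_recr natrB//; ring.
Qed.

Lemma poch_ratio (K : numFieldType) (x : K) p m :
  (forall j, x + j%:R != 0) -> (p <= m)%N ->
  poch x m / poch x p = \prod_(p <= j < m) ((x + j%:R) / (1 + j%:R)).
Proof.
move=> x0 pm; have nz k : poch x k != 0.
  apply/prodf_neq0 => j _; rewrite mulf_neq0// invr_eq0 addrC natr1 pnatr_eq0//.
rewrite /poch -!(big_mkord xpredT (fun j => (x + j%:R) / (1 + j%:R))).
rewrite (@big_cat_nat _ _ _ p)//= mulrAC divff ?mul1r//.
by have := nz p; rewrite /poch -(big_mkord xpredT (fun j => (x + j%:R) / (1 + j%:R))).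
Qed.

End PochAlgebra.

Section PochReal.
Context {R : realType}.
Implicit Types (x : R).

Lemma ln_step j : (0 < j)%N ->
  (j.+1%:R : R)^-1 <= ln j.+1%:R - ln j%:R <= (j%:R : R)^-1.
Proof.
move=> j0; have j1 : 0 < j%:R :> R by rewrite ltr0n.
have j2 : 0 < j.+1%:R :> R by rewrite ltr0n.
have E : j.+1%:R = j%:R + 1 :> R by rewrite natr1.
rewrite -ln_div ?posrE//; apply/andP; split.
  rewrite -[ln _]opprK -lnV ?posrE ?divr_gt0// lerNr invf_div.
  apply: le_trans (ln_le_subr1 (divr_gt0 j1 j2)) _.
  have -> : j%:R / j.+1%:R - 1 = - (j.+1%:R)^-1 :> R by rewrite E; field; rewrite gt_eqF// -E.
  by [].
apply: le_trans (ln_le_subr1 (divr_gt0 j2 j1)) _.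
by have -> : j.+1%:R / j%:R - 1 = (j%:R)^-1 :> R by rewrite E; field; rewrite gt_eqF.
Qed.

Lemma sum_ln_step p m : (0 < p)%N -> (p <= m)%N ->
  \sum_(p <= j < m) (ln j.+1%:R - ln j%:R) = ln m%:R - ln p%:R :> R.
Proof. by move=> p0 pm; rewrite (telescope_sumr (fun j : nat => ln j%:R : R)). Qed.

(** Each factor is 1 + (x - 1) / (j + 1), at most exp ((x - 1) (ln (j + 1) - ln j)), and the
    logarithms telescope. *)
Lemma poch_ratio_le x p n : 1 <= x -> (0 < p)%N -> (0 < n)%N ->
  poch x (n * p) / poch x p <= n%:R `^ (x - 1).
Proof.
move=> x1 p0 n0; have pn : (p <= n * p)%N by rewrite leq_pmull.
rewrite poch_ratio//; last first.
  by move=> j; rewrite gt_eqF// ltr_pwDl// (lt_le_trans ltr01).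
have np0 : 0 < n%:R :> R by rewrite ltr0n.
have pp0 : 0 < p%:R :> R by rewrite ltr0n.
have -> : n%:R `^ (x - 1) = expR (\sum_(p <= j < n * p) ((x - 1) * (ln j.+1%:R - ln j%:R))).
  by rewrite -mulr_sumr sum_ln_step// natrM lnM ?posrE// addrK /powR gt_eqF.
rewrite expR_sum big_nat_cond [leRHS]big_nat_cond; apply: ler_prod => j /andP[/andP[pj _] _].
have j1 : 0 < j.+1%:R :> R by rewrite ltr0n.
have E : j.+1%:R = 1 + j%:R :> R by rewrite -natr1 addrC.
have [l1 l2] := andP (ln_step (leq_trans p0 pj)).
have x0 : 0 <= x by lra.
rewrite -E divr_ge0 ?addr_ge0 ?(ltW j1)//=.
apply: le_trans (expR_ge1Dx _); have -> : (x + j%:R) / j.+1%:R = 1 + (x - 1) * j.+1%:R^-1.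
  by rewrite E; field; rewrite -E gt_eqF.
by rewrite lerD2l ler_wpM2l// subr_ge0.
Qed.

(** The truncated binomial series satisfies the differential equation of (1 - y)^(-x) up to its top
    term. *)
Lemma poch_poly_deriv x K y :
  (1 - y) * (\poly_(n < K) poch x n)^`().[y] - x * (\poly_(n < K) poch x n).[y] =
  - (K%:R * poch x K * y ^+ K.-1).
Proof.
rewrite !poly_def; elim: K => [|k IH].
  by rewrite big_ord0 deriv0 horner0 !mulr0 subr0 !mul0r oppr0.
rewrite big_ord_recr /= derivD !hornerD derivZ derivXn !hornerZ hornerMn !hornerXn.
rewrite !mulrDr opprD addrACA IH poch_recr -[y ^+ k.-1 *+ k]mulr_natl.
case: k {IH} => [|k] /=.
  by move: (poch x 0) => b; rewrite expr0; ring.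
rewrite exprS; move: (poch x k.+1) (y ^+ k) (k.+1%:R : R) => b Y c.
ring.
Qed.

Lemma poch_poly_deriv_le x K y : 0 < x -> 0 <= y ->
  (1 - y) * (\poly_(n < K) poch x n)^`().[y] - x * (\poly_(n < K) poch x n).[y] <= 0.
Proof.
move=> x0 y0; rewrite poch_poly_deriv oppr_le0 mulr_ge0 ?exprn_ge0// mulr_ge0//.
by rewrite ltW// poch_gt0.
Qed.

(** The product of (1 - y)^x with the truncated series is nonincreasing in y and at most 1 at y =
    0. *)
Lemma poch_sum_le x (xi : R) K : 0 < x -> 0 <= xi < 1 ->
  \sum_(n < K) poch x n * xi ^+ n <= (1 - xi) `^ (- x).
Proof.
move=> x0 /andP[xi0 xi1].
pose p : {poly R} := \poly_(n < K) poch x n.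
have pE y : p.[y] = \sum_(n < K) poch x n * y ^+ n by rewrite horner_poly.
have pD y : 0 <= y -> (1 - y) * p^`().[y] - x * p.[y] <= 0 by exact: poch_poly_deriv_le.
pose f (y : R) := (1 - y) `^ x * p.[y].
have df (y : R) : y < 1 -> is_derive y (1 : R) f
   ((1 - y) `^ (x - 1) * ((1 - y) * p^`().[y] - x * p.[y])).
  move=> y1; have y10 : 0 < 1 - y by rewrite subr_gt0.
  have D : is_derive y (1 : R) (fun y : R => 1 - y) (-1).
    by have := is_deriveB (is_derive_cst (1 : R) y (1 : R)) (is_derive_id y (1 : R)); rewrite sub0r.
  have D1 := is_derive1_powR x y10.
  have D2 : is_derive y (1 : R) (fun y : R => (1 - y) `^ x) (x * (1 - y) `^ (x - 1) * -1).
    exact: (@is_derive1_comp _ (fun z => z `^ x)).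
  have D3 := is_derive_poly p y.
  have -> : (1 - y) `^ (x - 1) * ((1 - y) * p^`().[y] - x * p.[y]) =
     ((1 - y) `^ x) *: p^`().[y] + p.[y] *: (x * (1 - y) `^ (x - 1) * -1).
    rewrite -(@mulr_powRB1 _ (1 - y) x) ?ltW// /GRing.scale /=; ring.
  exact: is_deriveM.
have H : f xi <= f 0.
  have [->//|xin] := eqVneq xi 0.
  have xip : 0 < xi by rewrite lt0r xin.
  apply: (@ler0_derive1_le_cc _ f 0 xi) => //.
  - by move=> y; rewrite in_itv/= => /andP[y0 y1]; have [] := df y (lt_trans y1 xi1).
  - move=> y; rewrite in_itv/= => /andP[y0 y1]; have [_] := df y (lt_trans y1 xi1).
    rewrite derive1E => ->; rewrite mulr_ge0_le0 ?powR_ge0//; exact: pD (ltW y0).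
  - apply: continuous_in_subspaceT => y /[!inE] /=; rewrite in_itv/= => /andP[_ y1].
    by apply: differentiable_continuous; apply/derivable1_diffP; have [] := df y (le_lt_trans y1 xi1).
  - by rewrite in_itv/= lexx ltW.
  - by rewrite in_itv/= lexx ltW.
have p0 : p.[0] <= 1.
  rewrite pE; case: K {p pE pD f df H} => [|k]; first by rewrite big_ord0.
  rewrite big_ord_recl big1 ?addr0 ?poch0 ?expr0 ?mulr1// => i _.
  by rewrite /= /bump /= exprS mul0r mulr0.
rewrite -pE powRN -[leRHS]mul1r ler_pdivlMr ?powR_gt0 ?subr_gt0//.
rewrite mulrC (le_trans H)// /f subr0 powR1 mul1r//.
Qed.

End PochReal.

Section PochComplex.
Context {R : realType}.
Implicit Types (s z : R[i]).

(** The ratio of |poch s n|^2 to the square of poch (Re s) n, for t = Im s and x = Re s; see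
    [normc_poch]. *)
Definition poch_defect (t x : R) n := \prod_(j < n) (1 + (t / (x + j%:R)) ^+ 2).

Lemma poch_defectS t x n : poch_defect t x n.+1 =
  poch_defect t x n * (1 + (t / (x + n%:R)) ^+ 2).
Proof. by rewrite /poch_defect big_ord_recr. Qed.

Lemma defect_factor_ge1 (t y : R) : 1 <= 1 + (t / y) ^+ 2.
Proof. by rewrite lerDl sqr_ge0. Qed.

Lemma poch_defect_ge1 t x n : 1 <= poch_defect t x n.
Proof.
elim: n => [|n IH]; first by rewrite /poch_defect big_ord0.
by rewrite poch_defectS -[leLHS]mulr1 ler_pM// ?ler01 ?defect_factor_ge1.
Qed.

Lemma poch_defect_nd t x : nondecreasing_seq (poch_defect t x).
Proof.
apply/nondecreasing_seqP => n; rewrite poch_defectS ler_peMr//.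
  by rewrite (le_trans ler01)// poch_defect_ge1.
exact: defect_factor_ge1.
Qed.

Lemma normc_poch s n : 0 < complex.Re s ->
  normc (poch s n) ^+ 2 =
  poch (complex.Re s) n ^+ 2 * poch_defect (complex.Im s) (complex.Re s) n.
Proof.
move=> s0; elim: n => [|n IH].
  by rewrite !poch0 normc1 /poch_defect big_ord0 !expr1n mul1r.
rewrite !pochS normcM exprMn IH poch_defectS [in RHS]exprMn [in RHS]mulrACA; congr (_ * _).
have sn : 0 < complex.Re s + n%:R by rewrite ltr_pwDl// ler0n.
have n1 : 0 < 1 + n%:R :> R by rewrite ltr_pwDl// ler0n.
rewrite normcM normcV exprMn exprVn !normc_sqrE.
have -> : (1 + n%:R : R[i]) = (1 + n%:R)%:C by rewrite rmorphD rmorph1 rmorph_nat.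
have -> : s + n%:R = (complex.Re s + n%:R) +i* complex.Im s.
  have -> : (n%:R : R[i]) = (n%:R)%:C by rewrite rmorph_nat.
  by case: s {IH s0 sn} => a b /=; apply/eqP; rewrite eq_complex /= addr0 !eqxx.
rewrite /= expr0n /= addr0; field.
by rewrite !gt_eqF.
Qed.

Lemma normc_poch_ge s n : 0 < complex.Re s -> poch (complex.Re s) n <= normc (poch s n).
Proof.
move=> s0; rewrite -(ler_pXn2r (n := 2)) ?nnegrE ?normc_ge0//; last by rewrite ltW// poch_gt0.
by rewrite normc_poch// ler_peMr ?sqr_ge0// poch_defect_ge1.
Qed.

Lemma poch_defect_le t x n : 1 <= x -> poch_defect t x n <= expR (2 * t ^+ 2).
Proof.
move=> x1; have F j : 1 + (t / (x + j%:R)) ^+ 2 <= expR (t ^+ 2 * (j.+1%:R^-1) ^+ 2).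
  apply: le_trans (expR_ge1Dx _); rewrite lerD2l expr_div_n ler_wpM2l ?sqr_ge0// -exprVn.
  have j0 : 0 <= j%:R :> R by [].
  have xj : 0 < x + j%:R by lra.
  rewrite ler_pXn2r ?nnegrE ?invr_ge0 ?(ltW xj)// lef_pV2 ?posrE ?ltr0n//.
  by rewrite -natr1; lra.
(* The exponent carries 2 - 1 / (k + 1), a bound for the sum of 1 / (j + 1)^2 over j <= k that is
   stable under induction. *)
suff H k : poch_defect t x k.+1 <= expR (t ^+ 2 * (2 - k.+1%:R^-1)).
  case: n => [|n]; first by rewrite /poch_defect big_ord0 -expR0 ler_expR mulr_ge0 ?sqr_ge0.
  apply: le_trans (H n) _; rewrite ler_expR mulrC ler_wpM2r ?sqr_ge0//.
  by rewrite gerBl invr_ge0.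
elim: k => [|k IH].
  rewrite /poch_defect big_ord_recl big_ord0 mulr1; apply: le_trans (F 0%N) _.
  by rewrite ler_expR invr1 expr1n; lra.
rewrite poch_defectS; apply: (@le_trans _ _ (expR (t ^+ 2 * (2 - k.+1%:R^-1)) * expR (t ^+ 2 * (k.+2%:R^-1) ^+ 2))).
  rewrite ler_pM ?F//; first by rewrite (le_trans ler01)// poch_defect_ge1.
  by rewrite (le_trans ler01)// defect_factor_ge1.
rewrite -expRD ler_expR -mulrDr ler_wpM2l ?sqr_ge0//.
have k1 : 0 < k.+1%:R :> R by rewrite ltr0n.
have k2 : 0 < k.+2%:R :> R by rewrite ltr0n.
have E : k.+1%:R^-1 - k.+2%:R^-1 = k.+1%:R^-1 * k.+2%:R^-1 :> R.
  rewrite -[in k.+2%:R]natr1; move: k1; move: (k.+1%:R : R) => y y0; field.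
  by rewrite !gt_eqF// addr_gt0.
have : k.+2%:R^-1 ^+ 2 <= k.+1%:R^-1 * k.+2%:R^-1 :> R.
  by rewrite expr2 ler_wpM2r ?invr_ge0// lef_pV2 ?posrE// ler_nat.
by move: (k.+1%:R^-1 : R) (k.+2%:R^-1 : R) E => u v; lra.
Qed.

(** The factor of index j on the left is a (2 j), where a j is the factor of index j on the right.
    As a is nonincreasing, a (2 j)^2 <= a (2 j - 1) a (2 j) for j > 0; only a 0 is left over. *)
Lemma poch_defect_half (t x : R) n : 0 < x ->
  poch_defect (t / 2) (x / 2) n ^+ 2 <= (1 + (t / x) ^+ 2) * poch_defect t x (n * 2).
Proof.
move=> x0; pose a j := 1 + (t / (x + j%:R)) ^+ 2.
have a1 j : 1 <= a j by exact: defect_factor_ge1.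
have a0 j : 0 <= a j by rewrite (le_trans ler01).
have an j k : (j <= k)%N -> a k <= a j.
  move=> jk; rewrite lerD2l !expr_div_n ler_wpM2l ?sqr_ge0// lef_pV2 ?posrE ?exprn_gt0 ?ltr_pwDl//.
  by rewrite ler_pXn2r ?nnegrE ?addr_ge0 ?(ltW x0)// lerD2l ler_nat.
have h j : 1 + (t / 2 / (x / 2 + j%:R)) ^+ 2 = a (j * 2)%N.
  rewrite /a natrM; congr (1 + _ ^+ 2); field.
  by rewrite !gt_eqF ?ltr_pwDl ?mulr_ge0//; have : 0 <= j%:R :> R by []; lra.
have D0 k : 0 <= poch_defect t x k by rewrite (le_trans ler01)// poch_defect_ge1.
(* The extra factor a (2 n) closes the induction, whose step replaces a (2 n + 2) by a (2 n + 1). *)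
suff : poch_defect (t / 2) (x / 2) n ^+ 2 * a (n * 2)%N <= a 0%N * poch_defect t x (n * 2).
  rewrite /a addr0 -/(a _) => H; apply: le_trans H.
  by rewrite ler_peMr ?sqr_ge0// a1.
elim: n => [|n IH].
  by rewrite mul0n /poch_defect !big_ord0 expr1n mul1r mulr1.
rewrite poch_defectS h mulSn !addSn add0n !poch_defectS -/(a _) -/(a _) exprMn.
have -> : poch_defect (t / 2) (x / 2) n ^+ 2 * a (n * 2)%N ^+ 2 * a (n * 2).+2 =
  (poch_defect (t / 2) (x / 2) n ^+ 2 * a (n * 2)%N) * (a (n * 2)%N * a (n * 2).+2) by ring.
rewrite [leRHS](_ : _ = (a 0%N * poch_defect t x (n * 2)) * (a (n * 2)%N * a (n * 2).+1)); last by ring.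
apply: ler_pM => //.
- by rewrite mulr_ge0// sqr_ge0.
- by rewrite mulr_ge0.
- by rewrite ler_wpM2l// an.
Qed.

End PochComplex.

Section PochLimit.
Context {R : realType}.
Implicit Types (s z : R[i]).

(** The factors are exchanged one at a time; bounds at least 1 let the missing factor be
    inserted. *)
Lemma prod_diff_le (I : eqType) (r : seq I) (u v : I -> R[i]) (M : I -> R) :
  (forall i, 1 <= M i) -> (forall i, i \in r -> normc (u i) <= M i) ->
  (forall i, i \in r -> normc (v i) <= M i) ->
  normc (\prod_(i <- r) u i - \prod_(i <- r) v i) <=
  (\sum_(i <- r) normc (u i - v i)) * \prod_(i <- r) M i.
Proof.
move=> M1; have M0 i : 0 <= M i by rewrite (le_trans ler01).
elim: r => [|i r IH] uM vM; first by rewrite !big_nil subrr normc0 mul0r.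
have {}IH := IH (fun j jr => uM j (mem_behead (s := i :: r) jr)) (fun j jr => vM j (mem_behead (s := i :: r) jr)).
rewrite !big_cons.
have -> : u i * \prod_(j <- r) u j - v i * \prod_(j <- r) v j =
  u i * (\prod_(j <- r) u j - \prod_(j <- r) v j) + (u i - v i) * \prod_(j <- r) v j by ring.
apply: (le_trans (normc_triangle _ _)); rewrite !normcM mulrDl addrC lerD//.
  apply: ler_wpM2l; rewrite ?normc_ge0//.
  rewrite normc_prod -[leLHS]mul1r ler_pM// ?prodr_ge0//.
    by move=> j _; exact: normc_ge0.
  rewrite big_seq [leRHS]big_seq; apply: ler_prod => j jr; rewrite normc_ge0 vM// in_cons jr orbT//.
rewrite [leRHS]mulrCA ler_pM ?normc_ge0// uM// mem_head//.
Qed.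

(** Both terms are products over the same j, with factors 1 + (s - 1) / (j + 1) and exp ((s - 1) (ln
    (j + 1) - ln j)). Corresponding factors differ by at most (A + 20 A^2) / p^2, there are fewer
    than n p of them, and exp (A n) bounds the products, whence [K]. *)
Lemma poch_cvg_natpowc s n : 0 < complex.Re s -> (0 < n)%N ->
  normc (poch s (n * p.+1) / poch s p.+1 - natpowc n (s - 1)) @[p --> \oo] --> (0 : R).
Proof.
move=> s0 n0; set A := normc (s - 1); have A0 : 0 <= A by exact: normc_ge0.
pose K := n%:R * (A + 20 * A ^+ 2) * expR (A * n%:R).
apply: (@squeeze_cvgr _ _ _ _ (fun=> 0) (fun p : nat => K * p.+1%:R^-1)); last 2 first.
- exact: cvg_cst.
- rewrite -[X in _ --> X](mulr0 K); apply: cvgM; first exact: cvg_cst.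
  exact: cvg_harmonic.
near=> p; rewrite normc_ge0/=.
(* Makes the argument of [cexp] at most 1/2 in modulus, the range of [cexp_bound2]. *)
have Ap : 2 * A <= p.+1%:R.
  have : 2 * A <= p%:R by near: p; exact: nbhs_infty_ger.
  by move=> /le_trans; apply; rewrite ler_nat.
have pn : (p.+1 <= n * p.+1)%N by rewrite leq_pmull.
have p0 : 0 < p.+1%:R :> R by rewrite ltr0n.
rewrite poch_ratio//; last first.
  move=> j; apply/negP => /eqP/(congr1 (@complex.Re _)); rewrite raddfD /=.
  rewrite -(rmorph_nat (real_complex R)) /= => H.
  by move: s0; rewrite ltNge; have : 0 <= j%:R :> R by []; lra.
pose d (j : nat) : R := ln j.+1%:R - ln j%:R.
have -> : natpowc n (s - 1) = \prod_(p.+1 <= j < n * p.+1) cexp ((s - 1) * (d j)%:C).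
  rewrite -cexp_sum -mulr_sumr -rmorph_sum /= sum_ln_step// natrM lnM ?posrE ?ltr0n// addrK.
  by [].
have jP j : j \in index_iota p.+1 (n * p.+1) -> (p.+1 <= j)%N.
  by rewrite mem_index_iota => /andP[].
have dP j : (p.+1 <= j)%N -> 0 <= d j <= j%:R^-1.
  move=> pj; have /andP[l1 l2] := @ln_step R j (leq_trans (ltn0Sn p) pj).
  by rewrite l2 (le_trans _ l1)// invr_ge0.
have uE j : (s + j%:R) / (1 + j%:R) = 1 + (s - 1) * (j.+1%:R^-1)%:C.
  rewrite fmorphV rmorph_nat -natr1 (addrC _ 1); field.
  by rewrite addrC natr1 pnatr_eq0.
have nR (x : R) : 0 <= x -> normc ((s - 1) * x%:C) = A * x.
  by move=> x0; rewrite normcM normcR ger0_norm.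
have jj j : (p.+1 <= j)%N -> 0 < j%:R :> R /\ j.+1%:R^-1 <= j%:R^-1 :> R.
  move=> pj; have j0 : (0 < j)%N by exact: leq_trans pj.
  by rewrite ltr0n lef_pV2 ?posrE ?ltr0n// ler_nat.
apply: (le_trans (prod_diff_le (M := fun j : nat => expR (A * j%:R^-1)) _ _ _)).
- by move=> j; rewrite -expR0 ler_expR mulr_ge0// invr_ge0.
- move=> j /jP pj; rewrite uE; apply: (le_trans (normc_triangle _ _)).
  rewrite normc1 nR ?invr_ge0//; apply: le_trans (expR_ge1Dx _).
  by rewrite lerD2l ler_wpM2l// (jj _ pj).2.
- move=> j /jP pj; have /andP[d0 d1] := dP _ pj; rewrite normc_cexp ler_expR.
  apply: le_trans (ler_norm _) _; apply: le_trans (Re_le_normc _) _.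
  by rewrite nR// ler_wpM2l.
have -> : K * p.+1%:R^-1 = (n%:R * (A + 20 * A ^+ 2) / p.+1%:R) * expR (A * n%:R).
  by rewrite /K; ring.
apply: ler_pM.
- by apply: sumr_ge0 => j _; exact: normc_ge0.
- by apply: prodr_ge0 => j _; exact: expR_ge0.
- apply: (@le_trans _ _ (\sum_(p.+1 <= j < n * p.+1) (A + 20 * A ^+ 2) / p.+1%:R ^+ 2)).
    rewrite big_seq [leRHS]big_seq; apply: ler_sum => j /jP pj.
    have [j0 j1] := jj _ pj; have /andP[d0 d1] := dP _ pj.
    have pjR : p.+1%:R <= j%:R :> R by rewrite ler_nat.
    have iv : j%:R^-1 <= p.+1%:R^-1 :> R by rewrite lef_pV2.
    have ip : 0 < p.+1%:R^-1 :> R by rewrite invr_gt0.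
    have Aj : A * d j <= 2^-1.
      apply: (@le_trans _ _ (A * p.+1%:R^-1)); first by rewrite ler_wpM2l// (le_trans d1).
      rewrite ler_pdivrMr//; lra.
    have -> : (s + j%:R) / (1 + j%:R) - cexp ((s - 1) * (d j)%:C) =
       (s - 1) * (j.+1%:R^-1 - d j)%:C - (cexp ((s - 1) * (d j)%:C) - 1 - (s - 1) * (d j)%:C).
      have -> : (j.+1%:R^-1 - d j)%:C = (j.+1%:R^-1)%:C - (d j)%:C by rewrite rmorphB.
      rewrite uE; set a := cexp _; set b := (_^-1)%:C; set c := (d j)%:C; ring.
    apply: (le_trans (normc_triangle _ _)); rewrite normc_opp.
    have B1 : normc ((s - 1) * (j.+1%:R^-1 - d j)%:C) <= A * p.+1%:R^-1 ^+ 2.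
      rewrite normcM normcR -/A ler_wpM2l//.
      have /andP[l1 l2] := @ln_step R j (leq_trans (ltn0Sn p) pj).
      rewrite ler0_norm; last by rewrite subr_le0.
      have : j%:R^-1 - j.+1%:R^-1 <= p.+1%:R^-1 ^+ 2 :> R.
        have -> : j%:R^-1 - j.+1%:R^-1 = j%:R^-1 * j.+1%:R^-1 :> R.
          by rewrite -natr1; field; rewrite natr1 !gt_eqF ?ltr0n// (leq_trans (ltn0Sn p) pj).
        by rewrite expr2 ler_pM ?invr_ge0// (le_trans j1).
      by move=> H; apply: le_trans H; rewrite opprB lerD2r.
    have B2 : normc (cexp ((s - 1) * (d j)%:C) - 1 - (s - 1) * (d j)%:C) <= 20 * (A ^+ 2 * p.+1%:R^-1 ^+ 2).
      have := @cexp_bound2 _ ((s - 1) * (d j)%:C); rewrite !nR// => /(_ Aj) /le_trans; apply.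
      rewrite exprMn ler_wpM2l// ler_wpM2l ?sqr_ge0// ler_pXn2r ?nnegrE ?(ltW ip)//.
      by rewrite (le_trans d1).
    apply: le_trans (lerD B1 B2) _; rewrite -exprVn; move: (p.+1%:R^-1 : R) => v; lra.
  rewrite sumr_const_nat -[leLHS]mulr_natl.
  have -> : (A + 20 * A ^+ 2) / p.+1%:R ^+ 2 = (A + 20 * A ^+ 2) / p.+1%:R / p.+1%:R.
    by rewrite [p.+1%:R ^+ 2]expr2 invfM mulrA.
  have -> : (n * p.+1 - p.+1)%:R * ((A + 20 * A ^+ 2) / p.+1%:R / p.+1%:R) =
    ((n * p.+1 - p.+1)%:R / p.+1%:R) * ((A + 20 * A ^+ 2) / p.+1%:R) by ring.
  rewrite -[leRHS]mulrA ler_wpM2r//.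
    by rewrite divr_ge0// addr_ge0// mulr_ge0// sqr_ge0.
  by rewrite ler_pdivrMr// -natrM ler_nat leq_subr.
- rewrite -expR_sum ler_expR -mulr_sumr ler_wpM2l//.
  apply: (@le_trans _ _ (\sum_(p.+1 <= j < n * p.+1) p.+1%:R^-1)).
    rewrite big_seq [leRHS]big_seq; apply: ler_sum => j /jP pj.
    by rewrite lef_pV2 ?posrE ?ler_nat// (jj _ pj).1.
  by rewrite sumr_const_nat -[leLHS]mulr_natl ler_pdivrMr// -natrM ler_nat leq_subr.
Unshelve. all: by end_near.
Qed.
End PochLimit.

(** * Averages of the partial sums over rotations *)

Section PochAsymptotics.
Context {R : realType}.
Implicit Types (x y : R).

Lemma cvg_sum0 (I : Type) (r : seq I) (f : I -> nat -> R) :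
  (forall i, f i n @[n --> \oo] --> (0 : R)) ->
  (\sum_(i <- r) f i n) @[n --> \oo] --> (0 : R).
Proof.
move=> H; elim: r => [|i r IH].
  by under eq_fun do rewrite big_nil; exact: cvg_cst.
rewrite (_ : (fun n => _) = (fun n => f i n + \sum_(j <- r) f j n)); last first.
  by apply/funext => n; rewrite big_cons.
by rewrite -[X in _ --> X](addr0 (0 : R)); apply: cvgD.
Qed.

Lemma cvg_powRN y : 0 < y -> (n.+1%:R `^ (- y)) @[n --> \oo] --> (0 : R).
Proof.
move=> y0; have /cvg_at_rightP/(_ (fun n : nat => n.+1%:R^-1)) := powR_cvg0 y0.
move=> H; apply: cvg_trans (H _); last by split; [move=> n; rewrite invr_gt0 ltr0n|exact: cvg_harmonic].
apply: near_eq_cvg; apply: nearW => n /=.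
by rewrite -powR_inv1 ?ler0n// -powRrM mulN1r.
Qed.

Lemma cvg_powR1 (f : nat -> R) y : f n @[n --> \oo] --> (1 : R) ->
  (f n `^ y) @[n --> \oo] --> (1 : R).
Proof.
move=> f1; have := is_derive1_powR y (@ltr01 R) => -[d _].
have c : {for (1 : R), continuous (fun x : R => x `^ y)}.
  by apply: differentiable_continuous; apply/derivable1_diffP; exact: d.
by have := cvg_comp _ _ f1 c; rewrite powR1.
Qed.

(** The limit of the square of poch (x / 2) n over poch (x - 1) n. *)
Definition gamma_square_ratio x := Gamma_fun (x - 1) / Gamma_fun (x / 2) ^+ 2.

(** The ratio is nondecreasing in n, because the comparison of consecutive terms reduces to (x / 2 -
    1)^2 >= 0; so every term lies below the limit. *)
Lemma poch_half_sqr_le x n : 1 < x ->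
  poch (x / 2) n ^+ 2 <= gamma_square_ratio x * poch (x - 1) n.
Proof.
move=> x1; have x0 : 0 < x by rewrite (lt_trans ltr01).
have xh : 0 < x / 2 by rewrite divr_gt0.
have xm : 0 < x - 1 by rewrite subr_gt0.
pose r n := poch (x / 2) n ^+ 2 / poch (x - 1) n.
have pm k := poch_gt0 k xm.
have nd : nondecreasing_seq r.
  apply/nondecreasing_seqP => k; rewrite /r ler_pdivrMr// mulrAC ler_pdivlMr//.
  rewrite !pochS exprMn [leLHS]mulrA [leRHS]mulrAC.
  have AB : 0 <= poch (x / 2) k ^+ 2 * poch (x - 1) k.
    by apply: mulr_ge0; [exact: sqr_ge0|exact: ltW].
  apply: ler_wpM2l => //.
  have k1 : 0 < 1 + k%:R :> R by rewrite ltr_pwDl.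
  rewrite expr_div_n ler_pdivlMr ?exprn_gt0// expr2 mulrA divfK ?gt_eqF//.
  rewrite -subr_ge0 [X in 0 <= X](_ : _ = (x / 2 - 1) ^+ 2) ?sqr_ge0//.
  by move: (k%:R : R) => a; field.
have cv : r k.+1 @[k --> \oo] --> gamma_square_ratio x.
  have c1 := cvg_poch xh; have c2 := cvg_poch xm.
  have L : ((poch (x / 2) k.+1 * k.+1%:R `^ (1 - x / 2)) *
    (poch (x / 2) k.+1 * k.+1%:R `^ (1 - x / 2)) /
    (poch (x - 1) k.+1 * k.+1%:R `^ (1 - (x - 1)))) @[k --> \oo] -->
    ((Gamma_fun (x / 2))^-1 * (Gamma_fun (x / 2))^-1 / (Gamma_fun (x - 1))^-1).
    apply: cvgM; first by apply: cvgM; exact: c1.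
    apply: cvgV; last exact: c2.
    by rewrite invr_eq0 gt_eqF//; exact: Gamma_fun_gt0.
  have -> : gamma_square_ratio x = (Gamma_fun (x / 2))^-1 * (Gamma_fun (x / 2))^-1 / (Gamma_fun (x - 1))^-1.
    by rewrite /gamma_square_ratio invrK -invfM -expr2 mulrC.
  apply: cvg_trans L; apply: near_eq_cvg; apply: nearW => k /=.
  have k0 : 0 < k.+1%:R :> R by rewrite ltr0n.
  have E : k.+1%:R `^ (1 - x / 2) * k.+1%:R `^ (1 - x / 2) = k.+1%:R `^ (1 - (x - 1)) :> R.
    by apply: powRD_gt0 => //; field.
  have z0 : 0 < k.+1%:R `^ (1 - (x - 1)) :> R by rewrite powR_gt0.
  rewrite mulrACA E /r; move: (pm k.+1) z0.
  by move: (poch (x / 2) _) (poch _ _) (_ `^ _) => u v w v0 w0; field; rewrite !gt_eqF.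
have H : r n.+1 <= gamma_square_ratio x.
  rewrite -(cvg_lim _ cv)//.
  apply: (nondecreasing_cvgn_le (u_ := fun k => r k.+1)); last by apply: cvgP cv.
  by move=> a b ab; apply: nd; rewrite ltnS.
have : r n <= gamma_square_ratio x by apply: le_trans H; exact: nd.
by rewrite /r ler_pdivrMr.
Qed.

End PochAsymptotics.

Section Averages.
Context {R : realType}.
Variable s : R[i].
Let sigma : R := complex.Re s.
Let t : R := complex.Im s.
Hypothesis sigma1 : 1 < sigma.

Let sigma0 : 0 < sigma. Proof. by rewrite (lt_trans ltr01). Qed.
Let sh0 : 0 < sigma / 2. Proof. by rewrite divr_gt0. Qed.

Definition Fpartial (M : nat) (q : R[i]) : R[i] :=
  \sum_(1 <= n < M) natpowc n (s - 1) * q ^+ n.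

Definition poch_defect_lim : R := limn (poch_defect t sigma).

(** This is |s| / Re s. *)
Definition norm_Re_ratio : R := Num.sqrt (1 + (t / sigma) ^+ 2).

(** Bounds the ratio of |poch (s / 2) n|^2 to the square of poch (Re s / 2) n uniformly in n, see
    [normc_poch_half]. *)
Definition coef_bound : R := norm_Re_ratio * Num.sqrt poch_defect_lim.

Lemma cvg_poch_defect : poch_defect t sigma @ \oo --> poch_defect_lim.
Proof.
apply: nondecreasing_is_cvgn; first exact: poch_defect_nd.
by exists (expR (2 * t ^+ 2)) => _ [n _ <-]; apply: poch_defect_le; exact: ltW.
Qed.

Lemma poch_defect_le_lim n : poch_defect t sigma n <= poch_defect_lim.
Proof.
apply: nondecreasing_cvgn_le; first exact: poch_defect_nd.
exact: cvgP cvg_poch_defect.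
Qed.

Lemma poch_defect_lim_ge1 : 1 <= poch_defect_lim.
Proof. exact: le_trans (poch_defect_ge1 t sigma 0) (poch_defect_le_lim 0). Qed.

Lemma norm_Re_ratio_ge0 : 0 <= norm_Re_ratio. Proof. exact: sqrtr_ge0. Qed.
Lemma coef_bound_ge0 : 0 <= coef_bound. Proof. by rewrite mulr_ge0// sqrtr_ge0. Qed.

(** As Re s > 1, the ratio is at most 1 + |t|, and pi / 2 >= 1. *)
Lemma norm_Re_ratio_le : norm_Re_ratio <= expR (pi / 2 * `|t|).
Proof.
apply: (@le_trans _ _ (1 + `|t|)).
  rewrite -[leRHS]ger0_norm ?addr_ge0// -sqrtr_sqr ler_wsqrtr//.
  have : (t / sigma) ^+ 2 <= `|t| ^+ 2.
    rewrite expr_div_n real_normK ?num_real// ler_piMr ?sqr_ge0// invf_le1 ?exprn_gt0//.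
    by rewrite expr2 -[leLHS]mulr1 ler_pM// ltW.
  have := normr_ge0 t; nra.
apply: le_trans (expR_ge1Dx _) _; rewrite ler_expR -[leLHS]mul1r ler_wpM2r//.
by have := @pi_ge2 R; lra.
Qed.

Lemma Re_half : complex.Re (s / 2) = sigma / 2.
Proof.
have -> : 2 = (2 : R)%:C by rewrite rmorph_nat.
by rewrite -fmorphV; rewrite /sigma; case: (s) => a b /=; rewrite !mulr0 subr0.
Qed.

Lemma Im_half : complex.Im (s / 2) = t / 2.
Proof.
have -> : 2 = (2 : R)%:C by rewrite rmorph_nat.
by rewrite -fmorphV /t; case: (s) => a b /=; rewrite mulr0 add0r.
Qed.

Lemma normc_poch_half n :
  normc (poch (s / 2) n) ^+ 2 <= coef_bound * poch (sigma / 2) n ^+ 2.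
Proof.
have h0 : 0 < complex.Re (s / 2) by rewrite Re_half.
rewrite normc_poch// Re_half Im_half mulrC ler_wpM2r ?sqr_ge0//.
have B0 : 0 <= poch_defect (t / 2) (sigma / 2) n by rewrite (le_trans ler01)// poch_defect_ge1.
rewrite -[leLHS]ger0_norm// -sqrtr_sqr /coef_bound /norm_Re_ratio -sqrtrM; last by rewrite addr_ge0// sqr_ge0.
apply: ler_wsqrtr; apply: le_trans (poch_defect_half t n sigma0) _.
by rewrite ler_wpM2l ?poch_defect_le_lim// addr_ge0// sqr_ge0.
Qed.

Lemma poch_neq0 n : poch s n != 0.
Proof.
apply/negP => /eqP H; have := normc_poch_ge n sigma0; rewrite H normc0.
by rewrite leNgt poch_gt0.
Qed.

Definition poch_poly (K : nat) : {poly R[i]} := \poly_(n < K) poch (s / 2) n.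

Lemma poch_poly_sqr_coef K m : (m < K)%N -> (poch_poly K * poch_poly K)`_m = poch s m.
Proof.
move=> mK; rewrite coefM -[in RHS](_ : s / 2 + s / 2 = s); last by field.
rewrite -poch_conv; apply: eq_bigr => j _; rewrite !coef_poly.
by rewrite !(leq_ltn_trans _ mK)// ?leq_subr// -ltnS.
Qed.

(** Holds for all m. Beyond K the square of the truncation no longer has the coefficient poch s m,
    and this bound takes over. *)
Lemma poch_poly_sqr_coef_le K m : normc (poch_poly K * poch_poly K)`_m <= coef_bound * poch sigma m.
Proof.
rewrite coefM; apply: (le_trans (normc_sum _ _ _)).
rewrite -[in leRHS](_ : sigma / 2 + sigma / 2 = sigma); last by field.
rewrite -poch_conv mulr_sumr; apply: ler_sum => j _; rewrite normcM.
have B k : normc (poch_poly K)`_k <= Num.sqrt coef_bound * poch (sigma / 2) k.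
  rewrite coef_poly; case: ifP => _; last first.
    by rewrite normc0 mulr_ge0 ?sqrtr_ge0// ltW// poch_gt0.
  have pk0 := ltW (poch_gt0 k sh0).
  rewrite -(ger0_norm (normc_ge0 _)) -(ger0_norm pk0) -!sqrtr_sqr -sqrtrM ?coef_bound_ge0//.
  by apply: ler_wsqrtr; exact: normc_poch_half.
apply: (le_trans (ler_pM (normc_ge0 _) (normc_ge0 _) (B _) (B _))).
by rewrite mulrACA -expr2 sqr_sqrtr// coef_bound_ge0.
Qed.

Lemma Fpartial_ordE M (q : R[i]) : (0 < M)%N -> Fpartial M q =
  \sum_(i < M * 2) (if (0 < i < M)%N then natpowc i (s - 1) else 0) * q ^+ i.
Proof.
move=> M0.
rewrite -(big_mkord xpredT (fun i => (if (0 < i < M)%N then natpowc i (s - 1) else 0) * q ^+ i)).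
rewrite (@big_cat_nat _ _ _ M) /=; [|lia|lia].
rewrite [X in _ = _ + X]big_nat_cond [X in _ = _ + X]big1 => [|n /andP[/andP[Mn _] _]]; last first.
  by rewrite (ltnNge n M) Mn andbF mul0r.
rewrite addr0 [RHS]big_ltn//= mul0r add0r; apply: eq_big_nat => n /andP[n0 nM].
by rewrite n0 nM.
Qed.

(** Summing P^2 over the p-th roots of q and dividing by p poch s p gives a polynomial in q with
    coefficients poch s (i p) / poch s p, close to i^(s-1), for i < M. The three error terms come
    from i = 0, where F has no term, from 0 < i < M, and from M <= i < 2 M, where P^2 goes beyond
    the truncation of F. *)
Lemma average_Fpartial_le (M p : nat) (q q' : R[i]) : (0 < M)%N -> (0 < p)%N ->
  q' ^+ p = q ->
  M%:R^-1 * \sum_(j < M) normc (Fpartial M (omega M ^+ j * q)) <=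
  (normc (poch s p))^-1 * (\sum_(n < M * p) normc (poch (s / 2) n) ^+ 2 * (normc q' ^+ 2) ^+ n)
  + ((normc (poch s p))^-1 +
     \sum_(1 <= n < M) normc (poch s (n * p) / poch s p - natpowc n (s - 1)) * normc q ^+ n
     + coef_bound * \sum_(M <= n < M * 2) n%:R `^ (sigma - 1) * normc q ^+ n).
Proof.
move=> M0 p0 qp; set beta := poch s p; have b0 : beta != 0 by exact: poch_neq0.
pose K := (M * p)%N; pose P := poch_poly K.
have K0 : (0 < K)%N by rewrite muln_gt0 M0.
have Pc k : P.[k] ^+ 2 = (P * P).[k] by rewrite hornerM expr2.
have sP : (size P <= K)%N by exact: size_poly.
have sPP : (size (P * P)%R <= M * 2 * p)%N.
  apply: (leq_trans (size_polyMleq _ _)); rewrite (leq_trans (leq_pred _))//.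
  by rewrite mulnAC muln2 -addnn leq_add.
pose x j := omega K ^+ j * q'.
have xp j : x j ^+ p = omega M ^+ j * q.
  by rewrite /x exprMn qp exprAC -(omegaM M p0).
have al j : \sum_(k < p) P.[omega p ^+ k * x j] ^+ 2 =
   p%:R * \sum_(i < M * 2) (P * P)`_(i * p) * (omega M ^+ j * q) ^+ i.
  by under eq_bigr do rewrite Pc; rewrite (alias_sum _ p0 sPP) xp.
pose e i := (if (0 < i < M)%N then natpowc i (s - 1) else 0) - (P * P)`_(i * p) / beta.
have FE j : Fpartial M (omega M ^+ j * q) =
   (beta^-1 * p%:R^-1) * \sum_(k < p) P.[omega p ^+ k * x j] ^+ 2 +
   \sum_(i < M * 2) e i * (omega M ^+ j * q) ^+ i.
  rewrite al mulrA divfK ?pnatr_eq0 -?lt0n// mulr_sumr -big_split /= Fpartial_ordE//.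
  by apply: eq_bigr => i _; rewrite /e mulrBl mulrA [beta^-1 * _]mulrC addrCA subrr addr0.
have eb : \sum_(i < M * 2) normc (e i) * normc q ^+ i <=
    (normc beta)^-1 +
     \sum_(1 <= n < M) normc (poch s (n * p) / beta - natpowc n (s - 1)) * normc q ^+ n
     + coef_bound * \sum_(M <= n < M * 2) n%:R `^ (sigma - 1) * normc q ^+ n.
  rewrite -(big_mkord xpredT (fun i => normc (e i) * normc q ^+ i)).
  have M20 : (0 < M * 2)%N by rewrite muln_gt0 M0.
  rewrite big_ltn// (@big_cat_nat _ _ _ M) /=; [|lia|lia].
  rewrite addrA; apply: lerD; first apply: lerD.
  - rewrite /e ltnn /= mul0n poch_poly_sqr_coef// poch0 expr0 mulr1 sub0r normc_opp.
    by rewrite mul1r normcV.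
  - rewrite big_nat [leRHS]big_nat; apply: ler_sum => n /andP[n0 nM].
    rewrite /e n0 nM /= poch_poly_sqr_coef; last by rewrite ltn_pmul2r.
    by rewrite -normc_opp opprB.
  rewrite mulr_sumr big_nat [leRHS]big_nat; apply: ler_sum => n /andP[Mn _].
  rewrite mulrA ler_wpM2r ?exprn_ge0 ?normc_ge0// /e (ltnNge n M) Mn andbF sub0r normc_opp.
  have bs := normc_poch_ge p sigma0; have bs0 := poch_gt0 p sigma0.
  have n0 : (0 < n)%N by exact: leq_trans Mn.
  rewrite normcM normcV ler_pdivrMr ?(lt_le_trans bs0)//.
  apply: (le_trans (poch_poly_sqr_coef_le _ _)); rewrite -[leRHS]mulrA ler_wpM2l ?coef_bound_ge0//.
  apply: (@le_trans _ _ (n%:R `^ (sigma - 1) * poch sigma p)); last by rewrite ler_wpM2l ?powR_ge0.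
  by rewrite -ler_pdivrMr//; apply: poch_ratio_le => //; exact: ltW.
have nq j : normc (omega M ^+ j * q) = normc q.
  by rewrite normcM normcX normc_omega expr1n mul1r.
have Fj j : normc (Fpartial M (omega M ^+ j * q)) <=
   (normc beta)^-1 * p%:R^-1 * \sum_(k < p) normc P.[omega p ^+ k * x j] ^+ 2 +
   \sum_(i < M * 2) normc (e i) * normc q ^+ i.
  rewrite FE; apply: (le_trans (normc_triangle _ _)); apply: lerD.
    rewrite !normcM !normcV normc_nat ler_wpM2l ?mulr_ge0 ?invr_ge0 ?normc_ge0//.
    apply: (le_trans (normc_sum _ _ _)); apply: ler_sum => k _.
    by rewrite normcX.
  apply: (le_trans (normc_sum _ _ _)); apply: ler_sum => i _.
  by rewrite normcM normcX nq.
have M0R : 0 < M%:R :> R by rewrite ltr0n.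
apply: (@le_trans _ _ (M%:R^-1 * \sum_(j < M) ((normc beta)^-1 * p%:R^-1 * \sum_(k < p) normc P.[omega p ^+ k * x j] ^+ 2 +
   \sum_(i < M * 2) normc (e i) * normc q ^+ i))).
  by rewrite ler_wpM2l ?invr_ge0// ler_sum.
rewrite big_split /= mulrDr sumr_const card_ord; apply: lerD; last first.
  by rewrite -[X in _ * X]mulr_natl mulKf ?gt_eqF.
(* The rotation by the k-th power of [omega p] and the j-th power of [omega K] is the power k M + j
   of [omega K]: the two families combine into all K-th roots of unity, ready for Parseval. *)
have -> : \sum_(j < M) (normc beta)^-1 * p%:R^-1 * \sum_(k < p) normc P.[omega p ^+ k * x j] ^+ 2 =
   (normc beta)^-1 * p%:R^-1 * (\sum_(i < K) normc P.[omega K ^+ i * q'] ^+ 2).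
  rewrite -mulr_sumr; congr (_ * _); rewrite exchange_big /= /K mulnC.
  rewrite (sum_mul_ord (fun m => normc P.[omega (p * M) ^+ m * q'] ^+ 2)).
  apply: eq_bigr => k _; apply: eq_bigr => j _.
  rewrite /x /K mulrA -(omegaM p M0) -exprM -[(M * p)%N]mulnC -exprD.
  by rewrite [(M * k)%N]mulnC.
rewrite parseval_omega//.
have -> : \sum_(k < K) normc P`_k ^+ 2 * (normc q' ^+ 2) ^+ k =
  \sum_(n < M * p) normc (poch (s / 2) n) ^+ 2 * (normc q' ^+ 2) ^+ n.
  by apply: eq_bigr => n _; rewrite coef_poly ltn_ord.
rewrite natrM; have p0R : 0 < p%:R :> R by rewrite ltr0n.
have bR : 0 < normc beta.
  rewrite lt0r normc_ge0 andbT; apply: contra b0 => /eqP H; exact/eqP/eq0_normc.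
rewrite le_eqVlt; apply/orP; left; apply/eqP.
move: (\sum_(n < _) _) => S.
by field; rewrite !gt_eqF.
Qed.

(** The discrete Fourier transform isolates the coefficient of q, which is 1; the exponent M - 1
    stands for -1 modulo M. *)
Lemma average_Fpartial_ge (M : nat) (q : R[i]) : (1 < M)%N ->
  normc q <= M%:R^-1 * \sum_(j < M) normc (Fpartial M (omega M ^+ j * q)).
Proof.
move=> M1; have M0 : (0 < M)%N by exact: ltnW.
have M0R : 0 < M%:R :> R by rewrite ltr0n.
pose w : R[i] := omega M; have w1 : normc w = 1 by exact: normc_omega.
have E : \sum_(j < M) w ^+ (M.-1 * j) * Fpartial M (w ^+ j * q) = M%:R * q.
  rewrite /Fpartial.
  transitivity (\sum_(1 <= n < M) (natpowc n (s - 1) * q ^+ n) * \sum_(j < M) (w ^+ (M.-1 + n)) ^+ j).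
    under eq_bigr do rewrite mulr_sumr.
    rewrite exchange_big /=; apply: eq_bigr => n _; rewrite mulr_sumr; apply: eq_bigr => j _.
    by rewrite exprMn -!exprM mulnDl exprD [(j * n)%N]mulnC; ring.
  rewrite big_ltn// {1}/w sum_omega// addn1 prednK// dvdnn natpowc1 mul1r expr1.
  rewrite big_nat_cond big1 ?addr0 1?mulrC// => n /andP[/andP[n0 nM] _].
  rewrite /w sum_omega//; case: ifP => [|_]; last by rewrite mulr0.
  have -> : (M.-1 + n = M + n.-1)%N by lia.
  rewrite dvdn_addr// => /dvdn_leq H.
  have n1 : (0 < n.-1)%N by lia.
  by move: (H n1) => H1; exfalso; lia.
have : normc (M%:R * q) <= \sum_(j < M) normc (Fpartial M (w ^+ j * q)).
  rewrite -E; apply: (le_trans (normc_sum _ _ _)); apply: ler_sum => j _.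
  by rewrite normcM normcX w1 expr1n mul1r.
by rewrite normcM normc_nat -ler_pdivlMl.
Qed.

Definition Gamma_average : R := Gamma_fun sigma * gamma_square_ratio sigma.

(** The limit in p of [average_Fpartial_le] at a p-th root of q. [U] dominates the main term: the
    defect of s in the denominator tends to the one inside [coef_bound], so only |s| / Re s
    survives. [V] and [W] dominate the first two errors and tend to 0. *)
Lemma average_Fpartial_limit (M : nat) (w : R[i]) : (0 < M)%N -> complex.Re w < 0 ->
  M%:R^-1 * \sum_(j < M) normc (Fpartial M (omega M ^+ j * cexp w)) <=
  norm_Re_ratio * Gamma_average * (- 2 * complex.Re w) `^ (1 - sigma) +
  coef_bound * \sum_(M <= n < M * 2) n%:R `^ (sigma - 1) * expR (complex.Re w) ^+ n.
Proof.
move=> M0 w0; set T := coef_bound * _; pose L := - complex.Re w.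
have L0 : 0 < L by rewrite oppr_gt0.
have sm : 0 < sigma - 1 by rewrite subr_gt0.
pose U p := (norm_Re_ratio * gamma_square_ratio sigma) * (Num.sqrt poch_defect_lim / Num.sqrt (poch_defect t sigma p.+1)) *
  ((poch sigma p.+1 * p.+1%:R `^ (1 - sigma))^-1 * (2 * L) `^ (1 - sigma)) *
  (1 + 2 * L * p.+1%:R^-1) `^ (sigma - 1).
pose V p := (poch sigma p.+1 * p.+1%:R `^ (1 - sigma))^-1 * p.+1%:R `^ (- (sigma - 1)).
pose W p := \sum_(1 <= n < M) normc (poch s (n * p.+1) / poch s p.+1 - natpowc n (s - 1)) * normc (cexp w) ^+ n.
have cpoch : (poch sigma p.+1 * p.+1%:R `^ (1 - sigma))^-1 @[p --> \oo] --> Gamma_fun sigma.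
  rewrite -[X in _ --> X]invrK; apply: cvgV; last exact: cvg_poch.
  by rewrite invr_eq0 gt_eqF// Gamma_fun_gt0.
have cU : U p @[p --> \oo] --> norm_Re_ratio * Gamma_average * (- 2 * complex.Re w) `^ (1 - sigma).
  have -> : norm_Re_ratio * Gamma_average * (- 2 * complex.Re w) `^ (1 - sigma) =
     (norm_Re_ratio * gamma_square_ratio sigma) * (Num.sqrt poch_defect_lim / Num.sqrt poch_defect_lim) *
     (Gamma_fun sigma * (2 * L) `^ (1 - sigma)) * 1.
    rewrite divff; last by rewrite gt_eqF// sqrtr_gt0 (lt_le_trans ltr01)// poch_defect_lim_ge1.
    by rewrite /Gamma_average /L mulNr mulrN; ring.
  apply: cvgM; first (apply: cvgM; first apply: cvgM; first exact: cvg_cst).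
  - apply: cvgM; first exact: cvg_cst.
    apply: cvgV; first by rewrite gt_eqF// sqrtr_gt0 (lt_le_trans ltr01)// poch_defect_lim_ge1.
    have c : poch_defect t sigma p.+1 @[p --> \oo] --> poch_defect_lim.
      by have := cvg_poch_defect; rewrite -(cvg_shiftS (poch_defect t sigma)).
    exact: (cvg_comp _ _ c (@sqrt_continuous R poch_defect_lim)).
  - by apply: cvgM; [exact: cpoch|exact: cvg_cst].
  - apply: cvg_powR1; rewrite -[X in _ --> X](_ : 1 + 2 * L * 0 = 1); last by rewrite mulr0 addr0.
    apply: cvgD; first exact: cvg_cst.
    by apply: cvgM; [exact: cvg_cst|exact: cvg_harmonic].
have cV : V p @[p --> \oo] --> (0 : R).
  by rewrite -[X in _ --> X](mulr0 (Gamma_fun sigma)); apply: cvgM => //; exact: cvg_powRN.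
have cW : W p @[p --> \oo] --> (0 : R).
  case: M M0 @T @W => // M _ T W.
  rewrite /W; under eq_fun do rewrite big_add1 /=.
  apply: cvg_sum0 => n.
  rewrite -[X in _ --> X](mul0r (normc (cexp w) ^+ n.+1)); apply: cvgM; last exact: cvg_cst.
  exact: poch_cvg_natpowc.
have c3 : (U p + (V p + W p + T)) @[p --> \oo] -->
   norm_Re_ratio * Gamma_average * (- 2 * complex.Re w) `^ (1 - sigma) + (0 + 0 + T).
  by apply: cvgD => //; apply: cvgD; [exact: cvgD|exact: cvg_cst].
rewrite !add0r in c3; apply: (cvgr_to_ge c3); apply: nearW => p.
have p0R : 0 < p.+1%:R :> R by rewrite ltr0n.
have qp : cexp (w * (p.+1%:R^-1)%:C) ^+ p.+1 = cexp w.
  rewrite -cexpMn mulrCA -(rmorph_nat (real_complex R)) -rmorphM /= mulfV ?gt_eqF//.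
  by rewrite rmorph1 mulr1.
apply: (le_trans (average_Fpartial_le M0 (ltn0Sn p) qp)).
have bs := normc_poch_ge p.+1 sigma0; have bs0 := poch_gt0 p.+1 sigma0.
have b0 : 0 < normc (poch s p.+1) by exact: lt_le_trans bs.
have pw0 : 0 < p.+1%:R `^ (1 - sigma) :> R by rewrite powR_gt0.
apply: lerD; last first.
  rewrite normc_cexp -/T !lerD2r; rewrite /W normc_cexp lerD2r /V opprB invfM -mulrA mulVf ?gt_eqF// mulr1.
  by rewrite lef_pV2 ?posrE.
have rq : normc (cexp (w * (p.+1%:R^-1)%:C)) ^+ 2 = expR (- (2 * L * p.+1%:R^-1)).
  rewrite normc_cexp -expRM_natl /L; congr expR.
  by case: (w) => a b /=; rewrite mulr0 subr0; ring.
rewrite rq; set u := 2 * L * p.+1%:R^-1.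
have u0 : 0 < u by rewrite mulr_gt0 ?mulr_gt0 ?invr_gt0.
set xi := expR (- u).
have xi01 : 0 <= xi < 1 by rewrite expR_ge0 expR_lt1 oppr_lt0.
(* From exp u >= 1 + u. As u is of order 1 / p, the loss is a factor tending to 1. *)
have xiu : u / (1 + u) <= 1 - xi.
  have u1 : 0 < 1 + u by rewrite addr_gt0.
  have : xi <= (1 + u)^-1 by rewrite /xi expRN lef_pV2 ?posrE ?expR_gt0// expR_ge1Dx.
  have -> : u / (1 + u) = 1 - (1 + u)^-1 by field; rewrite gt_eqF.
  by lra.
have g0 : 0 < gamma_square_ratio sigma.
  by rewrite divr_gt0 ?exprn_gt0 ?Gamma_fun_gt0.
have S1 : \sum_(n < M * p.+1) normc (poch (s / 2) n) ^+ 2 * xi ^+ n <=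
   coef_bound * gamma_square_ratio sigma * (1 - xi) `^ (- (sigma - 1)).
  apply: (@le_trans _ _ (\sum_(n < M * p.+1) (coef_bound * gamma_square_ratio sigma) * (poch (sigma - 1) n * xi ^+ n))).
    apply: ler_sum => n _; rewrite !mulrA ler_wpM2r ?exprn_ge0 ?expR_ge0//.
    apply: (le_trans (normc_poch_half n)); rewrite -[coef_bound * _ / _]mulrA -[leRHS]mulrA.
    rewrite ler_wpM2l ?coef_bound_ge0//; exact: poch_half_sqr_le.
  rewrite -mulr_sumr ler_wpM2l//; first by rewrite mulr_ge0 ?coef_bound_ge0// ltW.
  exact: poch_sum_le.
have S2 : (1 - xi) `^ (- (sigma - 1)) <= (u / (1 + u)) `^ (- (sigma - 1)).
  have u1 : 0 < u / (1 + u) by rewrite divr_gt0// addr_gt0.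
  rewrite !powRN lef_pV2 ?posrE ?powR_gt0//; last by rewrite (lt_le_trans u1).
  by rewrite ge0_ler_powR ?nnegrE ?(ltW u1) ?(ltW sm)// (le_trans (ltW u1)).
have bE : normc (poch s p.+1) = poch sigma p.+1 * Num.sqrt (poch_defect t sigma p.+1).
  rewrite -[LHS]ger0_norm ?normc_ge0// -sqrtr_sqr normc_poch//.
  by rewrite sqrtrM ?sqr_ge0// sqrtr_sqr ger0_norm// ltW.
apply: (@le_trans _ _ ((normc (poch s p.+1))^-1 * (coef_bound * gamma_square_ratio sigma * (u / (1 + u)) `^ (- (sigma - 1))))).
  rewrite ler_wpM2l ?invr_ge0 ?(ltW b0)//; apply: (le_trans S1).
  by rewrite ler_wpM2l// mulr_ge0 ?coef_bound_ge0// ltW.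
rewrite le_eqVlt; apply/orP; left; apply/eqP; rewrite bE /U /coef_bound -/u.
have -> : (u / (1 + u)) `^ (- (sigma - 1)) =
   (2 * L) `^ (1 - sigma) * (p.+1%:R `^ (1 - sigma))^-1 * (1 + u) `^ (sigma - 1).
  have u1 : 0 < 1 + u by rewrite addr_gt0.
  rewrite opprB powRM ?(ltW u0) ?invr_ge0 ?(ltW u1)// {1}/u powRM ?invr_ge0 ?mulr_ge0 ?(ltW L0) ?ler0n//.
  have iE (y : R) : 0 < y -> (y^-1) `^ (1 - sigma) = (y `^ (1 - sigma))^-1.
    by move=> y0; rewrite -powR_inv1 ?(ltW y0)// powRAC powR_inv1// powR_ge0.
  by rewrite !iE// -[sigma - 1]opprB [in RHS]powRN.
move: (gamma_square_ratio sigma) => g.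
have d0 : 0 < Num.sqrt (poch_defect t sigma p.+1).
  by rewrite sqrtr_gt0 (lt_le_trans ltr01)// poch_defect_ge1.
by field; rewrite !gt_eqF.
Qed.

End Averages.

(** * Row averages of the series F *)

Section ComplexConvergence.
Context {R : realType} (T : Type) (F : set_system T) {FF : Filter F}.
Implicit Types (f : T -> R[i]) (l : R[i]).

Lemma cvg_complex f l : (@complex.Re R) \o f @ F --> complex.Re l ->
  (@complex.Im R) \o f @ F --> complex.Im l -> (f : T -> R[i]^o) @ F --> (l : R[i]^o).
Proof.
move=> /cvgrPdist_lt cr /cvgrPdist_lt ci; apply/cvgrPdist_lt => -[e e'].
rewrite ltcE /= => /andP[/eqP e'0 e0].
have e2 : 0 < e / 2 by rewrite divr_gt0.
near=> t.
have h1 : `|complex.Re l - complex.Re (f t)| < e / 2 by near: t; exact: cr.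
have h2 : `|complex.Im l - complex.Im (f t)| < e / 2 by near: t; exact: ci.
rewrite normc_norm ltcE /= e'0 eqxx /=.
apply: le_lt_trans (normc_le_ReIm _) _.
by move: h1 h2; case: (f t) => c d; case: (l) => a b /= h1 h2; lra.
Unshelve. all: by end_near. Qed.

Lemma cvg_normc f l : (f : T -> R[i]^o) @ F --> (l : R[i]^o) ->
  (fun t => normc (f t)) @ F --> normc l.
Proof.
move=> /cvgrPdist_lt cf; apply/cvgrPdist_lt => e e0.
have e1 : 0 < e%:C by rewrite ltcR.
apply: filterS (cf _ e1) => t /=; rewrite normc_norm ltcR.
exact: le_lt_trans (normc_distl _ _).
Qed.

End ComplexConvergence.

Section ComplexMeasurability.
Context d (T : measurableType d) {R : realType}.
Implicit Types f g : T -> R[i].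

Definition cmeasurable f :=
  measurable_fun setT ((@complex.Re R) \o f) /\ measurable_fun setT ((@complex.Im R) \o f).

Lemma cmeasurable_cst c : cmeasurable (fun=> c).
Proof. by split; exact: measurable_cst. Qed.

Lemma cmeasurableD f g : cmeasurable f -> cmeasurable g -> cmeasurable (fun t => f t + g t).
Proof.
move=> [f1 f2] [g1 g2]; split.
- have := measurable_funD f1 g1; apply: eq_measurable_fun => t _ /=.
  by case: (f t) (g t) => ? ? [].
- have := measurable_funD f2 g2; apply: eq_measurable_fun => t _ /=.
  by case: (f t) (g t) => ? ? [].
Qed.

Lemma cmeasurableM f g : cmeasurable f -> cmeasurable g -> cmeasurable (fun t => f t * g t).
Proof.
move=> [f1 f2] [g1 g2]; split.
- have := measurable_funB (measurable_funM f1 g1) (measurable_funM f2 g2).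
  by apply: eq_measurable_fun => t _ /=; case: (f t) (g t) => ? ? [].
- have := measurable_funD (measurable_funM f1 g2) (measurable_funM f2 g1).
  by apply: eq_measurable_fun => t _ /=; case: (f t) (g t) => ? ? [].
Qed.

Lemma cmeasurableX f n : cmeasurable f -> cmeasurable (fun t => f t ^+ n).
Proof.
move=> mf; elim: n => [|n IH]; first exact: (cmeasurable_cst 1).
rewrite (_ : (fun t => _) = (fun t => f t * f t ^+ n)); first exact: cmeasurableM.
by apply/funext => t; rewrite exprS.
Qed.

Lemma cmeasurable_sum (I : Type) (r : seq I) (F : I -> T -> R[i]) :
  (forall i, cmeasurable (F i)) -> cmeasurable (fun t => \sum_(i <- r) F i t).
Proof.
move=> mF; elim: r => [|i r IH].
  rewrite (_ : (fun t => _) = fun=> 0); first exact: cmeasurable_cst.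
  by apply/funext => t; rewrite big_nil.
rewrite (_ : (fun t => _) = (fun t => F i t + \sum_(j <- r) F j t)); first exact: cmeasurableD.
by apply/funext => t; rewrite big_cons.
Qed.

Lemma cmeasurable_cexp f : cmeasurable f -> cmeasurable (fun t => cexp (f t)).
Proof.
move=> [f1 f2].
have me : measurable_fun setT (fun t => expR (complex.Re (f t))).
  by apply: (measurableT_comp (@measurable_expR R)).
split.
- have mc : measurable_fun setT (fun t => cos (complex.Im (f t))).
    exact: (measurableT_comp (continuous_measurable_fun (@continuous_cos R))).
  by have := measurable_funM me mc; apply: eq_measurable_fun => t _ /=; case: (f t).
- have ms : measurable_fun setT (fun t => sin (complex.Im (f t))).
    exact: (measurableT_comp (continuous_measurable_fun (@continuous_sin R))).
  by have := measurable_funM me ms; apply: eq_measurable_fun => t _ /=; case: (f t).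
Qed.

Lemma cmeasurable_normc f : cmeasurable f -> measurable_fun setT (fun t => normc (f t)).
Proof.
move=> [f1 f2].
have m2 : measurable_fun setT (fun t => complex.Re (f t) ^+ 2 + complex.Im (f t) ^+ 2).
  by apply: measurable_funD; exact: measurable_funX.
have := measurableT_comp (continuous_measurable_fun (@sqrt_continuous R)) m2.
by apply: eq_measurable_fun => t _ /=; case: (f t).
Qed.

End ComplexMeasurability.

Section Majorant.
Context {R : realType}.
Implicit Types (a L : R).

(* [ln x <= x - 1] at [x = b n], with [b = L / (2 a)]. *)
Lemma powR_exp_le a L : 0 < a -> 0 < L -> exists2 K, 0 < K &
  forall n, (0 < n)%N -> n%:R `^ a * expR (- L) ^+ n <= K * expR (- (L / 2)) ^+ n.
Proof.
move=> a0 L0; pose b := L / (2 * a).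
have b0 : 0 < b by rewrite divr_gt0// mulr_gt0.
exists (expR (a * (- 1 - ln b))) => [|n n0]; first exact: expR_gt0.
have n0R : 0 < n%:R :> R by rewrite ltr0n.
rewrite /powR gt_eqF// -!expRM_natl -!expRD ler_expR.
have nb0 : 0 < n%:R * b by rewrite mulr_gt0.
have := ln_le_subr1 nb0; rewrite lnM ?posrE// => H.
have {}H : a * ln n%:R <= a * (n%:R * b - 1 - ln b) by rewrite ler_pM2l//; lra.
apply: (le_trans (lerD H (lexx _))).
rewrite le_eqVlt; apply/orP; left; apply/eqP; rewrite /b.
by move: (ln _) (n%:R : R) => l m; field; rewrite gt_eqF.
Qed.

Lemma geometric_sum_le (rho : R) (M M' : nat) : 0 <= rho < 1 ->
  \sum_(M <= n < M') rho ^+ n <= rho ^+ M / (1 - rho).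
Proof.
move=> /andP[r0 r1]; have d : 0 < 1 - rho by rewrite subr_gt0.
have B0 : 0 <= rho ^+ M / (1 - rho) by rewrite divr_ge0 ?exprn_ge0// ltW.
have [MM|/ltnW MM] := leqP M' M; first by rewrite big_geq.
rewrite -{1}[M]addn0 -{1}(subnKC MM) addnC [(M + _)%N]addnC big_addn addnK.
under eq_bigr do rewrite exprD mulrC; rewrite -mulr_sumr ler_wpM2l ?exprn_ge0//.
rewrite -[leRHS]mul1r ler_pdivlMr// mulrC -opprB mulNr big_mkord -subrX1 opprB.
by rewrite gerBl exprn_ge0.
Qed.

End Majorant.

Section QExpansion.
Context {R : realType}.
Local Notation RT := (measurableTypeR R).
Local Notation mu := (@lebesgue_measure R).
Variables (h : R) (s : R[i]).
Hypotheses (h0 : 0 < h) (s1 : 1 < complex.Re s).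
Let sigma := complex.Re s.
Let sm : 0 < sigma - 1. Proof. by rewrite subr_gt0. Qed.

(** This is 2 pi i z / h for z = x + i y. *)
Definition qlog (x y : R) : R[i] := (- (2 * pi * y / h)) +i* (2 * pi * x / h).

Lemma cexp_period z (k : int) : cexp (z + (2 * pi * k%:~R)%:C * 'i) = cexp z :> R[i].
Proof.
have P n w : cexp (w + (2 * pi * n%:R)%:C * 'i) = cexp w :> R[i].
  have -> : 2 * pi * n%:R = 2 * pi * n%:R / 1%:R :> R by rewrite divr1.
  rewrite cexpD -omegaX.
  by rewrite -[omega 1]expr1 omega_expn// expr1n mulr1.
case: k => n; first exact: P.
rewrite NegzE mulrNz mulrN rmorphN mulNr -[LHS](P n.+1); congr cexp.
by rewrite subrK.
Qed.

Lemma qlog_shift x y a : qlog (x + a) y = qlog x y + (2 * pi * (a / h))%:C * 'i.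
Proof.
apply/eqP; rewrite eq_complex /=; apply/andP; split; apply/eqP; rewrite ?mul0r ?mulr0; [by ring|].
by field; rewrite gt_eqF.
Qed.

Lemma cexp_qlog_period x y (k : int) : cexp (qlog (x + k%:~R * h) y) = cexp (qlog x y).
Proof. by rewrite qlog_shift mulfK ?gt_eqF// cexp_period. Qed.

Lemma cexp_qlog_omega x y M j :
  cexp (qlog (x + j%:R * (h / M%:R)) y) = omega M ^+ j * cexp (qlog x y).
Proof.
rewrite qlog_shift cexpD mulrC omegaX; congr (cexp (_%:C * _) * _).
rewrite -!mulrA; congr (_ * (_ * (_ * _))).
by rewrite mulrCA mulfV ?mulr1// gt_eqF.
Qed.

Lemma normc_qexp x y : normc (cexp (qlog x y)) = expR (- (2 * pi * y / h)).
Proof. by rewrite normc_cexp. Qed.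

Lemma normc_term n (q : R[i]) : (0 < n)%N ->
  normc (natpowc n (s - 1) * q ^+ n) = n%:R `^ (sigma - 1) * normc q ^+ n.
Proof.
move=> n0; rewrite normcM normcX natpowcE//; congr (_ `^ _ * _).
by rewrite /sigma; case: (s).
Qed.

(** One constant for all n: half of the exponential decay absorbs the power of n. *)
Definition majorant y (K : R) := 0 < K /\ forall n, (0 < n)%N ->
  n%:R `^ (sigma - 1) * expR (- (2 * pi * y / h)) ^+ n <= K * expR (- (2 * pi * y / h / 2)) ^+ n.

Lemma exists_majorant y : 0 < y -> exists K, majorant y K.
Proof.
move=> y0; have L0 : 0 < 2 * pi * y / h.
  by rewrite divr_gt0// mulr_gt0// mulr_gt0// pi_gt0.
by have [K K0 H] := powR_exp_le sm L0; exists K.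
Qed.

Definition tail_bound y K (M : nat) : R :=
  K * (expR (- (2 * pi * y / h / 2)) ^+ M / (1 - expR (- (2 * pi * y / h / 2)))).

Lemma rho01 y : 0 < y -> 0 <= expR (- (2 * pi * y / h / 2)) < 1.
Proof.
move=> y0; rewrite expR_ge0 expR_lt1 oppr_lt0 divr_gt0// divr_gt0//.
by rewrite mulr_gt0// mulr_gt0// pi_gt0.
Qed.

Lemma tail_sum_le y K M M' : 0 < y -> majorant y K -> (0 < M)%N ->
  \sum_(M <= n < M') n%:R `^ (sigma - 1) * expR (- (2 * pi * y / h)) ^+ n <= tail_bound y K M.
Proof.
move=> y0 [K0 HK] M0.
apply: (@le_trans _ _ (\sum_(M <= n < M') K * expR (- (2 * pi * y / h / 2)) ^+ n)).
  rewrite big_nat [leRHS]big_nat; apply: ler_sum => n /andP[Mn _].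
  by apply: HK; exact: leq_trans Mn.
by rewrite -mulr_sumr /tail_bound ler_pM2l// geometric_sum_le// rho01.
Qed.

Lemma cvg_tail_bound y K : 0 < y -> tail_bound y K M @[M --> \oo] --> (0 : R).
Proof.
move=> y0; have /andP[r0 r1] := rho01 y0.
rewrite -[X in _ --> X](mulr0 K) /tail_bound; apply: cvgM; first exact: cvg_cst.
rewrite -[X in _ --> X](mul0r (1 - expR (- (2 * pi * y / h / 2)))^-1); apply: cvgM; last exact: cvg_cst.
by apply: cvg_expr; rewrite ger0_norm.
Qed.

Lemma Fpartial_tail x y K M M' : 0 < y -> majorant y K -> (0 < M <= M')%N ->
  normc (Fpartial s M' (cexp (qlog x y)) - Fpartial s M (cexp (qlog x y))) <= tail_bound y K M.
Proof.
move=> y0 HK /andP[M0 MM]; rewrite /Fpartial (@big_cat_nat _ _ _ M _ M')//= addrAC subrr add0r.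
apply: (le_trans (normc_sum _ _ _)); apply: le_trans (tail_sum_le M' y0 HK M0).
rewrite big_nat [leRHS]big_nat; apply: ler_sum => n /andP[Mn _].
by rewrite normc_term ?normc_qexp// (leq_trans M0).
Qed.

Lemma cvg_Fpartial x y : 0 < y ->
  cvgn ((fun M => Fpartial s M (cexp (qlog x y))) : nat -> R[i]^o).
Proof.
move=> y0; have [K HK] := exists_majorant y0; have [K0 HK'] := HK; have r01 := rho01 y0.
set q := cexp _.
pose a n := if n == 0%N then 0 else natpowc n (s - 1) * q ^+ n.
have aE : (fun M => Fpartial s M.+1 q) = (fun M => \sum_(0 <= n < M.+1) a n).
  apply/funext => M; rewrite /Fpartial [RHS]big_ltn// add0r; apply: eq_big_nat => n /andP[n0 _].
  by rewrite /a gtn_eqF.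
have ab n : normc (a n) <= geometric K (expR (- (2 * pi * y / h / 2))) n.
  rewrite /a; case: eqP => [->|/eqP n0]; first by rewrite normc0 /= mulr_ge0 ?(ltW K0)// exprn_ge0 ?expR_ge0.
  by rewrite normc_term ?lt0n// normc_qexp /=; apply: HK'; rewrite lt0n.
have C (p : R[i] -> R) : (forall z, `|p z| <= normc z) -> cvgn (series (p \o a)).
  move=> pz; apply: normed_cvg; apply: (series_le_cvg (v_ := geometric K (expR (- (2 * pi * y / h / 2))))).
  - by move=> n /=.
  - by move=> n; rewrite (le_trans (normc_ge0 _) (ab n)).
  - by move=> n /=; exact: le_trans (pz _) (ab n).
  by apply: is_cvg_geometric_series; case/andP: r01 => r0 r1; rewrite ger0_norm.
have sE (p : {additive R[i] -> R}) : (fun M => p (\sum_(0 <= n < M.+1) a n)) = (fun M => series (p \o a) M.+1).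
  by apply/funext => M; rewrite raddf_sum.
have /cvg_ex[l1 c1] := C _ (@Re_le_normc R); have /cvg_ex[l2 c2] := C _ (@Im_le_normc R).
apply/cvg_ex; exists (l1 +i* l2); rewrite -(cvg_shiftS (fun M => Fpartial s M q : R[i]^o)) aE.
apply: cvg_complex => /=.
- have -> : (@complex.Re R) \o (fun M => \sum_(0 <= n < M.+1) a n) = (fun M => series ((@complex.Re R) \o a) M.+1).
    by apply/funext => M /=; rewrite /series /= (raddf_sum (@complex.Re R : {additive R[i] -> R})).
  by rewrite (cvg_shiftS (series ((@complex.Re R) \o a))).
- have -> : (@complex.Im R) \o (fun M => \sum_(0 <= n < M.+1) a n) = (fun M => series ((@complex.Im R) \o a) M.+1).
    by apply/funext => M /=; rewrite /series /= (raddf_sum (@complex.Im R : {additive R[i] -> R})).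
  by rewrite (cvg_shiftS (series ((@complex.Im R) \o a))).
Qed.

Lemma cvg_Fseries (z : uhp R) :
  ((fun M => Fpartial s M (cexp (qlog (complex.Re z) (complex.Im z)))) : nat -> R[i]^o) @ \oo -->
  (Fseries h s z : R[i]^o).
Proof.
have y0 := uhp_valP z.
rewrite /Fseries (_ : (fun N => _) = (fun M => Fpartial s M (cexp (qlog (complex.Re z) (complex.Im z)))) :> (nat -> R[i]^o)).
  exact: cvg_Fpartial.
apply/funext => M; rewrite /Fpartial; apply: eq_bigr => n _.
rewrite -cexpMn; congr (_ * cexp _); case: (uhp_val z) => x y.
rewrite -(rmorph_nat (real_complex R)) /qlog.
by apply/eqP; rewrite eq_complex /=; apply/andP; split; apply/eqP; field; rewrite gt_eqF.
Qed.

(** The upper limit makes |F| an extended real function on the whole plane that is measurable as it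
    stands; for y > 0 it is a limit and equals |F|, see [absF_Fseries]. *)
Definition absF (p : RT * RT) : \bar R :=
  limn_esup (fun M => (normc (Fpartial s M (cexp (qlog p.1 p.2))))%:E).

Lemma absF_ge0 p : (0 <= absF p)%E.
Proof.
apply: le_ereal_inf_tmp => _ [V FV <-]; have [n Vn] := filter_ex FV.
by apply: le_trans (ereal_sup_ubound _); last (by exists n; [exact: Vn|]); rewrite lee_fin normc_ge0.
Qed.

Lemma measurable_absF : measurable_fun setT absF.
Proof.
apply: measurable_fun_limn_esup => M; apply/measurable_EFinP; apply: cmeasurable_normc.
apply: cmeasurable_sum => n; apply: cmeasurableM; first exact: cmeasurable_cst.
apply: cmeasurableX; apply: cmeasurable_cexp.
have m1 : measurable_fun [set: RT * RT] (fun p => - (2 * pi * p.2 / h) : R).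
  apply: measurableT_comp => //; do 2 apply: measurable_funM => //; exact: measurable_snd.
have m2 : measurable_fun [set: RT * RT] (fun p => 2 * pi * p.1 / h : R).
  by do 2 apply: measurable_funM => //; exact: measurable_fst.
by split; [exact: m1|exact: m2].
Qed.

Lemma absF_cvg (x y : R) : 0 < y -> exists2 l : R, absF (x, y) = l%:E &
  normc (Fpartial s M (cexp (qlog x y))) @[M --> \oo] --> l.
Proof.
move=> y0; have /cvg_ex[l cl] := @cvg_Fpartial x y y0; have cn : normc (Fpartial s M (cexp (qlog x y))) @[M --> \oo] --> normc l by apply: cvg_normc.
exists (normc l) => //; rewrite /absF; refine (cvg_limn_einf_sup _).2.
by apply: cvg_EFin; [exact: nearW|exact: cn].
Qed.

Lemma absF_Fseries (z : uhp R) :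
  absF (complex.Re z, complex.Im z) = (normc (Fseries h s z))%:E.
Proof.
have y0 := uhp_valP z; have [l -> cl] := absF_cvg (complex.Re z) y0; congr EFin.
apply: (cvg_unique _ cl) => //; apply: cvg_normc; exact: cvg_Fseries.
Qed.

Lemma absF_period (k : int) (x y : R) : absF ((x + k%:~R * h : R), y) = absF (x, y).
Proof. by rewrite /absF; congr limn_esup; apply/funext => M; congr (normc (Fpartial s M _))%:E; exact: cexp_qlog_period. Qed.

Lemma absF_approx x y K M : 0 < y -> majorant y K -> (0 < M)%N ->
  exists2 l : R, absF (x, y) = l%:E &
  `|l - normc (Fpartial s M (cexp (qlog x y)))| <= tail_bound y K M.
Proof.
move=> y0 HK M0; have [l lE cl] := absF_cvg x y0; exists l => //.
have c : `|normc (Fpartial s M' (cexp (qlog x y))) - normc (Fpartial s M (cexp (qlog x y)))| @[M' --> \oo] -->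
    `|l - normc (Fpartial s M (cexp (qlog x y)))|.
  by apply: cvg_norm; apply: cvgB => //; exact: cvg_cst.
apply: (cvgr_to_le c); near=> M'; apply: le_trans (normc_distl _ _) _.
by apply: Fpartial_tail => //; rewrite M0 /=; near: M'; exact: nbhs_infty_ge.
Unshelve. all: by end_near. Qed.

Local Open Scope ereal_scope.

Lemma absF_average x y K M : (0 < y)%R -> majorant y K -> (0 < M)%N ->
  exists2 l : R, M%:R^-1%:E * \sum_(j < M) absF (x + j%:R * (h / M%:R), y)%R = l%:E &
  (`|l - M%:R^-1 * \sum_(j < M) normc (Fpartial s M (omega M ^+ j * cexp (qlog x y)))| <= tail_bound y K M)%R.
Proof.
move=> y0 HK M0.
have H (j : 'I_M) := @absF_approx (x + j%:R * (h / M%:R))%R y K M y0 HK M0.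
pose l (j : 'I_M) := fine (absF (x + j%:R * (h / M%:R), y)%R).
have lE (j : 'I_M) : absF (x + j%:R * (h / M%:R), y)%R = (l j)%:E.
  by rewrite /l; have [u -> _] := H j.
exists (M%:R^-1 * \sum_(j < M) l j)%R.
  by under eq_bigr do rewrite lE; rewrite sumEFin -EFinM.
have M0R : (0 < M%:R :> R)%R by rewrite ltr0n.
rewrite -mulrBr -sumrB normrM ger0_norm ?invr_ge0// ler_pdivrMl//.
apply: (le_trans (ler_norm_sum _ _ _)).
rewrite [leRHS](_ : _ = \sum_(j < M) tail_bound y K M)%R; last by rewrite sumr_const card_ord mulr_natl.
apply: ler_sum => j _; rewrite -cexp_qlog_omega.
by have := H j; rewrite lE => -[u [<-]].
Qed.

Lemma measurable_absF_row y : measurable_fun [set: RT] (fun x => absF (x, y)).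
Proof. by apply: (measurableT_comp measurable_absF); exact: measurable_fun_pair. Qed.

Lemma integral_absF_average y M : (0 < M)%N ->
  \int[mu]_(x in `[0%R, h[) absF (x, y) =
  \int[mu]_(x in `[0%R, h[) (M%:R^-1%:E * \sum_(j < M) absF (x + j%:R * (h / M%:R), y)%R).
Proof.
move=> M0.
exact: (integral_average h0 M0 (measurable_absF_row y) (fun x => absF_ge0 _)
  (fun k x => absF_period k x y)).
Qed.

Lemma measurable_absF_average y M : measurable_fun (`[0%R, h[%classic : set RT)
  (fun x => M%:R^-1%:E * \sum_(j < M) absF (x + j%:R * (h / M%:R), y)%R).
Proof.
apply: measurable_funeM.
apply: (@emeasurable_sum _ _ _ _ _ _ (fun (j : 'I_M) (x : RT) => absF (x + j%:R * (h / M%:R), y)%R)).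
move=> j; apply: measurable_funTS.
have := measurableT_comp (measurable_absF_row y) (measurable_affine 1 (j%:R * (h / M%:R))%R).
by apply: eq_measurable_fun => x _ /=; rewrite mul1r.
Qed.

Lemma integral_cst_strip (c : R) :
  \int[mu]_(x in `[0%R, h[) c%:E = (h * c)%:E.
Proof.
by rewrite integral_cst//= lebesgue_measure_itv/= lte_fin h0 -EFinD subr0 -EFinM mulrC.
Qed.

(** The average of |F| over M shifts differs from that of its truncation at M by a tail, and
    [average_Fpartial_limit] applies to the latter; both tails vanish as M grows. *)
Lemma integral_absF_le y : (0 < y)%R ->
  \int[mu]_(x in `[0%R, h[) absF (x, y) <=
  (h * (norm_Re_ratio s * Gamma_average s * (4 * pi * y / h) `^ (1 - sigma)))%:E.
Proof.
move=> y0; have [K HK] := exists_majorant y0.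
set U := (norm_Re_ratio s * _ * _)%R.
have B M : (0 < M)%N -> \int[mu]_(x in `[0%R, h[) absF (x, y) <=
    (h * (U + (coef_bound s + 1) * tail_bound y K M))%:E.
  move=> M0; rewrite (integral_absF_average y M0) -[X in _ <= X]integral_cst_strip.
  apply: ge0_le_integral => //.
  - by move=> x _; rewrite mule_ge0 ?lee_fin ?invr_ge0// sume_ge0// => j _; exact: absF_ge0.
  - exact: measurable_absF_average.
  move=> x _; have [l -> Hl] := absF_average x y0 HK M0; rewrite lee_fin.
  have Rw : (complex.Re (qlog x y) < 0)%R.
    by rewrite /= oppr_lt0 divr_gt0// mulr_gt0// mulr_gt0// pi_gt0.
  have := average_Fpartial_limit s1 M0 Rw.
  have -> : (- 2 * complex.Re (qlog x y) = 4 * pi * y / h)%R by rewrite /=; ring.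
  rewrite -/sigma -/U => H2.
  have := @tail_sum_le y K M (M * 2) y0 HK M0.
  move=> /(ler_wpM2l (coef_bound_ge0 s)) H3.
  move: Hl; rewrite ler_norml => /andP[_ H1].
  move: (M%:R^-1 * _)%R H1 H2 => A H1 H2.
  move: (coef_bound s * \sum_(_ <= _ < _) _)%R H2 H3 => C2 H2 H3.
  by rewrite mulrDl mul1r; lra.
have c : ((h * (U + (coef_bound s + 1) * tail_bound y K M.+1))%:E @[M --> \oo] --> (h * U)%:E).
  apply: cvg_EFin; first exact: nearW.
  rewrite -[X in _ --> X](_ : h * (U + (coef_bound s + 1) * 0) = h * U)%R; last by rewrite mulr0 addr0.
  apply: cvgM; first exact: cvg_cst.
  apply: cvgD; first exact: cvg_cst.
  apply: cvgM; first exact: cvg_cst.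
  by have := cvg_tail_bound K y0; rewrite -(cvg_shiftS (tail_bound y K)).
rewrite -(cvg_lim _ c)//; apply: lime_ge; first by apply: cvgP c.
by apply: nearW => M; exact: B.
Qed.

(** When the tail exceeds the first term the bound at M is trivial; otherwise [average_Fpartial_ge]
    applies, and M tends to infinity. *)
Lemma integral_absF_ge y : (0 < y)%R ->
  (h * expR (- (2 * pi * y / h)))%:E <= \int[mu]_(x in `[0%R, h[) absF (x, y).
Proof.
move=> y0; have [K HK] := exists_majorant y0.
set r := expR _.
have B M : (1 < M)%N -> (h * (r - tail_bound y K M))%:E <= \int[mu]_(x in `[0%R, h[) absF (x, y).
  move=> M1; have M0 : (0 < M)%N by exact: ltnW.
  have [neg|pos] := ltP (r - tail_bound y K M)%R 0%R.
    apply: (@le_trans _ _ 0); last by apply: integral_ge0 => x _; exact: absF_ge0.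
    by rewrite lee_fin pmulr_rle0// ltW.
  rewrite (integral_absF_average y M0) -[X in X <= _]integral_cst_strip; apply: ge0_le_integral => //.
  - exact: measurable_absF_average.
  move=> x _; have [l -> Hl] := absF_average x y0 HK M0; rewrite lee_fin.
  have := average_Fpartial_ge s1 (cexp (qlog x y)) M1; rewrite normc_qexp -/r => H2.
  move: Hl; rewrite ler_norml => /andP[H1 _].
  move: (M%:R^-1 * _)%R H1 H2 => A H1 H2; lra.
have c : ((h * (r - tail_bound y K M.+2))%:E @[M --> \oo] --> (h * r)%:E).
  apply: cvg_EFin; first exact: nearW.
  rewrite -[X in _ --> X](_ : h * (r - 0) = h * r)%R; last by rewrite subr0.
  apply: cvgM; first exact: cvg_cst.
  apply: cvgB; first exact: cvg_cst.
  by have := cvg_tail_bound K y0; rewrite -(cvg_shiftS (tail_bound y K)) -(cvg_shiftS (fun n => tail_bound y K n.+1)).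
rewrite -(cvg_lim _ c)//; apply: lime_le; first by apply: cvgP c.
by apply: nearW => M; exact: B.
Qed.

End QExpansion.

(** * Discrete subgroups of the metaplectic group *)

Lemma ord2P (P : 'I_2 -> Prop) : P 0 -> P 1 -> forall i, P i.
Proof.
move=> P0 P1 i; case: (unliftP 0 i) => [j ->|-> //].
by rewrite (_ : lift 0 j = 1)//; apply: val_inj => /=; case: j => [[|?] ?].
Qed.

Section SL2Entries.
Context {R : realType}.
Implicit Types (g k : SL2 R) (x : R).

Lemma SL2_eqP g k : g 0 0 = k 0 0 -> g 0 1 = k 0 1 -> g 1 0 = k 1 0 -> g 1 1 = k 1 1 ->
  g = k.
Proof. by move=> ? ? ? ?; apply: val_inj; apply/matrixP; do 2 apply: ord2P. Qed.

Definition SL2_adj_mx g : 'M[R]_2 := \matrix_(i, j)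
  (if i == 0 then if j == 0 then g 1 1 else - g 0 1
   else if j == 0 then - g 1 0 else g 0 0).

Lemma SL2_adj_det g : \det (SL2_adj_mx g) == 1.
Proof. by rewrite det_mx22 !mxE /= -(SL2_detE g); apply/eqP; ring. Qed.

Lemma SL2_invE g : [/\ g^-1%g 0 0 = g 1 1, g^-1%g 0 1 = - g 0 1,
  g^-1%g 1 0 = - g 1 0 & g^-1%g 1 1 = g 0 0].
Proof.
suff -> : g^-1%g = MkSL2 (SL2_adj_det g) by rewrite /= !mxE.
apply: mulg1_eq; have := SL2_detE g => D.
by apply: SL2_eqP; rewrite SL2_mulE SL2_1E /= !mxE /= -?D; ring.
Qed.

Lemma upper_unipE x : [/\ upper_unip x 0 0 = 1, upper_unip x 0 1 = x,
  upper_unip x 1 0 = 0 & upper_unip x 1 1 = 1].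
Proof. by rewrite /= !mxE. Qed.

Lemma proj_Mp2_nX x n : Mp2_proj (Mp2_n x ^+ n)%g = upper_unip (n%:R * x).
Proof.
elim: n => [|n IH].
  by rewrite expg0; have [e1 e2 e3 e4] := upper_unipE (0%:R * x); apply: SL2_eqP;
    rewrite SL2_1E ?e1 ?e2 ?e3 ?e4 ?mul0r.
rewrite expgS -[LHS]/(upper_unip x * Mp2_proj (Mp2_n x ^+ n))%g IH.
have [a1 a2 a3 a4] := upper_unipE x; have [b1 b2 b3 b4] := upper_unipE (n%:R * x).
have [c1 c2 c3 c4] := upper_unipE (n.+1%:R * x).
by apply: SL2_eqP; rewrite SL2_mulE ?a1 ?a2 ?a3 ?a4 ?b1 ?b2 ?b3 ?b4 ?c1 ?c2 ?c3 ?c4 -?natr1; ring.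
Qed.

Lemma proj_cyclic x t : cyclic_subgroup (Mp2_n x) t ->
  exists k : int, Mp2_proj t = upper_unip (k%:~R * x).
Proof.
move=> [n [->|->]]; first by exists n; rewrite proj_Mp2_nX.
exists (- n%:Z); rewrite -[LHS]/(Mp2_proj (Mp2_n x ^+ n))^-1%g proj_Mp2_nX mulrNz mulNr.
have [a1 a2 a3 a4] := upper_unipE (n%:R * x); have [c1 c2 c3 c4] := upper_unipE (- (n%:R * x)).
by have [b1 b2 b3 b4] := SL2_invE (upper_unip (n%:R * x)); apply: SL2_eqP;
  rewrite ?b1 ?b2 ?b3 ?b4 ?a1 ?a2 ?a3 ?a4 ?c1 ?c2 ?c3 ?c4 ?oppr0.
Qed.

Lemma cyclic_proj x (k : int) : exists2 t, cyclic_subgroup (Mp2_n x) t &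
  Mp2_proj t = upper_unip (k%:~R * x).
Proof.
case: k => n; first by exists (Mp2_n x ^+ n)%g; [exists n; left|rewrite proj_Mp2_nX].
exists (Mp2_n x ^- n.+1)%g; first by exists n.+1; right.
rewrite -[LHS]/(Mp2_proj (Mp2_n x ^+ n.+1))^-1%g proj_Mp2_nX NegzE mulrNz mulNr.
have [a1 a2 a3 a4] := upper_unipE (n.+1%:R * x); have [c1 c2 c3 c4] := upper_unipE (- (n.+1%:R * x)).
by have [b1 b2 b3 b4] := SL2_invE (upper_unip (n.+1%:R * x)); apply: SL2_eqP;
  rewrite ?b1 ?b2 ?b3 ?b4 ?a1 ?a2 ?a3 ?a4 ?c1 ?c2 ?c3 ?c4 ?oppr0.
Qed.

(** The sign [e] is 1 or -1: the hypothesis on h determines the stabilizer only up to the center. *)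
Definition translates g a := exists2 e : R, e ^+ 2 = 1 &
  [/\ g 0 0 = e, g 0 1 = e * a, g 1 0 = 0 & g 1 1 = e].

Lemma actR_translates g a (x y : R) : translates g a -> actR g (x, y) = (x + a, y).
Proof.
move=> [e e1 [g1 g2 g3 g4]]; rewrite /actR /= g1 g2 g3 g4.
rewrite !mul0r expr0n /= addr0 mulr0 mul0r addr0 add0r e1 !divr1.
by rewrite -mulrDr mulrC mulrA -expr2 e1 mul1r.
Qed.

End SL2Entries.

Section Subgroup.
Context {R : realType}.
Variable G : set (Mp2 R).
Hypothesis hG : is_subgroup G.
Implicit Types s t : Mp2 R.

Lemma subgroup1 : G 1%g. Proof. by case: hG. Qed.

Lemma subgroupV s : G s -> G s^-1%g.
Proof. by move=> Gs; have := hG.2 _ _ subgroup1 Gs; rewrite mul1g. Qed.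

Lemma subgroupM s t : G s -> G t -> G (s * t)%g.
Proof. by move=> Gs /subgroupV Gt; have := hG.2 _ _ Gs Gt; rewrite invgK. Qed.

Lemma stab_inftyE s : stab_infty G s <-> G s /\ Mp2_proj s 1 0 = 0.
Proof.
rewrite /stab_infty /setI /=; split=> -[Gs]; last by move=> ->; rewrite eqxx.
by case: eqP.
Qed.

Variable h : R.
Hypothesis hwidth : set_mulg Mp2_center (stab_infty G) =
  set_mulg Mp2_center (cyclic_subgroup (Mp2_n h)).

Lemma center_scalar s : Mp2_center s -> exists2 e : R, e ^+ 2 = 1 &
  [/\ Mp2_proj s 0 0 = e, Mp2_proj s 0 1 = 0, Mp2_proj s 1 0 = 0 & Mp2_proj s 1 1 = e].
Proof.
by move=> [E|E]; [exists 1|exists (-1)]; rewrite ?sqrrN ?expr1n ?E ?mxE ?oppr0.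
Qed.

Lemma center1 : Mp2_center (1%g : Mp2 R).
Proof. by left. Qed.

Lemma stab_translates s : stab_infty G s -> exists k : int, translates (Mp2_proj s) (k%:~R * h).
Proof.
move=> Gs; have : set_mulg Mp2_center (stab_infty G) s.
  by exists 1%g; [exact: center1|exists s => //; rewrite mul1g].
rewrite hwidth => -[z /center_scalar[e e1 [z1 z2 z3 z4]] [t /proj_cyclic[k tk] <-]].
exists k, e => //; have [a1 a2 a3 a4] := upper_unipE (k%:~R * h).
rewrite -[Mp2_proj _]/(Mp2_proj z * Mp2_proj t)%g tk !SL2_mulE z1 z2 z3 z4 a1 a2 a3 a4.
by rewrite !mulr1 !mulr0 !mul0r !addr0 add0r.
Qed.

Lemma translates_stab (k : int) : exists2 s, stab_infty G s & translates (Mp2_proj s) (k%:~R * h).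
Proof.
have [t ct tk] := cyclic_proj h k.
have : set_mulg Mp2_center (cyclic_subgroup (Mp2_n h)) t.
  by exists 1%g; [exact: center1|exists t => //; rewrite mul1g].
rewrite -hwidth => -[z /center_scalar[e e1 [z1 z2 z3 z4]] [s Gs zs]].
exists s => //; exists e => //.
have [a1 a2 a3 a4] := upper_unipE (k%:~R * h).
have E i j : e * Mp2_proj s i j = Mp2_proj t i j.
  rewrite -zs -[Mp2_proj (z * s)%g]/(Mp2_proj z * Mp2_proj s)%g SL2_mulE.
  move: i; apply: ord2P; rewrite ?z1 ?z2 ?z3 ?z4 mul0r ?addr0 ?add0r//.
have E' i j : Mp2_proj s i j = e * Mp2_proj t i j.
  by rewrite -E mulrA -expr2 e1 mul1r.
by rewrite !E' tk a1 a2 a3 a4 !mulr1 mulr0.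
Qed.

End Subgroup.

Section Discrete.
Context {R : realType}.
Variable G : set (Mp2 R).
Hypotheses (hG : is_subgroup G) (hdisc : discrete_set G).
Implicit Types s t : Mp2 R.

Lemma nbhs_real_ball (x : R) (P : set R) : nbhs x P ->
  exists2 e, 0 < e & forall y, `|y - x| < e -> P y.
Proof.
move=> /nbhs_ballP[e e0 H]; exists e => // y yx; apply: H.
by rewrite -ball_normE /= distrC.
Qed.

Lemma nbhs_complex_ball (x : R[i]) (P : set R[i]) : nbhs (x : R[i]^o) P ->
  exists2 e, 0 < e & forall y, normc (y - x) < e -> P y.
Proof.
move=> /nbhs_ballP[[e e'] /= e0 H]; move: e0; rewrite ltcE /= => /andP[/eqP e'0 e0].
exists e => // y yx; apply: H; rewrite -ball_normE /= normc_norm ltcE /= e'0 eqxx /=.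
by rewrite normc_sub.
Qed.

Lemma discrete_near1 : exists2 e : R, 0 < e & forall t, G t ->
  (forall i j, `|Mp2_proj t i j - (1%g : SL2 R) i j| < e) ->
  normc (Mp2_eta t uhp_i - 1) < e -> t = 1%g.
Proof.
have [_ [V /= nV VG]] := hdisc (subgroup1 hG).
move: nV; rewrite nbhsE => -[B nB BV]; case: nB => oB B1; case: oB => W oW WB.
have nW : nbhs (Mp2_emb (1%g : Mp2 R)) W by apply: open_nbhs_nbhs; split => //; move: B1; rewrite -WB.
case: nW => [[W1 W2]] /= [nW1 nW2] W12; case: nW1 => P nP PW1.
have ex i j : exists e, 0 < e /\ forall y, `|y - (1%g : SL2 R) i j| < e -> P i j y.
  by have [e e0 H] := nbhs_real_ball (nP i j); exists e.
have [f fP] := choice (fun ij : 'I_2 * 'I_2 => ex ij.1 ij.2).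
have [e5 e50 H5] := nbhs_complex_ball nW2.
pose e := Num.min e5 (Num.min (Num.min (f (0, 0)) (f (0, 1))) (Num.min (f (1, 0)) (f (1, 1)))).
have ef i j : e <= f (i, j).
  by move: i j; do 2 apply: ord2P; rewrite /e !ge_min lexx ?orbT.
exists e => [|t Gt pt et].
  by rewrite /e !lt_min e50 (fP (0, 0)).1 (fP (0, 1)).1 (fP (1, 0)).1 (fP (1, 1)).1.
suff : (V `&` G) t by rewrite VG.
split => //; apply: BV; rewrite -WB; apply: (W12 (_, _)); split => /=.
  apply: PW1 => i j; apply: (fP (i, j)).2; exact: lt_le_trans (pt i j) (ef i j).
by apply: H5; apply: lt_le_trans et _; rewrite /e ge_min lexx.
Qed.

Lemma cvg_complex_normc (T : Type) (F : set_system T) (FF : Filter F) (f : T -> R[i]) (l : R[i]) :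
  normc (f t - l) @[t --> F] --> (0 : R) -> (f : T -> R[i]^o) @ F --> (l : R[i]^o).
Proof.
move=> /cvgrPdist_lt c; apply/cvgrPdist_lt => -[e e'].
rewrite ltcE /= => /andP[/eqP e'0 e0]; apply: filterS (c _ e0) => t.
by rewrite sub0r normrN ger0_norm ?normc_ge0// normc_norm ltcE /= e'0 eqxx /= normc_sub.
Qed.

Lemma cvg_normc_sub (T : Type) (F : set_system T) (FF : Filter F) (f : T -> R[i]) (l a : R[i]) :
  (f : T -> R[i]^o) @ F --> (l : R[i]^o) -> normc (f t - a) @[t --> F] --> normc (l - a).
Proof.
move=> /cvgrPdist_lt cf; apply/cvgrPdist_lt => e e0.
have e1 : 0 < e%:C by rewrite ltcR.
apply: filterS (cf _ e1) => t /=; rewrite normc_norm ltcR => H.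
by apply: le_lt_trans (normc_distl _ _) _; rewrite opprB addrA subrK.
Qed.

Lemma cvg_eta t (f : nat -> uhp R) : (fun n => f n : R[i]^o) @ \oo --> (uhp_i : R[i]^o) ->
  (fun n => Mp2_eta t (f n) : R[i]^o) @ \oo --> (Mp2_eta t uhp_i : R[i]^o).
Proof.
move=> cf.
have c : {for (uhp_i : R[i]^o), continuous (uhp_ext (Mp2_eta t) : R[i]^o -> R[i]^o)}.
  by apply: differentiable_continuous; apply/derivable1_diffP; exact: (Mp2_holo (m := t)).
have := cvg_comp _ _ cf c; rewrite uhp_extE; apply: cvg_trans; apply: near_eq_cvg.
by apply: nearW => n /=; rewrite uhp_extE.
Qed.

Lemma act_i_cvg (g : nat -> SL2 R) :
  (forall i j, g k i j @[k --> \oo] --> (1%g : SL2 R) i j) ->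
  (fun k => (act (g k) uhp_i : R[i]) : R[i]^o) @ \oo --> (uhp_i : R[i]^o).
Proof.
move=> H.
have H00 := H 0 0; have H01 := H 0 1; have H10 := H 1 0; have H11 := H 1 1.
rewrite !SL2_1E /= in H00 H01 H10 H11.
have E k := actRE (g k) 0 (uhp_valP (@uhp_i R)).
have D : (g k 1 1 ^+ 2 + g k 1 0 ^+ 2) @[k --> \oo] --> (1 : R).
  rewrite -[X in _ --> X](_ : 1 * 1 + 0 * 0 = 1); last by rewrite mulr0 addr0 mul1r.
  by under eq_fun do rewrite !expr2; apply: cvgD; apply: cvgM.
have DV : (g k 1 1 ^+ 2 + g k 1 0 ^+ 2)^-1 @[k --> \oo] --> (1 : R).
  by rewrite -[X in _ --> X]invr1; apply: cvgV => //; exact: oner_neq0.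
apply: cvg_complex => /=.
- have -> : (@complex.Re R) \o (fun k => act (g k) uhp_i : R[i]) =
     (fun k => (g k 0 1 * g k 1 1 + g k 0 0 * g k 1 0) * (g k 1 1 ^+ 2 + g k 1 0 ^+ 2)^-1).
    apply/funext => k; have := E k; rewrite /actR /= => -[+ _].
    by rewrite !mulr0 !add0r !mulr1 expr1n mulr1 => ->.
  rewrite -[X in _ --> X](_ : (0 * 1 + 1 * 0) * 1 = 0); last by ring.
  by apply: cvgM => //; apply: cvgD; apply: cvgM.
- have -> : (@complex.Im R) \o (fun k => act (g k) uhp_i : R[i]) =
     (fun k => (g k 1 1 ^+ 2 + g k 1 0 ^+ 2)^-1).
    apply/funext => k; have := E k; rewrite /actR /= => -[_].
    by rewrite !mulr0 !add0r !mulr1 div1r => ->.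
  exact: DV.
Qed.

(* The [eta] of an element near the kernel of [P] is near 1 or -1 at [i]; in
   the second case a product of two such elements is near the identity. *)
Lemma discrete_no_cvg (g : nat -> Mp2 R) : (forall k, G (g k)) ->
  (forall k, Mp2_proj (g k) 1 0 != 0) ->
  (forall i j, Mp2_proj (g k) i j @[k --> \oo] --> (1%g : SL2 R) i j) -> False.
Proof.
move=> Gg c0 cg; have [e e0 He] := discrete_near1.
pose et k := Mp2_eta (g k) uhp_i.
have near_of (x : nat -> 'I_2 -> 'I_2 -> R) (l : 'I_2 -> 'I_2 -> R) :
    (forall i j, x k i j @[k --> \oo] --> l i j) ->
    (forall i j, `|l i j - (1%g : SL2 R) i j| < e) ->
    \forall k \near \oo, forall i j, `|x k i j - (1%g : SL2 R) i j| < e.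
  move=> cx le.
  have N i j : \forall k \near \oo, `|x k i j - (1%g : SL2 R) i j| < e.
    apply: (cvgr_lt `|l i j - (1%g : SL2 R) i j|) => //.
    by apply: cvg_norm; apply: cvgB => //; exact: cvg_cst.
  near=> k; do 2 (apply: ord2P); near: k; exact: N.
have n1 : \forall k \near \oo, forall i j, `|Mp2_proj (g k) i j - (1%g : SL2 R) i j| < e.
  by apply: near_of cg _ => i j; rewrite subrr normr0.
have not1 : \forall k \near \oo, e <= normc (et k - 1).
  apply: filterS n1 => k Hk; rewrite leNgt; apply/negP => Hl.
  by have := He _ (Gg k) Hk Hl => E; have := c0 k; rewrite E SL2_1E eqxx.
have c10 := cg 1 0; have c11 := cg 1 1; rewrite !SL2_1E /= in c10 c11.
have sq0 : (`|Mp2_proj (g k) 1 0| + `|Mp2_proj (g k) 1 1 - 1|) / e @[k --> \oo] --> (0 : R).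
  rewrite -[X in _ --> X](_ : (`|0 : R| + `|1 - 1 : R|) / e = 0); last by rewrite subrr normr0 addr0 mul0r.
  apply: cvgM; last exact: cvg_cst.
  by apply: cvgD; apply: cvg_norm => //; apply: cvgB => //; exact: cvg_cst.
(* The product of eta - 1 and eta + 1 is c i + d - 1, which tends to 0, while eta - 1 stays at
   distance at least e from 0. *)
have cet0 : normc (et k - (-1)) @[k --> \oo] --> (0 : R).
  apply: (squeeze_cvgr _ (cvg_cst 0) sq0); apply: filterS not1 => k ek.
  rewrite normc_ge0 /= ler_pdivlMr// opprK.
  apply: (@le_trans _ _ (normc (et k + 1) * normc (et k - 1))); first by rewrite ler_wpM2l ?normc_ge0.
  rewrite -normcM mulrC -subr_sqr expr1n Mp2_sqr /mobius_den.
  by apply: le_trans (normc_le_ReIm _) _; rewrite /= !mul0r !mulr0 !mulr1 subr0 !addr0 add0r oppr0 addr0 addrC.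
have cet : (et : nat -> R[i]^o) @ \oo --> (-1 : R[i]^o) by apply: cvg_complex_normc.
(* Here k is fixed and only l tends to infinity: eta of the product at i tends to - [et k], close to
   1, and its lower left entry tends to that of [g k], which is not 0. *)
have [k [k1 k2]] : exists k, (forall i j, `|Mp2_proj (g k) i j - (1%g : SL2 R) i j| < e) /\ normc (et k - (-1)) < e.
  have n2 : \forall k \near \oo, normc (et k - (-1)) < e by exact: cvgr_lt cet0 _ e0.
  by near \oo => k; exists k; split; near: k.
have cp i j : Mp2_proj (g k * g l)%g i j @[l --> \oo] --> Mp2_proj (g k) i j.
  rewrite -[X in _ --> X](_ : Mp2_proj (g k) i 0 * (1%g : SL2 R) 0 j + Mp2_proj (g k) i 1 * (1%g : SL2 R) 1 j = _); last first.
    by move: j; apply: ord2P; rewrite !SL2_1E /= mulr1 mulr0 ?addr0 ?add0r.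
  under eq_fun do rewrite -[Mp2_proj _]/(Mp2_proj (g k) * Mp2_proj (g _))%g SL2_mulE.
  by apply: cvgD; apply: cvgM => //; exact: cvg_cst.
have ceta : (fun l => Mp2_eta (g k * g l)%g uhp_i : R[i]^o) @ \oo --> (- et k : R[i]^o).
  have cA : (fun l => Mp2_eta (g k) (act (Mp2_proj (g l)) uhp_i) : R[i]^o) @ \oo --> (et k : R[i]^o).
    by apply: cvg_eta; exact: act_i_cvg.
  have cA0 : normc (Mp2_eta (g k) (act (Mp2_proj (g l)) uhp_i) - et k) @[l --> \oo] --> (0 : R).
    by rewrite -(normc0 R) -(subrr (et k)); exact: cvg_normc_sub.
  have cE : normc (et l) @[l --> \oo] --> normc (-1 : R[i]) by exact: (@cvg_normc _ _ _ _ et (-1) cet).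
  have cS : normc (Mp2_eta (g k) (act (Mp2_proj (g l)) uhp_i) - et k) * normc (et l) +
      normc (et k) * normc (et l - (-1)) @[l --> \oo] --> (0 : R).
    rewrite -[X in _ --> X](_ : 0 * normc (-1 : R[i]) + normc (et k) * 0 = 0); last by rewrite mul0r mulr0 addr0.
    by apply: cvgD; apply: cvgM => //; exact: cvg_cst.
  apply: cvg_complex_normc; apply: (squeeze_cvgr _ (cvg_cst 0) cS); apply: nearW => l.
  rewrite normc_ge0 /= -!normcM -/(et l).
  rewrite [X in normc X <= _](_ : _ = (Mp2_eta (g k) (act (Mp2_proj (g l)) uhp_i) - et k) * et l + et k * (et l - (-1))).
    exact: normc_triangle.
  by rewrite !opprK mulrBl mulrDr mulr1 addrA subrK.
have cn : normc (Mp2_eta (g k * g l)%g uhp_i - 1) @[l --> \oo] --> normc (et k - (-1)).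
  have -> : normc (et k - (-1)) = normc (- et k - 1) by rewrite -[RHS]normc_opp opprB !opprK addrC.
  exact: cvg_normc_sub.
have [l [l1 [l2 l3]]] : exists l, (forall i j, `|Mp2_proj (g k * g l)%g i j - (1%g : SL2 R) i j| < e) /\
   (normc (Mp2_eta (g k * g l)%g uhp_i - 1) < e /\ Mp2_proj (g k * g l)%g 1 0 != 0).
  have m1 := near_of _ _ cp k1.
  have m2 : \forall l \near \oo, normc (Mp2_eta (g k * g l)%g uhp_i - 1) < e by exact: cvgr_lt cn _ k2.
  have m3 : \forall l \near \oo, Mp2_proj (g k * g l)%g 1 0 != 0 by exact: cvgr_neq0 (cp 1 0) (c0 k).
  by near \oo => l; exists l; split; [|split]; near: l.
move: l3; rewrite (He _ _ l1 l2); first by rewrite SL2_1E eqxx.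
exact: subgroupM.
Unshelve. all: by end_near. Qed.

End Discrete.

(** * Shimizu's lemma *)

Section Shimizu.
Context {R : realType}.
Variable G : set (Mp2 R).
Hypotheses (hG : is_subgroup G) (hdisc : discrete_set G).
Variable h : R.
Hypothesis h0 : 0 < h.
Hypothesis hwidth : set_mulg Mp2_center (stab_infty G) =
  set_mulg Mp2_center (cyclic_subgroup (Mp2_n h)).
Implicit Types s t : Mp2 R.

Fixpoint conj_iter s t k :=
  if k is k'.+1 then (conj_iter s t k' * t * (conj_iter s t k')^-1)%g else s.

Lemma conj_entries (g t : SL2 R) (e a c : R) : e ^+ 2 = 1 ->
  [/\ t 0 0 = e, t 0 1 = e * h, t 1 0 = 0 & t 1 1 = e] -> g 0 0 = a -> g 1 0 = c ->
  [/\ (g * t * g^-1)%g 0 0 = e * (1 - a * c * h), (g * t * g^-1)%g 0 1 = e * (a ^+ 2 * h),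
      (g * t * g^-1)%g 1 0 = - (e * (c ^+ 2 * h)) & (g * t * g^-1)%g 1 1 = e * (1 + a * c * h)].
Proof.
move=> e1 [t1 t2 t3 t4] <- <-; have D := SL2_detE g; have [g1 g2 g3 g4] := SL2_invE g.
rewrite !SL2_mulE g1 g2 g3 g4 t1 t2 t3 t4; rewrite -[in X in _ * (X - _)]D -[in X in _ * (X + _)]D.
by split; ring.
Qed.

(** Along the iteration the matrices of the conjugates tend to that of t; the factor t^-1 moves the
    limit to 1 and cancels the sign [e]. *)
Lemma commutator_entries (g t : SL2 R) (e a c : R) : e ^+ 2 = 1 ->
  [/\ t 0 0 = e, t 0 1 = e * h, t 1 0 = 0 & t 1 1 = e] -> g 0 0 = a -> g 1 0 = c ->
  let x := (g * t * g^-1 * t^-1)%g in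
  [/\ x 0 0 = 1 - a * c * h, x 0 1 = h * (a ^+ 2 - 1 + a * c * h),
      x 1 0 = - (c ^+ 2 * h) & x 1 1 = 1 + a * c * h + (c * h) ^+ 2].
Proof.
move=> e1 te ga gc x; have [y1 y2 y3 y4] := conj_entries e1 te ga gc.
case: te => t1 t2 t3 t4; have [g1 g2 g3 g4] := SL2_invE t.
rewrite /x !(SL2_mulE (g * t * g^-1)%g) y1 y2 y3 y4 g1 g2 g3 g4 t1 t2 t3 t4.
split.
- by rewrite -[RHS]mul1r -e1; ring.
- by rewrite -[RHS]mul1r -e1; ring.
- by rewrite -[RHS]mul1r -e1; ring.
- by rewrite -[RHS]mul1r -e1; ring.
Qed.

(** Each conjugation squares |c| h, which therefore tends to 0 when it starts below 1, without ever
    becoming 0. The commutators have nonzero lower left entry and matrices tending to 1, against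
    [discrete_no_cvg]. *)
Lemma shimizu s : G s -> Mp2_proj s 1 0 != 0 -> 1 <= `|Mp2_proj s 1 0| * h.
Proof.
move=> Gs cs; rewrite leNgt; apply/negP => small.
have [t /stab_inftyE[Gt _] [e e1 te]] := translates_stab hwidth 1.
rewrite mul1r in te.
pose S k := conj_iter s t k.
have GS k : G (S k).
  elim: k => //= k IH; apply: (subgroupM hG); last exact: (subgroupV hG).
  exact: (subgroupM hG).
pose a k := Mp2_proj (S k) 0 0; pose c k := Mp2_proj (S k) 1 0.
have rec k : a k.+1 = e * (1 - a k * c k * h) /\ c k.+1 = - (e * (c k ^+ 2 * h)).
  by have [x1 _ x3 _] := conj_entries e1 te (erefl (a k)) (erefl (c k)).
have ne : `|e| = 1 by apply/eqP; rewrite -sqrp_eq1// real_normK ?num_real// e1.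
have e0 : e != 0 by rewrite -normr_eq0 ne oner_neq0.
pose rho := `|Mp2_proj s 1 0| * h.
have rho0 : 0 <= rho by rewrite mulr_ge0// ltW.
have cb k : `|c k * h| <= rho ^+ k * rho /\ c k != 0.
  elim: k => [|k [IH ck]]; first by rewrite expr0 mul1r normrM (gtr0_norm h0).
  rewrite (rec k).2; split; last first.
    rewrite oppr_eq0 mulf_neq0// mulf_neq0 ?expf_neq0//; by rewrite gt_eqF.
  have -> : `|- (e * (c k ^+ 2 * h)) * h| = `|c k * h| * `|c k * h|.
    rewrite mulNr normrN !normrM ne; ring.
  rewrite exprS -mulrA ler_pM//.
  by apply: (le_trans IH); rewrite ler_piMl// exprn_ile1// ltW.
(* Chosen so that 1 + B rho <= B, which passes the bound from [a k] to [a k.+1]. *)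
pose B := `|a 0%N| + (1 - rho)^-1.
have d0 : 0 < 1 - rho by rewrite subr_gt0.
have B0 : 0 <= B by rewrite addr_ge0// invr_ge0 ltW.
have ab k : `|a k| <= B.
  elim: k => [|k IH]; first by rewrite lerDl invr_ge0 ltW.
  rewrite (rec k).1 normrM ne mul1r; apply: (le_trans (ler_normB _ _)).
  rewrite normr1 -mulrA normrM.
  have ck : `|c k * h| <= rho.
    by apply: (le_trans (cb k).1); rewrite ler_piMl// exprn_ile1// ltW.
  apply: (@le_trans _ _ (1 + B * rho)); first by rewrite lerD2l ler_pM.
  have : 1 <= B * (1 - rho).
    by rewrite mulrDl mulVf ?gt_eqF// lerDr mulr_ge0// ltW.
  by rewrite mulrBr mulr1; lra.
have crho : rho ^+ k * rho @[k --> \oo] --> (0 : R).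
  rewrite -[X in _ --> X](mul0r rho); apply: cvgM; last exact: cvg_cst.
  by apply: cvg_expr; rewrite ger0_norm.
have cch : c k * h @[k --> \oo] --> (0 : R).
  apply: norm_cvg0; apply: (squeeze_cvgr _ (cvg_cst 0) crho).
  by apply: nearW => k; rewrite normr_ge0 (cb k).1.
have cu : a k * c k * h @[k --> \oo] --> (0 : R).
  have cB : B * (rho ^+ k * rho) @[k --> \oo] --> (0 : R).
    by rewrite -[X in _ --> X](mulr0 B); apply: cvgM => //; exact: cvg_cst.
  apply: norm_cvg0; apply: (squeeze_cvgr _ (cvg_cst 0) cB).
  by apply: nearW => k; rewrite normr_ge0 -mulrA normrM ler_pM// (cb k).1.
have ca : a k.+1 ^+ 2 @[k --> \oo] --> (1 : R).
  have -> : (fun k => a k.+1 ^+ 2) = (fun k => (1 - a k * c k * h) * (1 - a k * c k * h)).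
    by apply/funext => k; rewrite (rec k).1 exprMn e1 mul1r expr2.
  rewrite -[X in _ --> X](_ : (1 - 0) * (1 - 0) = 1); last by rewrite subr0 mul1r.
  by apply: cvgM; apply: cvgB => //; exact: cvg_cst.
pose g k := (S k.+1 * t * (S k.+1)^-1 * t^-1)%g.
have gE k := commutator_entries e1 te (erefl (a k.+1)) (erefl (c k.+1)).
have cu1 : a k.+1 * c k.+1 * h @[k --> \oo] --> (0 : R).
  by move: cu; rewrite -(cvg_shiftS (fun k => a k * c k * h)).
have cch1 : c k.+1 * h @[k --> \oo] --> (0 : R).
  by move: cch; rewrite -(cvg_shiftS (fun k => c k * h)).
apply: (@discrete_no_cvg _ G hG hdisc g).
- move=> k; apply: (subgroupM hG); last exact: (subgroupV hG).
  exact: (GS k.+2).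
- by move=> k; have [_ _ + _] := gE k => /= ->; rewrite oppr_eq0 mulf_neq0 ?expf_neq0 ?(cb _).2// gt_eqF.
do 2 apply: ord2P; rewrite SL2_1E /=.
- rewrite (_ : (fun k => _) = (fun k => 1 - a k.+1 * c k.+1 * h)); last by apply/funext => k; have [-> _ _ _] := gE k.
  by rewrite -[X in _ --> X](subr0 (1 : R)); apply: cvgB => //; exact: cvg_cst.
- rewrite (_ : (fun k => _) = (fun k => h * (a k.+1 ^+ 2 - 1 + a k.+1 * c k.+1 * h))); last by apply/funext => k; have [_ -> _ _] := gE k.
  rewrite -[X in _ --> X](_ : h * (1 - 1 + 0) = 0); last by rewrite subrr addr0 mulr0.
  apply: cvgM; first exact: cvg_cst.
  by apply: cvgD => //; apply: cvgB => //; exact: cvg_cst.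
- rewrite (_ : (fun k => _) = (fun k => - ((c k.+1 * h) * (c k.+1 * h) * h^-1))); last first.
    apply/funext => k; have [_ _ -> _] := gE k.
    by field; rewrite gt_eqF.
  rewrite -[X in _ --> X](_ : - (0 * 0 * h^-1) = 0); last by rewrite !mul0r oppr0.
  by apply: cvgN; apply: cvgM; [exact: cvgM|exact: cvg_cst].
- rewrite (_ : (fun k => _) = (fun k => 1 + a k.+1 * c k.+1 * h + (c k.+1 * h) * (c k.+1 * h))); last first.
    by apply/funext => k; have [_ _ _ ->] := gE k; rewrite expr2.
  rewrite -[X in _ --> X](_ : 1 + 0 + 0 * 0 = 1); last by rewrite mul0r !addr0.
  by apply: cvgD; [apply: cvgD => //; exact: cvg_cst|exact: cvgM].
Qed.

End Shimizu.

Section ActR.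
Context {R : realType}.
Implicit Types (g k : SL2 R) (x y : R).

Lemma actRM g k x y : 0 < y -> actR (g * k)%g (x, y) = actR g (actR k (x, y)).
Proof.
move=> y0; rewrite (actRE k x y0) (actRE (g * k)%g x y0); set w := act k _.
rewrite (actRE _ _ (uhp_valP w)) actM -/w.
suff -> : Uhp (uhp_valP w) = w :> uhp R => //.
Qed.

Lemma actRVK g x y : 0 < y -> actR g (actR g^-1%g (x, y)) = (x, y).
Proof. by move=> y0; rewrite -{1}[g]invgK actRK. Qed.

(** The image has height at most 1 / (c^2 y), and c^2 y > N. *)
Lemma actR_snd_lt g (N x y : R) : 0 < N -> N <= `|g 1 0| -> N^-1 < y ->
  (actR g (x, y)).2 < N^-1.
Proof.
move=> N0 cN yN; have y0 : 0 < y by rewrite (lt_trans _ yN)// invr_gt0.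
have c0 : 0 < `|g 1 0| by exact: lt_le_trans cN.
have g0 : g 1 0 != 0 by rewrite -normr_gt0.
have cy : 0 < (g 1 0 * y) ^+ 2 by rewrite exprn_even_gt0//= mulf_neq0// gt_eqF.
rewrite /actR /= ltr_pdivrMr; last by rewrite ltr_wpDl ?sqr_ge0.
apply: (@lt_le_trans _ _ (N^-1 * (g 1 0 * y) ^+ 2)); last first.
  by rewrite ler_wpM2l ?invr_ge0 ?(ltW N0)// lerDr sqr_ge0.
have c2 : N ^+ 2 <= g 1 0 ^+ 2 by rewrite -[leRHS]real_normK ?num_real// ler_pXn2r ?nnegrE// ltW.
rewrite exprMn mulrA; apply: (@lt_le_trans _ _ (N^-1 * N ^+ 2 * y ^+ 2)); last first.
  by rewrite ler_wpM2r ?sqr_ge0// ler_wpM2l// invr_ge0 ltW.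
have -> : N^-1 * N ^+ 2 = N by rewrite expr2 mulrA mulVf ?mul1r// gt_eqF.
rewrite expr2 mulrA ltr_pMl//.
by rewrite -(mulfV (lt0r_neq0 N0)) ltr_pM2l.
Qed.

Lemma continuous_actR g (x y : R) : 0 < y ->
  ((fun p : R * R => (actR g p).1 : R) @ (x, y) --> ((actR g (x, y)).1 : R)) /\
  ((fun p : R * R => (actR g p).2 : R) @ (x, y) --> ((actR g (x, y)).2 : R)).
Proof.
move=> y0.
have c1 : (fun p : R * R => p.1) @ (x, y) --> x by exact: cvg_fst.
have c2 : (fun p : R * R => p.2) @ (x, y) --> y by exact: cvg_snd.
have cl (u v : R) : (fun p : R * R => u * p.1 + v) @ (x, y) --> u * x + v.
  by apply: cvgD; [apply: cvgM => //; exact: cvg_cst|exact: cvg_cst].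
have cy (u : R) : (fun p : R * R => u * p.2) @ (x, y) --> u * y.
  by apply: cvgM => //; exact: cvg_cst.
have cD : (fun p : R * R => (g 1 0 * p.1 + g 1 1) ^+ 2 + (g 1 0 * p.2) ^+ 2) @ (x, y) -->
    (g 1 0 * x + g 1 1) ^+ 2 + (g 1 0 * y) ^+ 2.
  under eq_fun do rewrite !expr2; rewrite !expr2.
  by apply: cvgD; apply: cvgM; [exact: cl|exact: cl|exact: cy|exact: cy].
have D0 : (g 1 0 * x + g 1 1) ^+ 2 + (g 1 0 * y) ^+ 2 != 0.
  by have := actR_gt0 g x y0; rewrite /actR /=; apply: contraTneq => ->; rewrite invr0 mulr0 ltxx.
have cV : (fun p : R * R => ((g 1 0 * p.1 + g 1 1) ^+ 2 + (g 1 0 * p.2) ^+ 2)^-1) @ (x, y) -->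
    ((g 1 0 * x + g 1 1) ^+ 2 + (g 1 0 * y) ^+ 2)^-1 by apply: cvgV.
split; rewrite /actR /=; last exact: cvgM.
apply: cvgM => //; apply: cvgD; first by apply: cvgM; exact: cl.
under eq_fun do rewrite expr2; rewrite expr2.
by apply: cvgM; [exact: cvg_cst|exact: cvgM].
Qed.

Lemma rational_near (x y : R) (P : set (R * R)) : nbhs (x, y) P ->
  exists q : rat * rat, P (ratr q.1, ratr q.2).
Proof.
move=> [[P1 P2] /= [n1 n2] H].
have [e1 e10 H1] := nbhs_real_ball n1; have [e2 e20 H2] := nbhs_real_ball n2.
have /rat_in_itvoo[q1 Hq1] : x - e1 < x + e1 by lra.
have /rat_in_itvoo[q2 Hq2] : y - e2 < y + e2 by lra.
exists (q1, q2); apply: (H (_, _)); split => /=; [apply: H1|apply: H2].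
  by move: Hq1; rewrite in_itv/= => /andP[a b]; rewrite ltr_norml; apply/andP; split; lra.
by move: Hq2; rewrite in_itv/= => /andP[a b]; rewrite ltr_norml; apply/andP; split; lra.
Qed.

End ActR.

(** * Cosets of the stabilizer and images of the strip *)

Section Cosets.
Context {R : realType}.
Variable G : set (Mp2 R).
Hypotheses (hG : is_subgroup G) (hdisc : discrete_set G).
Variable h : R.
Hypothesis h0 : 0 < h.
Hypothesis hwidth : set_mulg Mp2_center (stab_infty G) =
  set_mulg Mp2_center (cyclic_subgroup (Mp2_n h)).
Let N := min_lower_entry G.
Implicit Types s t : Mp2 R.

Lemma stabM s t : stab_infty G s -> stab_infty G t -> stab_infty G (s * t)%g.
Proof.
move=> /stab_inftyE[Gs cs] /stab_inftyE[Gt ct]; apply/stab_inftyE; split; first exact: (subgroupM hG).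
by rewrite -[Mp2_proj _]/(Mp2_proj s * Mp2_proj t)%g SL2_mulE cs ct mul0r mulr0 addr0.
Qed.

Lemma stabV s : stab_infty G s -> stab_infty G s^-1%g.
Proof.
move=> /stab_inftyE[Gs cs]; apply/stab_inftyE; split; first exact: (subgroupV hG).
by have [_ _ + _] := SL2_invE (Mp2_proj s); rewrite -[Mp2_proj s^-1%g]/(Mp2_proj s)^-1%g => ->; rewrite cs oppr0.
Qed.

Lemma stab1 : stab_infty G (1%g : Mp2 R).
Proof. by apply/stab_inftyE; split; [exact: (subgroup1 hG)|rewrite SL2_1E]. Qed.

Lemma lower_entry_in s : G s -> Mp2_proj s 1 0 != 0 ->
  [set `|SL2_val g 1 0| | g in Mp2_proj @` (G `\` stab_infty G)] `|Mp2_proj s 1 0|.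
Proof.
move=> Gs cs; exists (Mp2_proj s) => //; exists s => //; split => // /stab_inftyE[_ c].
by rewrite c eqxx in cs.
Qed.

Lemma min_lower_entry_le s : G s -> Mp2_proj s 1 0 != 0 -> N <= `|Mp2_proj s 1 0|.
Proof.
move=> Gs cs; apply: ge_inf; last exact: lower_entry_in.
by exists 0 => _ [g _ <-].
Qed.

(** Shimizu's lemma bounds every element of the set from below; the given s makes the set nonempty,
    since the infimum of the empty set is a default value. *)
Lemma min_lower_entry_ge s : G s -> Mp2_proj s 1 0 != 0 -> h^-1 <= N.
Proof.
move=> Gs cs; apply: lb_le_inf; first by exists `|Mp2_proj s 1 0|; exact: lower_entry_in.
move=> _ [_ [t [Gt nst] <-] <-]; rewrite -[leLHS]mul1r ler_pdivrMr//.
apply: (shimizu hG hdisc h0 hwidth Gt); apply/eqP => c; apply: nst.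
by apply/stab_inftyE.
Qed.

Hypothesis N0 : 0 < N.

Definition cusp_strip : set (R * R) := [set p | 0 <= p.1 < h /\ N^-1 < p.2].

Lemma strip_below s x y (k : int) : G s -> Mp2_proj s 1 0 != 0 -> 0 < y ->
  cusp_strip (actR (Mp2_proj s)^-1%g (x + k%:~R * h, y)) -> y < N^-1.
Proof.
move=> Gs cs y0; rewrite -[in X in _ -> X](_ : (actR (Mp2_proj s) (actR (Mp2_proj s)^-1%g (x + k%:~R * h, y))).2 = y); last by rewrite actRVK.
case: (actR _^-1%g _) => u v [_ /= vN].
exact: actR_snd_lt N0 (min_lower_entry_le Gs cs) vN.
Qed.

(** The element b = s'^-1 d' d^-1 s carries one point of the strip to another. By [actR_snd_lt] its
    lower left entry is 0, so it translates by some j h; both real parts lie in [0, h), hence j = 0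
    and b projects to a scalar matrix. *)
Lemma coset_separation s s' x y (k k' : int) : G s -> G s' ->
  Mp2_proj s' 1 0 != 0 -> 0 < y ->
  cusp_strip (actR (Mp2_proj s)^-1%g (x + k%:~R * h, y)) ->
  cusp_strip (actR (Mp2_proj s')^-1%g (x + k'%:~R * h, y)) ->
  (exists2 d, stab_infty G d & s = (d * s')%g) /\ (s = s' -> k = k').
Proof.
move=> Gs Gs' cs' y0.
have [d sd td] := translates_stab hwidth k; have [d' sd' td'] := translates_stab hwidth k'.
set p := (x + k%:~R * h, y); set p' := (x + k'%:~R * h, y).
case wE : (actR (Mp2_proj s)^-1%g p) => [u v]; case wE' : (actR (Mp2_proj s')^-1%g p') => [u' v'].
move=> [/= /andP[u0 uh] vN] [/= /andP[u0' uh'] vN'].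
have v0 : 0 < v by rewrite (lt_trans _ vN)// invr_gt0.
have v0' : 0 < v' by rewrite (lt_trans _ vN')// invr_gt0.
pose b := (s'^-1 * (d' * (d^-1 * s)))%g.
have Gd : G d by case/stab_inftyE: sd.
have Gd' : G d' by case/stab_inftyE: sd'.
have Gb : G b.
  apply: (subgroupM hG); first exact: (subgroupV hG).
  apply: (subgroupM hG) => //; apply: (subgroupM hG) => //; exact: (subgroupV hG).
have ps : actR (Mp2_proj s) (u, v) = p by rewrite -wE actRVK.
have bw : actR (Mp2_proj b) (u, v) = (u', v').
  rewrite -[Mp2_proj b]/((Mp2_proj s')^-1 * (Mp2_proj d' * ((Mp2_proj d)^-1 * Mp2_proj s)))%g.
  rewrite !actRM// ps.
  have -> : p = actR (Mp2_proj d) (x, y) by rewrite (actR_translates _ _ td).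
  by rewrite actRK// (actR_translates _ _ td').
have cb : Mp2_proj b 1 0 = 0.
  apply/eqP; apply: contraT => cb.
  have := actR_snd_lt u N0 (min_lower_entry_le Gb cb) vN; rewrite bw /= => H.
  by have := lt_trans H vN'; rewrite ltxx.
have sb : stab_infty G b by apply/stab_inftyE.
have [j tj] := stab_translates hwidth sb.
have : (u', v') = (u + j%:~R * h, v) by rewrite -bw (actR_translates _ _ tj).
move=> [uj vv].
have j0 : j = 0.
  apply/eqP; rewrite eq_le -!ltzD1 -!(ltr_int R) !intrD mulr0z.
  move: uj; move: (j%:~R : R) => J uj.
  by apply/andP; split; rewrite -(ltr_pM2r h0) ?mulrDl ?mul1r ?mul0r ?mulrDl; lra.
rewrite j0 mul0r in tj; case: tj => e e1 [b1 b2 b3 b4].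
(* Conjugation preserves a scalar matrix, so b' fixes infinity as well, and s = d d'^-1 b' s' lies
   in the coset of s'. *)
pose b' := (s' * (b * s'^-1))%g.
have sb' : stab_infty G b'.
  apply/stab_inftyE; split.
    apply: (subgroupM hG) => //; apply: (subgroupM hG) => //; exact: (subgroupV hG).
  have [i1 i2 i3 i4] := SL2_invE (Mp2_proj s').
  rewrite -[Mp2_proj b']/(Mp2_proj s' * (Mp2_proj b * (Mp2_proj s')^-1))%g.
  move: (Mp2_proj b) b1 b2 b3 b4 => B b1 b2 b3 b4.
  rewrite !SL2_mulE b1 b2 b3 b4 i1 i3; ring.
split.
  exists (d * (d'^-1 * b'))%g.
    by apply: stabM => //; apply: stabM => //; exact: stabV.
  by rewrite /b' /b -!mulgA mulVg mulg1 !mulgA mulgK mulgVK mulgV mul1g.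
move=> ss; have : p = p'.
  have E : actR (Mp2_proj s') (u', v') = p' by rewrite -wE' actRVK.
  by rewrite -ps -E uj vv j0 mul0r addr0 ss.
move=> [/addrI /(mulIf (lt0r_neq0 h0)) /eqP]; rewrite eqr_int => /eqP //.
Qed.

Local Notation cosets := (right_cosets (stab_infty G) G).

(** The same choice as in [Psi], so that the terms of the two agree. *)
Definition coset_repr (A : cosets) : Mp2 R := xget 1%g (val A).

Lemma coset_reprP (A : cosets) : G (coset_repr A) /\
  val A = [set (t * coset_repr A)%g | t in stab_infty G].
Proof.
have := valP A; rewrite inE /= => -[g Gg gA]; have vA : val A = [set (t * g)%g | t in stab_infty G] by exact/esym.
have : val A (coset_repr A).
  by apply: (@xgetPex _ 1%g (val A)); exists g; rewrite vA; exists 1%g; [exact: stab1|rewrite mul1g].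
rewrite {1}vA => -[t st tg]; split.
  by rewrite -tg; apply: (subgroupM hG) => //; case/stab_inftyE: st.
rewrite {1}vA -tg; apply/seteqP; split => u /= [r sr <-].
  by exists (r * t^-1)%g; [apply: stabM => //; exact: stabV|rewrite mulgA mulgVK].
by exists (r * t)%g; [exact: stabM|rewrite mulgA].
Qed.

Lemma coset_repr_inj (A B : cosets) d : stab_infty G d ->
  coset_repr A = (d * coset_repr B)%g -> A = B.
Proof.
move=> sd AB; apply: val_inj; have [_ ->] := coset_reprP A; have [_ ->] := coset_reprP B.
rewrite AB; apply/seteqP; split => u /= [r sr <-].
  by exists (r * d)%g; [exact: stabM|rewrite mulgA].
by exists (r * d^-1)%g; [apply: stabM => //; exact: stabV|rewrite mulgA mulgVK].
Qed.

(** By [improper_coset_uniq] this excludes at most one coset, that of 1. *)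
Definition proper_coset (A : cosets) := Mp2_proj (coset_repr A) 1 0 != 0.

Lemma improper_coset_uniq (A B : cosets) : ~~ proper_coset A -> ~~ proper_coset B -> A = B.
Proof.
rewrite /proper_coset !negbK => /eqP cA /eqP cB.
have [GA _] := coset_reprP A; have [GB _] := coset_reprP B.
have sA : stab_infty G (coset_repr A) by apply/stab_inftyE.
have sB : stab_infty G (coset_repr B) by apply/stab_inftyE.
apply: (@coset_repr_inj A B (coset_repr A * (coset_repr B)^-1)%g).
  by apply: stabM => //; exact: stabV.
by rewrite mulgVK.
Qed.

(* Rational points of the disjoint images of the strip enumerate the cosets. *)
Lemma coset_enum : exists f : cosets -> nat, forall A B,
  proper_coset A -> proper_coset B -> f A = f B -> A = B.
Proof.
have ex A : exists q : rat * rat, 0 < ratr q.2 :> R /\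
    cusp_strip (actR (Mp2_proj (coset_repr A))^-1%g (ratr q.1, ratr q.2)).
  set g := Mp2_proj _.
  have iN : 0 < N^-1 by rewrite invr_gt0.
  have y0 : 0 < 2 * N^-1 by rewrite mulr_gt0.
  (* The point (h / 2, 2 / N) is interior to the strip, so by continuity rational points near its
     image are pulled back into the strip. *)
  have pE := actRK g (h / 2) y0; have p0 := actR_gt0 g (h / 2) y0.
  case: (actR g _) pE p0 => x y /= pE p0.
  have [c1 c2] := continuous_actR g^-1%g x p0; rewrite pE /= in c1 c2.
  apply: (@rational_near _ x y [set p : R * R | 0 < p.2 /\ cusp_strip (actR g^-1%g p)]).
  have cy : (fun p : R * R => p.2) @ (x, y) --> y by exact: cvg_snd.
  have n1 : \forall p \near (x, y), 0 < p.2 by exact: (cvgr_gt _ cy _ p0).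
  have n2 : \forall p \near (x, y), 0 < (actR g^-1%g p).1.
    by apply: (cvgr_gt _ c1); rewrite divr_gt0.
  have n3 : \forall p \near (x, y), (actR g^-1%g p).1 < h.
    by apply: (cvgr_lt _ c1); rewrite ltr_pdivrMr// ltr_pMr// ltr1n.
  have n4 : \forall p \near (x, y), N^-1 < (actR g^-1%g p).2.
    by apply: (cvgr_gt _ c2); rewrite ltr_pMl// ltr1n.
  near=> p; split; first by near: p.
  split; last by near: p.
  by apply/andP; split; [apply: ltW|]; near: p.
have [q qP] := choice ex.
exists (fun A => choice.pickle (q A)) => A B pA pB /(pcan_inj choice.pickleK) qE.
have [GA _] := coset_reprP A; have [GB _] := coset_reprP B.
have [yA SA] := qP A; have [_ SB] := qP B; rewrite -qE in SB.
have E0 (x : R) : x = x + (0 : int)%:~R * h by rewrite mul0r addr0.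
rewrite (E0 (ratr (q A).1)) in SA; rewrite (E0 (ratr (q A).1)) in SB.
have [[d sd dE] _] := coset_separation GA GB pB yA SA SB.
exact: coset_repr_inj sd dE.
Unshelve. all: by end_near. Qed.

End Cosets.

(** * Summation over the cosets *)

Section Summation.
Context {R : realType} (I : choiceType).
Implicit Types (J : {fset I}) (r : I -> R) (a : I -> R[i]).
#[local] Existing Instance summability.totally_filter.

Lemma partial_sumE (V : zmodType) (x : I -> V) J :
  summability.partial_sum x J = \sum_(i <- J) x i.
Proof. by rewrite /summability.partial_sum (big_seq_fsetE _ _ xpredT x). Qed.

Lemma sum_subseq_perm (V : nmodType) (K : eqType) (F : K -> V) (s t : seq K) :
  uniq s -> uniq t -> {subset s <= t} ->
  \sum_(i <- s) F i = \sum_(i <- t | i \in s) F i.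
Proof.
move=> us ut st; rewrite -[RHS]big_filter; apply: perm_big; apply: uniq_perm => //.
  exact: filter_uniq.
by move=> i; rewrite mem_filter; case: (boolP (i \in s)) => // /st ->.
Qed.

Lemma ler_sum_fsubset r J J' : (forall i, 0 <= r i) -> (J `<=` J')%fset ->
  \sum_(i <- J) r i <= \sum_(i <- J') r i.
Proof.
move=> r0 JJ; rewrite (@sum_subseq_perm _ _ r J J') ?fset_uniq//; last exact/fsubsetP.
by rewrite [leRHS](bigID (fun i => i \in J)) /= lerDl sumr_ge0.
Qed.

Lemma cvg_partial_sum_ge0 r (S : R) : (forall i, 0 <= r i) ->
  (forall J, \sum_(i <- J) r i <= S) ->
  cvg (summability.partial_sum r @ summability.totally).
Proof.
move=> r0 rS; pose E := [set \sum_(i <- J) r i | J in [set: {fset I}]].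
have hE : has_sup E.
  split; first by exists (\sum_(i <- fset0) r i), fset0.
  by exists S => _ [J _ <-].
apply/cvg_ex; exists (sup E); apply/cvgrPdist_lt => e e0.
have [_ [J0 _ <-] HJ0] := sup_adherent e0 hE.
exists J0 => // J /= JJ; rewrite partial_sumE.
have le1 : \sum_(i <- J) r i <= sup E by apply: sup_upper_bound => //; exists J.
have := ler_sum_fsubset r0 JJ => le2.
by rewrite ger0_norm ?subr_ge0//; lra.
Qed.

(** A real family is the difference of the nonnegative families |r| + r and |r|. *)
Lemma cvg_partial_sum r (S : R) : (forall J, \sum_(i <- J) `|r i| <= S) ->
  cvg (summability.partial_sum r @ summability.totally).
Proof.
move=> rS.
have c1 : cvg (summability.partial_sum (fun i => `|r i|) @ summability.totally).
  exact: (cvg_partial_sum_ge0 (S := S)).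
have c2 : cvg (summability.partial_sum (fun i => `|r i| + r i) @ summability.totally).
  apply: (cvg_partial_sum_ge0 (S := 2 * S)).
    by move=> i; have := ler_norm (- r i); rewrite normrN; lra.
  move=> J; apply: (@le_trans _ _ (\sum_(i <- J) 2 * `|r i|)).
    by apply: ler_sum => i _; rewrite mulrDl mul1r lerD2l ler_norm.
  by rewrite -mulr_sumr ler_pM2l.
have -> : summability.partial_sum r =
    (fun J => summability.partial_sum (fun i => `|r i| + r i) J - summability.partial_sum (fun i => `|r i|) J).
  by apply/funext => J; rewrite !partial_sumE big_split /= addrAC subrr add0r.
exact: is_cvgB.
Qed.

Lemma cvg_partial_sum_complex a (S : R) : (forall J, \sum_(i <- J) normc (a i) <= S) ->
  exists l : R[i], (summability.partial_sum a : {fset I} -> R[i]^o) @ summability.totally --> (l : R[i]^o).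
Proof.
move=> aS.
have /cvg_ex[u cu] : cvg (summability.partial_sum (fun i => complex.Re (a i)) @ summability.totally).
  apply: (cvg_partial_sum (S := S)) => J; apply: le_trans (aS J).
  by apply: ler_sum => i _; exact: Re_le_normc.
have /cvg_ex[v cv] : cvg (summability.partial_sum (fun i => complex.Im (a i)) @ summability.totally).
  apply: (cvg_partial_sum (S := S)) => J; apply: le_trans (aS J).
  by apply: ler_sum => i _; exact: Im_le_normc.
exists (u +i* v); apply: cvg_complex => /=.
- rewrite (_ : _ \o _ = summability.partial_sum (fun i => complex.Re (a i)))//.
  by apply/funext => J /=; rewrite !partial_sumE (raddf_sum (@complex.Re R : {additive R[i] -> R})).
- rewrite (_ : _ \o _ = summability.partial_sum (fun i => complex.Im (a i)))//.
  by apply/funext => J /=; rewrite !partial_sumE (raddf_sum (@complex.Im R : {additive R[i] -> R})).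
Qed.

(** The value of [summability.sum] is a limit, which may be a default value; the bound on finite
    sums yields convergence, and then the term at i0 is minus the limit of the sums of the
    others. *)
Lemma sum_eq0_le a i0 (S : R) : summability.sum (a : I -> R[i]^o) = 0 ->
  (forall J, i0 \notin J -> \sum_(i <- J) normc (a i) <= S) -> normc (a i0) <= S.
Proof.
move=> a0 aS.
have aS' J : \sum_(i <- J) normc (a i) <= normc (a i0) + S.
  have [iJ|iJ] := boolP (i0 \in J); last by rewrite (le_trans (aS _ iJ))// lerDr normc_ge0.
  rewrite (big_fsetD1 i0)//= lerD2l; apply: aS; by rewrite !inE eqxx.
have [l cl] := cvg_partial_sum_complex aS'.
have l0 : l = 0.
  rewrite -a0; apply/esym; exact: (cvg_lim (@norm_hausdorff _ _) cl).
rewrite l0 in cl.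
have cn : normc (summability.partial_sum a J) @[J --> summability.totally] --> normc (0 : R[i]).
  exact: (@cvg_normc _ _ _ _ _ _ cl).
rewrite normc0 in cn; rewrite -subr_le0; apply: (cvgr_to_ge cn).
exists [fset i0]%fset => // J /=; rewrite fsub1set => iJ.
rewrite partial_sumE (big_fsetD1 i0)//= lerBlDr.
set u := a i0; set v := \sum_(i <- _) a i.
have : normc u <= normc (u + v) + normc v.
  have := normc_triangle (u + v) (- v); rewrite addrK normc_opp => //.
move=> /le_trans; apply; rewrite lerD2l; apply: le_trans (normc_sum _ _ _) _.
by apply: aS; rewrite !inE eqxx.
Qed.

Lemma sum_nneseries_le (b : nat -> \bar R) (s : seq nat) : (forall n, (0 <= b n)%E) -> uniq s ->
  (\sum_(n <- s) b n <= \sum_(n <oo) b n)%E.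
Proof.
move=> b0 us; pose K := (\max_(n <- s) n).+1.
have sK : {subset s <= iota 0 K}.
  move=> n ns; rewrite mem_iota /= add0n ltnS.
  by rewrite (big_rem n ns) /= leq_max leqnn.
rewrite (sum_subseq_perm b us (iota_uniq 0 K) sK).
apply: (@le_trans _ _ (\sum_(0 <= n < K) b n)%E).
  rewrite /index_iota subn0 [leRHS](bigID (fun n => n \in s)) /=.
  by apply: leeDl; apply: sume_ge0.
exact: nneseries_lim_ge.
Qed.

(** An infinite series leaves nothing to prove, and a finite one bounds all finite sums. Here [f]
    places the terms other than the one at i0 at distinct indices, and the remaining indices only
    add nonnegative terms. *)
Lemma sum_eq0_nneseries a i0 (f : I -> nat) (b : nat -> \bar R) (c : R) : 0 < c ->
  summability.sum (a : I -> R[i]^o) = 0 ->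
  (forall n, (0 <= b n)%E) ->
  (forall i j, i != i0 -> j != i0 -> f i = f j -> i = j) ->
  (forall i, i != i0 -> b (f i) = (normc (a i) * c)%:E) ->
  ((normc (a i0) * c)%:E <= \sum_(n <oo) b n)%E.
Proof.
move=> c0 a0 b0 fI bf.
have := nneseries_ge0 (P := xpredT) (N := 0) (fun n _ _ => b0 n).
case E : (\sum_(n <oo) b n)%E => [S| |] //= S0; last by rewrite leey.
rewrite lee_fin -ler_pdivlMr//; apply: (sum_eq0_le a0) => J iJ.
rewrite ler_pdivlMr// -lee_fin -E.
have H i : i \in J -> i != i0 by move=> iJ'; apply: contraNneq iJ => <-.
have -> : ((\sum_(i <- J) normc (a i)) * c)%:E = (\sum_(n <- map f J) b n)%E.
  rewrite big_map mulr_suml -sumEFin big_seq [RHS]big_seq; apply: eq_bigr => i /H ni.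
  by rewrite bf.
apply: sum_nneseries_le => //; rewrite map_inj_in_uniq ?fset_uniq// => i j /H ni /H nj.
exact: fI.
Qed.

End Summation.

(** * The slash action in absolute value *)

Section Slash.
Context {R : realType}.
Local Notation RT := (measurableTypeR R).
Variables (m h : R) (w : nat) (s : R[i]) (G : set (Mp2 R)) (chi : Mp2 R -> R[i]).
Hypotheses (hw : w%:R = 2 * m) (h0 : 0 < h) (s1 : 1 < complex.Re s).
Hypothesis hchi : finite_order_character G chi.

Lemma normc_chi g : G g -> normc (chi g) = 1.
Proof.
case: hchi => _ _ [k k0 H] Gg; have := congr1 (@normc R) (H g Gg).
rewrite normcX normc1 => /eqP; rewrite pexpr_eq1 ?normc_ge0// => [/eqP//].
Qed.

(** For this function the weight m action, in absolute value, becomes plain composition with the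
    action on the half plane, see [weighted_absF_slash]. *)
Definition weighted_absF (p : RT * RT) : \bar R := (absF h s p * (p.2 `^ (m / 2))%:E)%E.

Lemma weighted_absF_ge0 p : (0 <= weighted_absF p)%E.
Proof. by rewrite mule_ge0 ?absF_ge0// lee_fin powR_ge0. Qed.

Lemma measurable_weighted_absF : measurable_fun setT weighted_absF.
Proof.
apply: emeasurable_funM; first exact: measurable_absF.
apply/measurable_EFinP; apply: (measurableT_comp (measurable_powR (m / 2))).
exact: measurable_snd.
Qed.

Lemma weighted_absF_period (k : int) (x y : R) : weighted_absF ((x + k%:~R * h : R), y) = weighted_absF (x, y).
Proof. by rewrite /weighted_absF absF_period. Qed.

(** The fourth power of |eta| is |c z + d|^2 = Im z / Im (g z), and w = 2 m. *)
Lemma normc_etaX (g : Mp2 R) (z : uhp R) :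
  normc (Mp2_eta g z) ^+ w = (complex.Im z / complex.Im (act (Mp2_proj g) z)) `^ (m / 2).
Proof.
have n0 : 0 < normc (Mp2_eta g z).
  rewrite lt0r normc_ge0 andbT; apply: contra (Mp2_eta_neq0 g z) => /eqP H; exact/eqP/eq0_normc.
have -> : complex.Im z / complex.Im (act (Mp2_proj g) z) = normc (Mp2_eta g z) ^+ 4.
  have ImE : complex.Im (act (Mp2_proj g) z) = complex.Im z /
      ((Mp2_proj g 1 0 * complex.Re z + Mp2_proj g 1 1) ^+ 2 + (Mp2_proj g 1 0 * complex.Im z) ^+ 2).
    by case: (z) => -[x y] y0; exact: Im_mobius.
  have I0 := uhp_valP (act (Mp2_proj g) z); have z0 := uhp_valP z.
  rewrite -[4%N]/(2 * 2)%N exprM -normcX Mp2_sqr normc_sqrE.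
  have -> : complex.Re (mobius_den (Mp2_proj g) z) = Mp2_proj g 1 0 * complex.Re z + Mp2_proj g 1 1.
    by rewrite /mobius_den; case: (uhp_val z) => x y /=; rewrite mul0r subr0.
  have -> : complex.Im (mobius_den (Mp2_proj g) z) = Mp2_proj g 1 0 * complex.Im z.
    by rewrite /mobius_den; case: (uhp_val z) => x y /=; rewrite mul0r !addr0.
  rewrite ImE in I0 *; move: I0; set D := _ + _ => I0.
  have D0 : D != 0 by apply: contraTneq I0 => ->; rewrite invr0 mulr0 ltxx.
  by rewrite invf_div mulrC divfK ?gt_eqF.
rewrite -powR_mulrn ?normc_ge0// -(powR_mulrn 4) ?normc_ge0// -powRrM hw; congr (_ `^ _).
by field.
Qed.

Lemma weighted_absF_slash (g : Mp2 R) (x y : R) (y0 : 0 < y) : G g ->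
  weighted_absF (actR (Mp2_proj g) (x, y)) =
  (normc ((chi g)^* * slash w (Fseries h s) g (@Uhp R (x +i* y) y0)) * y `^ (m / 2))%:E.
Proof.
move=> Gg; set z := Uhp _; rewrite (actRE _ _ y0) -/z /weighted_absF absF_Fseries//.
rewrite -EFinM; congr EFin; rewrite /slash !normcM normcV normcX normc_etaX.
have -> : normc (chi g)^* = 1 by rewrite -(normc_chi Gg); case: (chi g) => a b /=; rewrite sqrrN.
rewrite mul1r -mulrA; congr (_ * _); have I0 := uhp_valP (act (Mp2_proj g) z).
rewrite -/z [complex.Im z]/= powRM ?invr_ge0 ?(ltW y0) ?(ltW I0)//.
have p1 : 0 < y `^ (m / 2) by rewrite powR_gt0.
have p2 : 0 < complex.Im (act (Mp2_proj g) z) `^ (m / 2) by rewrite powR_gt0.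
have -> : (complex.Im (act (Mp2_proj g) z))^-1 `^ (m / 2) = (complex.Im (act (Mp2_proj g) z) `^ (m / 2))^-1.
  by rewrite -powR_inv1 ?(ltW I0)// powRAC powR_inv1// ltW.
by rewrite invfM invrK mulrAC mulVf ?mul1r// gt_eqF.
Qed.

End Slash.

(** * The two sides of the unfolding inequality *)

Section RadialIntegrals.
Context {R : realType}.
Local Notation RT := (measurableTypeR R).
Local Notation mu := (@lebesgue_measure R).
Variables (m h : R) (s : R[i]).
Hypotheses (h0 : 0 < h) (s1 : 1 < complex.Re s).
Let sigma := complex.Re s.
Local Open Scope ereal_scope.

Lemma measurable_le_indic (B : R) : measurable_fun [set: RT] (fun y : RT => (y <= B)%R%:R : R).
Proof.
have : measurable_fun [set: RT] (\1_(`]-oo, B]%classic : set RT) : RT -> R).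
  by apply: measurable_indic; exact: measurable_itv.
by apply: eq_measurable_fun => x _; rewrite indicE mem_setE in_itv.
Qed.

Lemma measurable_gt_indic (B : R) : measurable_fun [set: RT] (fun y : RT => (B < y)%R%:R : R).
Proof.
have : measurable_fun [set: RT] (\1_(`]B, +oo[%classic : set RT) : RT -> R).
  by apply: measurable_indic; exact: measurable_itv.
by apply: eq_measurable_fun => x _; rewrite indicE mem_setE in_itv/= andbT.
Qed.

(** The substitution v = y^q in the integral of the indicator of v <= B^q. *)
Lemma integral_powR (q B : R) : (0 < q)%R -> (0 < B)%R ->
  \int[mu]_(y in `]0%R, +oo[) ((y <= B)%R%:R * y `^ (q - 1))%:E = (B `^ q / q)%:E.
Proof.
move=> q0 B0; have Bq : (0 < B `^ q)%R by rewrite powR_gt0.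
have mg : measurable_fun setT (fun v : R => ((v <= B `^ q)%R%:R : R)%:E).
  by apply/measurable_EFinP; exact: measurable_le_indic.
have E := ge0_integral_powR q0 mg.
set J := \int[mu]_(y in _) _.
have {}E : (B `^ q)%:E = q%:E * J.
  transitivity (\int[mu]_(y in `]0%R, +oo[) ((y <= B `^ q)%R%:R : R)%:E).
    rewrite -[LHS]mul1e [LHS](_ : _ = \int[mu]_(y in `]0%R, (B `^ q)%R]) (1%:E : \bar R)); last first.
      by rewrite integral_cst//= lebesgue_measure_itv/= lte_fin Bq -EFinD subr0.
    rewrite integral_mkcond [RHS]integral_mkcond; apply: eq_integral => y _.
    by rewrite !patchE !mem_setE !in_itv/= andbT; case: (0 < y)%R => //=; case: (y <= _)%R.
  rewrite E; last by move=> v; rewrite lee_fin ler0n.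
  rewrite /J -ge0_integralZl//; last 3 first.
  - apply: measurable_funTS; apply/measurable_EFinP; apply: measurable_funM; first exact: measurable_le_indic.
    exact: measurable_powR.
  - by move=> y _; rewrite lee_fin mulr_ge0// powR_ge0.
  - by rewrite lee_fin ltW.
  apply: eq_integral => y; rewrite inE/= in_itv/= andbT => y0.
  rewrite -!EFinM; congr EFin; rewrite mulrCA; congr (q * ((nat_of_bool _)%:R * _))%R.
  have nn (x : R) : (0 < x -> x \in Num.nneg)%R by move=> x0; rewrite nnegrE ltW.
  apply/idP/idP => H; last exact: (ge0_ler_powR (ltW q0) (nn _ y0) (nn _ B0) H).
  rewrite leNgt; apply: contraL H => H; rewrite -ltNge.
  exact: (gt0_ltr_powR q0 (nn _ B0) (nn _ y0) H).
by rewrite mulrC EFinM E muleA -EFinM mulVf ?mul1e// gt_eqF.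
Qed.

Definition row_integral (y : R) : \bar R := \int[mu]_(x in `[0%R, h[) absF h s (x, y).

Lemma row_integral_ge0 y : 0 <= row_integral y.
Proof. by apply: integral_ge0 => x _; exact: absF_ge0. Qed.

Lemma measurable_strip_absF :
  measurable_fun [set: RT * RT] (fun p => (0 <= p.1 < h)%R%:R%:E * absF h s p).
Proof.
apply: emeasurable_funM; last exact: measurable_absF.
by apply/measurable_EFinP; apply: (measurableT_comp (measurable_strip h)); exact: measurable_fst.
Qed.

Lemma measurable_row_integral : measurable_fun setT row_integral.
Proof.
have G0 (p : RT * RT) : 0 <= (0 <= p.1 < h)%R%:R%:E * absF h s p.
  by rewrite mule_ge0 ?absF_ge0// lee_fin ler0n.
have /(_ mu) := measurable_fun_fubini_tonelli_G _ measurable_strip_absF G0.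
by apply: eq_measurable_fun => y _; rewrite /fubini_G /row_integral integral_strip.
Qed.

(** Fubini reduces the strip to its rows; the exponent -2 is the invariant density, recovered from
    logarithmic coordinates. *)
Lemma hyp_weight (wgt : RT -> R) : measurable_fun setT wgt -> (forall y, (0 <= wgt y)%R) ->
  hyp_integral (fun p : RT * RT => (0 <= p.1 < h)%R%:R%:E * ((wgt p.2)%:E * absF h s p)) =
  \int[mu]_(y in `]0%R, +oo[) ((wgt y * y `^ (-2))%:E * row_integral y).
Proof.
move=> mw w0; rewrite hyp_iter; last 2 first.
- have mw2 : measurable_fun [set: RT * RT] (fun p => (wgt p.2)%:E).
    by apply/measurable_EFinP; apply: (measurableT_comp mw); exact: measurable_snd.
  have := emeasurable_funM mw2 measurable_strip_absF; apply: eq_measurable_fun => p _ /=.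
  by rewrite muleCA.
- by move=> p; rewrite mule_ge0 ?mule_ge0 ?absF_ge0// lee_fin ?ler0n.
have mww : measurable_fun setT (fun y : R => ((wgt y * y `^ (-2))%:E * row_integral y)).
  apply: emeasurable_funM; last exact: measurable_row_integral.
  by apply/measurable_EFinP; apply: measurable_funM => //; exact: measurable_powR.
rewrite ge0_integral_expR//; last first.
  by move=> y; rewrite mule_ge0 ?row_integral_ge0// lee_fin mulr_ge0// powR_ge0.
apply: eq_integral => u _.
rewrite /row_integral integral_strip muleAC -EFinM.
have -> : (wgt (expR u) * expR u `^ (-2) * expR u = wgt (expR u) * expR (- u))%R.
  by rewrite -mulrA -expRM -expRD; congr (_ * expR _)%R; ring.
rewrite -ge0_integralZl//; last 3 first.
- by apply: (measurableT_comp measurable_strip_absF); exact: measurable_fun_pair.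
- by move=> x _; rewrite mule_ge0 ?absF_ge0// lee_fin ler0n.
- by rewrite lee_fin mulr_ge0// expR_ge0.
apply: eq_integral => x _ /=.
by rewrite EFinM -!muleA muleCA; congr (_ * _); rewrite [RHS]muleC -muleA.
Qed.

(** The row bound [integral_absF_le] leaves the power m / 2 - 2 + (1 - sigma) of y, integrable at 0
    because sigma < m / 2. *)
Lemma hyp_upper (B : R) : (0 < B)%R -> (sigma < m / 2)%R ->
  hyp_integral (fun p : RT * RT => ((0 <= p.1 < h) && (p.2 <= B))%R%:R%:E * weighted_absF m h s p) <=
  (h * (norm_Re_ratio s * Gamma_average s) * (4 * pi / h) `^ (1 - sigma) *
   (B `^ (m / 2 - sigma) / (m / 2 - sigma)))%:E.
Proof.
move=> B0 sm2; set q := (m / 2 - sigma)%R; have q0 : (0 < q)%R by rewrite subr_gt0.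
pose wgt (y : RT) : R := ((y <= B)%R%:R * y `^ (m / 2))%R.
have mw : measurable_fun setT wgt.
  by apply: measurable_funM; [exact: measurable_le_indic|exact: measurable_powR].
have w0 y : (0 <= wgt y)%R by rewrite mulr_ge0// powR_ge0.
rewrite (_ : hyp_integral _ = hyp_integral (fun p : RT * RT => (0 <= p.1 < h)%R%:R%:E * ((wgt p.2)%:E * absF h s p))); last first.
  apply: eq_hyp => x y y0; rewrite /weighted_absF /wgt /= -mulnb natrM !EFinM -!muleA; congr (_ * (_ * _)).
  by rewrite muleC.
rewrite hyp_weight//.
set C := (h * _ * _)%R.
have EG0 : (0 <= norm_Re_ratio s * Gamma_average s)%R.
  rewrite mulr_ge0 ?norm_Re_ratio_ge0// /Gamma_average /gamma_square_ratio.
  have s0 : (0 < complex.Re s)%R by rewrite (lt_trans ltr01).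
  rewrite mulr_ge0 ?divr_ge0 ?exprn_ge0// ltW// Gamma_fun_gt0 ?subr_gt0//.
  by rewrite divr_gt0.
have C0 : (0 <= C)%R by rewrite /C mulr_ge0 ?powR_ge0// mulr_ge0// ltW.
rewrite EFinM -(integral_powR q0 B0) -ge0_integralZl//; last 2 first.
- apply: measurable_funTS; apply/measurable_EFinP; apply: measurable_funM; first exact: measurable_le_indic.
  exact: measurable_powR.
- by move=> y _; rewrite lee_fin mulr_ge0// powR_ge0.
apply: ge0_le_integral => //.
- by move=> y _; rewrite mule_ge0 ?row_integral_ge0// lee_fin mulr_ge0// powR_ge0.
- apply: measurable_funTS; apply: emeasurable_funM; last exact: measurable_row_integral.
  by apply/measurable_EFinP; apply: measurable_funM => //; exact: measurable_powR.
- apply: measurable_funTS; apply: measurable_funeM; apply/measurable_EFinP; apply: measurable_funM; first exact: measurable_le_indic.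
  exact: measurable_powR.
move=> y; rewrite /= in_itv/= andbT => y0.
have W0 : 0 <= (wgt y * y `^ (-2))%:E by rewrite lee_fin mulr_ge0// powR_ge0.
apply: (le_trans (lee_wpmul2l W0 (integral_absF_le h0 s1 y0))).
rewrite -!EFinM lee_fin le_eqVlt; apply/orP; left; apply/eqP.
have -> : ((4 * pi * y / h) `^ (1 - sigma) = (4 * pi / h) `^ (1 - sigma) * y `^ (1 - sigma))%R.
  rewrite -powRM ?(ltW y0)//; first by congr (_ `^ _)%R; ring.
  by rewrite divr_ge0 ?mulr_ge0 ?pi_ge0// ltW.
have E : (y `^ (m / 2) * y `^ (-2) * y `^ (1 - sigma) = y `^ (q - 1))%R.
  by rewrite (powRD_gt0 y0 (erefl _)) (powRD_gt0 y0 (erefl _)); congr (_ `^ _)%R; rewrite /q; ring.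
by rewrite -E /wgt /C -/sigma; ring.
Qed.

(** The row bound [integral_absF_ge] leaves y^(k-1) exp (- 2 pi y / h), and t = 2 pi y / h turns
    this into an incomplete gamma integral. *)
Lemma hyp_lower (B k : R) : (0 < B)%R -> k = (m / 2 - 1)%R ->
  (h * (h / (2 * pi)) `^ k)%:E *
    \int[mu]_(t in `]((2 * pi * B / h) : R)%R, +oo[) (t `^ (k - 1) * expR (- t))%:E <=
  hyp_integral (fun p : RT * RT => ((0 <= p.1 < h) && (B < p.2))%R%:R%:E * weighted_absF m h s p).
Proof.
move=> B0 kE.
pose wgt (y : RT) : R := ((B < y)%R%:R * y `^ (m / 2))%R.
have mw : measurable_fun setT wgt.
  by apply: measurable_funM; [exact: measurable_gt_indic|exact: measurable_powR].
have w0 y : (0 <= wgt y)%R by rewrite mulr_ge0// powR_ge0.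
rewrite (_ : hyp_integral _ = hyp_integral (fun p : RT * RT => (0 <= p.1 < h)%R%:R%:E * ((wgt p.2)%:E * absF h s p))); last first.
  apply: eq_hyp => x y y0; rewrite /weighted_absF /wgt /= -mulnb natrM !EFinM -!muleA; congr (_ * (_ * _)).
  by rewrite muleC.
rewrite hyp_weight//.
pose F (y : R) : \bar R := ((B < y)%R%:R * (y `^ (k - 1) * (h * expR (- (2 * pi * y / h)))))%:E.
have me (c : R) : measurable_fun [set: RT] (fun y => expR (- (c * y / h)) : R)%R.
  apply: measurableT_comp => //; apply: measurableT_comp => //.
  by do 2 apply: measurable_funM => //.
have mF : measurable_fun setT F.
  apply/measurable_EFinP; apply: measurable_funM; first exact: measurable_gt_indic.
  apply: measurable_funM; first exact: measurable_powR.
  by apply: measurable_funM => //; exact: me.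
have F0 y : 0 <= F y by rewrite lee_fin mulr_ge0// mulr_ge0 ?powR_ge0// mulr_ge0 ?expR_ge0// ltW.
apply: (@le_trans _ _ (\int[mu]_(y in `]0%R, +oo[) F y)); last first.
  apply: ge0_le_integral => //.
  - exact: measurable_funTS.
  - apply: measurable_funTS; apply: emeasurable_funM; last exact: measurable_row_integral.
    by apply/measurable_EFinP; apply: measurable_funM => //; exact: measurable_powR.
  move=> y; rewrite /= in_itv/= andbT => y0.
  have W0 : 0 <= (wgt y * y `^ (-2))%:E by rewrite lee_fin mulr_ge0// powR_ge0.
  apply: le_trans (lee_wpmul2l W0 (integral_absF_ge h0 s1 y0)).
  rewrite -EFinM lee_fin le_eqVlt; apply/orP; left; apply/eqP.
  have -> : (y `^ (k - 1) = y `^ (m / 2) * y `^ (-2))%R.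
    by rewrite (powRD_gt0 y0 (erefl _)) kE; congr (_ `^ _)%R; ring.
  by rewrite /wgt; ring.
pose c := (h / (2 * pi))%R.
have p0 : (0 < 2 * pi :> R)%R by rewrite mulr_gt0// pi_gt0.
have c0 : (0 < c)%R by rewrite divr_gt0.
have -> : \int[mu]_(y in `]0%R, +oo[) F y = \int[mu]_y F y.
  rewrite integral_mkcond; apply: eq_integral => y _; rewrite patchE mem_setE in_itv/= andbT.
  by case: ltP => // y0; rewrite /F ltNge (le_trans y0 (ltW B0))/= mul0r.
rewrite (ge0_integral_affine 0 c0 mF F0).
rewrite -ge0_integralZl//; last 3 first.
- apply: measurable_funTS; apply/measurable_EFinP; exact: measurable_gamma_integrand.
- by move=> t _; rewrite lee_fin mulr_ge0 ?powR_ge0 ?expR_ge0.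
- by rewrite lee_fin mulr_ge0 ?powR_ge0// ltW.
rewrite -[X in _ <= X]ge0_integralZl//; last 2 first.
- apply: (measurableT_comp mF); exact: measurable_affine.
- by rewrite lee_fin ltW.
rewrite le_eqVlt; apply/orP; left; apply/eqP.
rewrite integral_mkcond; apply: eq_integral => t _; rewrite patchE mem_setE in_itv/= andbT.
have -> : (2 * pi * B / h < t)%R = (B < c * t)%R.
  by rewrite /c ltr_pdivrMr// [in RHS]mulrAC ltr_pdivlMr// mulrC [(h * t)%R]mulrC.
rewrite /F addr0; case: ifP => Bt; last by rewrite mul0r mule0.
have t0 : (0 < t)%R by rewrite -(pmulr_rgt0 _ c0) (lt_trans B0).
rewrite mul1r -!EFinM; congr EFin.
rewrite -/c (powRM _ (ltW c0) (ltW t0)).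
have -> : (2 * pi * (c * t) / h = t)%R by rewrite /c; have := pi_gt0 R; move: (pi : R) => P P0; field; rewrite !gt_eqF.
have -> : (c `^ k = c * c `^ (k - 1))%R.
  by rewrite -{2}[c]powRr1 ?(ltW c0)// (powRD_gt0 c0 (erefl _)); congr (_ `^ _)%R; ring.
ring.
Qed.

End RadialIntegrals.

(** * Comparison of the constants *)

Section Numeric.
Context {R : realType}.
Variable s : R[i].
Let sigma := complex.Re s.
Hypothesis s1 : 1 < sigma.

(** Legendre's formula at sigma / 2 and at (sigma - 1) / 2; the two factors Gamma (sigma / 2) that
    arise cancel the denominator. *)
Lemma Gamma_averageE : 4 `^ (1 - sigma) * Gamma_average s =
  Gamma_fun ((sigma + 1) / 2) * Gamma_fun ((sigma - 1) / 2) / (2 * pi).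
Proof.
have s0 : 0 < sigma by rewrite (lt_trans ltr01).
have sh : 0 < sigma / 2 by rewrite divr_gt0.
have smh : 0 < (sigma - 1) / 2 by rewrite divr_gt0// subr_gt0.
have D1 := Gamma_duplication sh; have D2 := Gamma_duplication smh.
rewrite (_ : sigma / 2 + 2^-1 = (sigma + 1) / 2) in D1; last by field.
rewrite (_ : (sigma - 1) / 2 + 2^-1 = sigma / 2) in D2; last by field.
rewrite (_ : 2 * (sigma / 2) = sigma) in D1; last by field.
rewrite (_ : 2 * ((sigma - 1) / 2) = sigma - 1) in D2; last by field.
have p2 : 0 < 2 `^ (1 - sigma) :> R by rewrite powR_gt0.
have E4 : 4 `^ (1 - sigma) = 2 `^ (1 - sigma) * 2 `^ (1 - sigma) :> R.
  by rewrite -powRM//; congr (_ `^ _); rewrite -natrM.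
have E2 : 2 `^ (1 - (sigma - 1)) = 2 * 2 `^ (1 - sigma) :> R.
  by rewrite -{2}[2 : R]powRr1// (@powRD_gt0 R 2 1 (1 - sigma) (1 - (sigma - 1)))//; ring.
rewrite E2 in D2; rewrite E4 /Gamma_average /gamma_square_ratio -/sigma.
have g0 : 0 < Gamma_fun (sigma / 2) by rewrite Gamma_fun_gt0// divr_gt0.
have q0 : 0 < Num.sqrt pi :> R by rewrite sqrtr_gt0 pi_gt0.
have qq : Num.sqrt pi * Num.sqrt pi = pi :> R by rewrite -expr2 sqr_sqrtr// pi_ge0.
have A1 : Gamma_fun sigma = Gamma_fun (sigma / 2) * Gamma_fun ((sigma + 1) / 2) / (2 `^ (1 - sigma) * Num.sqrt pi).
  by rewrite D1 mulrC mulKf// mulf_neq0 ?gt_eqF.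
have A2 : Gamma_fun (sigma - 1) = Gamma_fun ((sigma - 1) / 2) * Gamma_fun (sigma / 2) / (2 * 2 `^ (1 - sigma) * Num.sqrt pi).
  by rewrite D2 mulrC mulKf// !mulf_neq0 ?gt_eqF.
rewrite A1 A2; move: g0 q0 p2 qq.
move: (Gamma_fun ((sigma + 1) / 2)) (Gamma_fun ((sigma - 1) / 2)) => u v.
move: (Num.sqrt pi : R) (2 `^ (1 - sigma) : R) (Gamma_fun (sigma / 2)) => a b c c0 a0 b0 <-.
by field; rewrite !gt_eqF.
Qed.

(** Once |s| / Re s is bounded by the exponential, the claim is the hypothesis times a positive
    constant: k + 1 - sigma = m / 2 - sigma makes the powers of pi and h match. *)
Lemma upper_le_lower (m h N k : R) : 0 < h -> 0 < N -> k = m / 2 - 1 -> 0 < k -> sigma < m / 2 ->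
  expR (pi / 2 * `|complex.Im s|) * Gamma_fun ((sigma + 1) / 2) * Gamma_fun ((sigma - 1) / 2)
    * (2 `^ k / Gamma_fun k) * ((pi / (N * h)) `^ (m / 2 - sigma) / (m / 2 - sigma)) <= pi ->
  h * (norm_Re_ratio s * Gamma_average s) * (4 * pi / h) `^ (1 - sigma) *
   (N^-1 `^ (m / 2 - sigma) / (m / 2 - sigma)) <=
  h * (h / (2 * pi)) `^ k * (Gamma_fun k / 2).
Proof.
move=> h0 N0 kE k0 sm; set q := m / 2 - sigma; have q0 : 0 < q by rewrite subr_gt0.
have p0 : 0 < pi :> R := pi_gt0 R.
have iV (x y : R) : 0 < x -> x^-1 `^ y = (x `^ y)^-1.
  by move=> x0; rewrite -powR_inv1 ?(ltW x0)// powRAC powR_inv1// powR_ge0.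
have V0 (x : R) : 0 < x -> 0 <= x^-1 by move=> x0; rewrite invr_ge0 ltW.
have -> : (pi / (N * h)) `^ q = (pi `^ k * pi `^ (1 - sigma)) * N^-1 `^ q * (h `^ q)^-1.
  rewrite invfM mulrA !powRM ?mulr_ge0 ?V0 ?(ltW p0)// (iV h)//.
  by rewrite (@powRD_gt0 R pi k (1 - sigma) q)// kE /q; ring.
have -> : (4 * pi / h) `^ (1 - sigma) = 4 `^ (1 - sigma) * pi `^ (1 - sigma) * (h `^ (1 - sigma))^-1.
  by rewrite !powRM ?mulr_ge0 ?V0 ?(ltW p0)// (iV h).
have -> : (h / (2 * pi)) `^ k = h `^ k * (2 `^ k)^-1 * (pi `^ k)^-1.
  by rewrite invfM mulrA !powRM ?mulr_ge0 ?V0 ?(ltW p0) ?(ltW h0)// !iV.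
have -> : h `^ q = h `^ k * h `^ (1 - sigma) by rewrite (@powRD_gt0 R h k (1 - sigma) q)// kE /q; ring.
have gE := Gamma_averageE; have eE := norm_Re_ratio_le s1.
have g1 : 0 < Gamma_fun ((sigma + 1) / 2).
  by apply: Gamma_fun_gt0; rewrite divr_gt0// addr_gt0// (lt_trans ltr01).
have g2 : 0 < Gamma_fun ((sigma - 1) / 2) by apply: Gamma_fun_gt0; rewrite divr_gt0// subr_gt0.
have gk : 0 < Gamma_fun k by exact: Gamma_fun_gt0.
have w1 : 0 < pi `^ k by rewrite powR_gt0.
have w2 : 0 < pi `^ (1 - sigma) by rewrite powR_gt0.
have w3 : 0 < N^-1 `^ q by rewrite powR_gt0// invr_gt0.
have w4 : 0 < h `^ k by rewrite powR_gt0.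
have w5 : 0 < h `^ (1 - sigma) by rewrite powR_gt0.
have w6 : 0 < 2 `^ k :> R by rewrite powR_gt0.
have e0 := norm_Re_ratio_ge0 s.
move: gE eE e0 g1 g2 gk w1 w2 w3 w4 w5 w6.
move: (Gamma_average s) (norm_Re_ratio s) (expR _) (Gamma_fun k) (4 `^ _) => G E E' gk four.
move: (Gamma_fun ((sigma + 1) / 2)) (Gamma_fun ((sigma - 1) / 2)) => g1 g2.
move: (pi `^ k) (pi `^ (1 - sigma)) (N^-1 `^ q) (h `^ k) (h `^ (1 - sigma)) (2 `^ k) => a b c d e f.
move=> gE eE e0 g10 g20 gk0 a0 b0 c0 d0 ee0 f0 H.
move: p0 gE H; move: (pi : R) => P p0 gE H; clearbody q.
have -> : h * (E * G) * (four * b * e^-1) * (c / q) = h / 2 * (E * (g1 * g2 * b * c / (P * e * q))).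
  rewrite [LHS](_ : _ = h * E * (four * G) * b * e^-1 * (c / q)); last by ring.
  by rewrite gE; field; rewrite !gt_eqF.
have -> : h * (d * f^-1 * a^-1) * (gk / 2) = h / 2 * (d * gk / (f * a)).
  by field; rewrite !gt_eqF.
rewrite ler_pM2l ?divr_gt0//.
apply: (@le_trans _ _ (E' * (g1 * g2 * b * c / (P * e * q)))).
  by rewrite ler_wpM2r// divr_ge0 ?mulr_ge0// ltW.
(* The constant by which the hypothesis is multiplied, after division of the claim by h / 2. *)
have K0 : 0 < d * gk / (f * a * P) by rewrite divr_gt0 ?mulr_gt0.
have := H; rewrite -(ler_pM2l K0) => H'.
rewrite [leLHS](_ : _ = d * gk / (f * a * P) * (E' * g1 * g2 * (f / gk) * (a * b * c / (d * e) / q))); last first.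
  by field; rewrite !gt_eqF.
by apply: (le_trans H'); rewrite le_eqVlt; apply/orP; left; apply/eqP; field; rewrite !gt_eqF.
Qed.

End Numeric.

(** * Non-vanishing *)

Section Nonvanishing.
Context {R : realType}.
Local Notation RT := (measurableTypeR R).
Local Notation mu := (@lebesgue_measure R).
Variables (m : R) (w : nat) (G : set (Mp2 R)) (chi : Mp2 R -> R[i]) (h : R) (s : R[i]).
Hypotheses (hw : w%:R = 2 * m) (hG : is_subgroup G) (hdisc : discrete_set G).
Hypothesis hchi : finite_order_character G chi.
Hypotheses (h0 : 0 < h) (s1 : 1 < complex.Re s).
Hypothesis hwidth : set_mulg Mp2_center (stab_infty G) =
  set_mulg Mp2_center (cyclic_subgroup (Mp2_n h)).
Hypothesis Psi0 : Psi G w chi h s = (fun=> 0).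
Local Notation cosets := (right_cosets (stab_infty G) G).
Local Notation N := (min_lower_entry G).

Lemma exists_improper : exists A : cosets, ~~ proper_coset A.
Proof.
have H : right_cosets (stab_infty G) G [set (t * 1)%g | t in stab_infty G].
  by exists 1%g => //; exact: (subgroup1 hG).
exists (SigSub (mem_set H)); set A := SigSub _.
have [GA vA] := coset_reprP hG A.
have : val A (coset_repr A) by rewrite vA; exists 1%g; [exact: (stab1 hG)|rewrite mul1g].
rewrite /A /= => -[t /stab_inftyE[_ ct] tE]; rewrite /proper_coset -/A -tE mulg1 ct eqxx //.
Qed.

(** The representative of the improper coset translates by a multiple of h, so by periodicity its
    term has the size of the value at (x, y) itself. *)
Lemma weighted_absF_le_nneseries (A0 : cosets) (x y : R) (f : cosets -> nat) (b : nat -> \bar R) :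
  ~~ proper_coset A0 -> 0 < y -> (forall n, (0 <= b n)%E) ->
  (forall A B, proper_coset A -> proper_coset B -> f A = f B -> A = B) ->
  (forall A, proper_coset A -> b (f A) = weighted_absF m h s (actR (Mp2_proj (coset_repr A)) (x, y))) ->
  (weighted_absF m h s (x, y) <= \sum_(n <oo) b n)%E.
Proof.
move=> iA0 y0 b0 fI bf.
have pr A : A != A0 -> proper_coset A.
  by move=> AA; apply: contraNT AA => iA; apply/eqP; exact: (improper_coset_uniq hG iA iA0).
have [GA0 _] := coset_reprP hG A0.
have -> : weighted_absF m h s (x, y) = weighted_absF m h s (actR (Mp2_proj (coset_repr A0)) (x, y)).
  have /stab_translates : stab_infty G (coset_repr A0).
    by apply/stab_inftyE; split => //; move: iA0; rewrite /proper_coset negbK => /eqP.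
  by move=> /(_ _ hwidth)[k tk]; rewrite (actR_translates _ _ tk) weighted_absF_period.
rewrite (weighted_absF_slash hw h0 s1 hchi x y0 GA0).
have := congr1 (fun F => F (@Uhp R (x +i* y) y0)) Psi0; rewrite /Psi => P0.
apply: (sum_eq0_nneseries (f := f) _ P0) => //.
- by rewrite powR_gt0.
- by move=> A B /pr pA /pr pB; exact: fI.
- move=> A /pr pA; have [GA _] := coset_reprP hG A.
  by rewrite bf// (weighted_absF_slash hw h0 s1 hchi x y0 GA).
Qed.

(** Otherwise the improper coset is alone, and Psi = 0 makes |F| vanish on the line y = 1, against
    [integral_absF_ge]. Such an element is what makes N the infimum of a nonempty set. *)
Lemma exists_lower_entry : exists2 g, G g & Mp2_proj g 1 0 != 0.
Proof.
apply: contrapT => H.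
have imp (A : cosets) : ~~ proper_coset A.
  by apply/negP => pA; apply: H; exists (coset_repr A) => //; exact: (coset_reprP hG A).1.
have [A0 _] := exists_improper.
have phi0 x : (absF h s (x, 1%R) <= 0)%E.
  have z : (\sum_(n <oo) (fun=> 0%E : \bar R) n = 0)%E by apply: eseries0.
  have -> : absF h s (x, 1%R) = weighted_absF m h s (x, 1%R) by rewrite /weighted_absF powR1 mule1.
  rewrite -[leRHS]z; apply: (@weighted_absF_le_nneseries A0 x 1 (fun=> 0%N)) => //.
  - by move=> A B pA; have := imp A; rewrite pA.
  - by move=> A pA; have := imp A; rewrite pA.
have := integral_absF_ge h0 s1 (@ltr01 R).
rewrite (_ : integral _ _ _ = 0%E); last first.
  apply: integral0_eq => x _; apply/eqP; rewrite eq_le absF_ge0 andbT; exact: phi0.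
by rewrite lee_fin leNgt mulr_gt0// expR_gt0.
Qed.

Lemma cusp_stripE : cusp_strip G h = `[0, h[%classic `*` `]N^-1, +oo[%classic :> set (RT * RT).
Proof.
by apply/seteqP; split => p /=; rewrite !in_itv/= andbT => -[].
Qed.

Lemma measurable_cusp_strip : measurable (cusp_strip G h : set (RT * RT)).
Proof. by rewrite cusp_stripE; apply: measurableX; exact: measurable_itv. Qed.

Lemma hyp_strip_le :
  (hyp_integral (fun p : RT * RT => ((0 <= p.1 < h) && (N^-1 < p.2))%R%:R%:E * weighted_absF m h s p) <=
   hyp_integral (fun p : RT * RT => ((0 <= p.1 < h) && (p.2 <= N^-1))%R%:R%:E * weighted_absF m h s p))%E.
Proof.
have [g0 Gg0 cg0] := exists_lower_entry.
have N0 : 0 < N.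
  by apply: lt_le_trans (min_lower_entry_ge hG hdisc h0 hwidth Gg0 cg0); rewrite invr_gt0.
have [A0 iA0] := exists_improper.
have [f fI] := coset_enum hG h0 hwidth N0.
(* A partial inverse of [f] on the proper cosets, so that they can be summed over [nat]. *)
pose e n : option cosets :=
  if pselect (exists A, proper_coset A /\ f A = n) is left H then Some (projT1 (cid H)) else None.
have eS n A : e n = Some A -> proper_coset A /\ f A = n.
  by rewrite /e; case: pselect => // H [<-]; case: (cid H).
have ef A : proper_coset A -> e (f A) = Some A.
  move=> pA; rewrite /e; case: pselect => [H|[]]; last by exists A.
  by case: (cid H) => B /= [pB fB]; congr Some; exact: fI.
(* Off the range of [f] the set is empty; [g0] fills these indices because [hyp_unfold] asks for a
   nonzero lower left entry at every index. *)
pose S n : set (RT * RT) := if e n is Some _ then cusp_strip G h else set0.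
pose g n := Mp2_proj (if e n is Some A then coset_repr A else g0).
have mS n : measurable (S n) by rewrite /S; case: (e n) => *; [exact: measurable_cusp_strip|exact: measurable0].
have cg n : g n 1 0 != 0.
  by rewrite /g; case E : (e n) => [A|//]; case: (eS _ _ E).
have mphi := measurable_weighted_absF m h s.
pose b n (p : RT * RT) : \bar R := ((\1_(S n) p)%:E * weighted_absF m h s (actR (g n) p))%E.
have b0 n p : (0 <= b n p)%E by rewrite mule_ge0 ?weighted_absF_ge0// lee_fin.
have mb n : measurable_fun setT (b n).
  apply: emeasurable_funM; first by apply/measurable_EFinP; exact: measurable_indic.
  by apply: (measurableT_comp mphi); exact: measurable_actR.
apply: (@le_trans _ _ (\sum_(n <oo) hyp_integral (b n))%E); last first.
  apply: (@hyp_unfold R h N^-1 S g (weighted_absF m h s) h0 mS cg mphi (weighted_absF_ge0 m h s)).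
  - by move=> k x y; exact: weighted_absF_period.
  - move=> x y n k n' k' y0 _; rewrite /S /g.
    case E : (e n) => [A|//]; case E' : (e n') => [A'|//] sA sA'.
    have [pA fA] := eS _ _ E; have [pA' fA'] := eS _ _ E'.
    have [GA _] := coset_reprP hG A; have [GA' _] := coset_reprP hG A'.
    have [[d sd dE] kk] := coset_separation hG h0 hwidth N0 GA GA' pA' y0 sA sA'.
    have AA : A = A' by exact: (coset_repr_inj hG sd dE).
    split; first by rewrite -fA -fA' AA.
    by apply: zenum_inj; apply: kk; rewrite AA.
  - move=> x y n k y0 _; rewrite /S /g; case E : (e n) => [A|//] sA.
    have [pA _] := eS _ _ E; have [GA _] := coset_reprP hG A.
    exact: ltW (strip_below N0 GA pA y0 sA).
rewrite hyp_nneseries//; apply: le_hyp.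
- have mi : measurable_fun setT (fun p : RT * RT => (\1_(cusp_strip G h : set (RT * RT)) p : R)%:E).
    by apply/measurable_EFinP; apply: measurable_indic; exact: measurable_cusp_strip.
  have := emeasurable_funM mi mphi; apply: eq_measurable_fun => p _; rewrite /= indicE.
  congr (((_ : bool)%:R)%:E * _)%E; apply/idP/idP; first by rewrite inE => -[-> ->].
  by move=> /andP[H1 H2]; rewrite inE.
- by apply: ge0_emeasurable_sum => // n p _ _; exact: b0.
- by move=> p; rewrite mule_ge0 ?weighted_absF_ge0// lee_fin ler0n.
move=> x y y0 /=; case: (boolP ((0 <= x < h) && (N^-1 < y))%R) => [/andP[xh yN]|_]; last first.
  by rewrite mul0e; apply: nneseries_ge0 => n _ _; exact: b0.
rewrite mul1e; apply: (@weighted_absF_le_nneseries A0 x y f) => //.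
move=> A pA; rewrite /b /S /g ef// indicE mem_set ?mul1e//.
Qed.

End Nonvanishing.

Theorem theorem6p3 (R : realType) (m : R) (w : nat)
    (hm : exists k : nat, m = 5 / 2 + k%:R) (hw : w%:R = 2 * m)
    (G : set (Mp2 R)) (hG : is_subgroup G) (hdisc : discrete_set G)
    (hcov : finite_covolume G) (hcusp : is_cusp (Mp2_proj @` G) None)
    (chi : Mp2 R -> R[i]) (hchi : finite_order_character G chi)
    (hchi_infty : forall g, stab_infty G g ->
       forall z : uhp R, Mp2_eta g z ^- w = chi g)
    (h : R) (hh : 0 < h)
    (hwidth : set_mulg Mp2_center (stab_infty G) =
              set_mulg Mp2_center (cyclic_subgroup (Mp2_n h)))
    (N : R) (hN : N = min_lower_entry G)
    (hmN : 4 * pi / (N * h) + 8 / 3 <= m)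
    (s : R[i]) (hs1 : 1 < complex.Re s) (hs2 : complex.Re s < m / 2)
    (hbound :
       expR (pi / 2 * `|complex.Im s|)
       * Gamma_fun ((complex.Re s + 1) / 2)
       * Gamma_fun ((complex.Re s - 1) / 2)
       * (2 `^ (m / 2 - 1) / Gamma_fun (m / 2 - 1))
       * ((pi / (N * h)) `^ (m / 2 - complex.Re s) / (m / 2 - complex.Re s))
       <= pi) :
  Psi G w chi h s <> (fun=> 0).
Proof.
move=> Psi0.
have [g0 Gg0 cg0] := exists_lower_entry hw hG hchi hh hs1 hwidth Psi0.
have N0 : 0 < N.
  by rewrite hN; apply: lt_le_trans (min_lower_entry_ge hG hdisc hh hwidth Gg0 cg0); rewrite invr_gt0.
have H := hyp_strip_le hw hG hdisc hchi hh hs1 hwidth Psi0; rewrite -hN in H.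
have NV0 : 0 < N^-1 by rewrite invr_gt0.
set k := m / 2 - 1 in hbound; have k0 : 0 < k by rewrite subr_gt0 (lt_trans hs1).
have p0 := pi_gt0 R.
have a0 : 0 < 2 * pi * N^-1 / h by rewrite divr_gt0// mulr_gt0// mulr_gt0.
(* Half of the lower bound for m, as k - 1/3 = m / 2 - 4/3. *)
have ak : 2 * pi * N^-1 / h <= k - 3^-1.
  have E : 4 * pi / (N * h) = 2 * (2 * pi * N^-1 / h) by field; rewrite !gt_eqF.
  by rewrite /k; move: hmN; rewrite E; lra.
have L := gamma_median a0 ak.
have lo := hyp_lower hh hs1 NV0 (erefl k).
have up := hyp_upper hh hs1 NV0 hs2.
have num := upper_le_lower hs1 hh N0 (erefl k) k0 hs2 hbound.
have C0 : 0 < h * (h / (2 * pi)) `^ k by rewrite mulr_gt0// powR_gt0// divr_gt0// mulr_gt0.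
rewrite -lee_fin in num.
(* The chain bounds the incomplete gamma integral by half of Gamma k, up to a common positive
   factor, against the strict inequality [L]. *)
have := le_trans lo (le_trans H (le_trans up num)).
by rewrite [X in (_ <= X)%E]EFinM leNgt lte_pmul2l// L.
Qed.
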